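(* Fix $r\ge 2$ and $\pi\in\mathfrak{S}_r$. Let $(q_n)$ be a sequence in $(0,1)$ with $n^{3/2}(1-q_n)\to 0$ as $n\to\infty$, and for each $n$ let $\tau_n\sim\mathrm{Mallows}(n,q_n)$. Then, in distribution as $n\to\infty$, $$\frac{\mathrm{Occ}(\pi,\tau_n)-\frac{1}{r!}\binom{n}{r}}{n^{r-1/2}}\longrightarrow \mathcal{N}(0,\nu_\pi^2),$$ where $\nu_\pi>0$ is the same constant as for uniformly random permutations (see context). This also holds jointly for any finite family of patterns: if $\pi^{(1)},\dots,\pi^{(m)}$ are patterns of sizes $r_1,\dots,r_m\ge2$, the random vector with entries $n^{-(r_i-1/2)}\big(\mathrm{Occ}(\pi^{(i)},\tau_n)-\frac{1}{r_i!}\binom{n}{r_i}\big)$, $1\le i\le m$, converges in distribution to a centered Gaussian vector with the same covariances $\nu_{\pi^{(i)},\pi^{(j)}}$ as in the case of uniformly random permutations.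
   Context: $[n]=\{1,\dots,n\}$ and $\mathfrak{S}_n$ is the symmetric group on $[n]$. For $\sigma\in\mathfrak{S}_n$, $\mathrm{inv}(\sigma)$ is the number of pairs $i<j$ with $\sigma(i)>\sigma(j)$. $\mathrm{Mallows}(n,q)$ is the probability measure on $\mathfrak{S}_n$ giving mass $q^{\mathrm{inv}(\sigma)}/Z_{n,q}$ to $\sigma$, where $Z_{n,q}=\prod_{k=1}^n\frac{1-q^k}{1-q}$. For $\tau\in\mathfrak{S}_n$ and $I=\{i_1<\dots<i_r\}\subseteq[n]$, $\mathrm{pat}(I,\tau)$ is the permutation $\sigma\in\mathfrak{S}_r$ with $\sigma(j)<\sigma(k)\iff\tau(i_j)<\tau(i_k)$ for all $j,k\in[r]$, and for $\pi\in\mathfrak{S}_r$, $\mathrm{Occ}(\pi,\tau)=|\{I\subseteq[n]:\mathrm{pat}(I,\tau)=\pi\}|$. $\mathcal{N}(0,\nu^2)$ is the centered normal law with variance $\nu^2$. Uniform case (known theorem of Janson, Nakamura and Zeilberger, which defines the constants): if $u_n\sim\mathrm{Unif}(\mathfrak{S}_n)$, then for every $r\ge2$ and $\pi\in\mathfrak{S}_r$, $n^{-(r-1/2)}\big(\mathrm{Occ}(\pi,u_n)-\frac1{r!}\binom nr\big)$ converges in distribution to $\mathcal{N}(0,\nu_\pi^2)$ for some $\nu_\pi>0$, jointly for any finite family of patterns and with convergence of all moments. Hence the covariances of the limiting Gaussian family are $\nu_{\pi,\rho}=\lim_{n\to\infty} n^{-(|\pi|+|\rho|-1)}\,\mathrm{Cov}\big[\mathrm{Occ}(\pi,u_n),\mathrm{Occ}(\rho,u_n)\big]$,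 and $\nu_\pi^2=\nu_{\pi,\pi}$, where $|\pi|$ denotes the size of $\pi$. *)

(* Defs.v *)
From HB Require Import structures.
From mathcomp Require Import all_boot all_order all_algebra all_fingroup.
From mathcomp Require Import all_classical all_reals all_analysis.

Set Implicit Arguments.
Unset Strict Implicit.
Unset Printing Implicit Defensive.

Import Order.TTheory GRing.Theory Num.Theory.
Import numFieldTopology.Exports numFieldNormedType.Exports.

Local Open Scope classical_set_scope.
Local Open Scope ring_scope.

(** Permutations of [n] are elements of ['S_n], with [n] shifted to
    [0, ..., n-1]. *)

Definition inv_perm (n : nat) (s : 'S_n) : nat :=
  #|[set p : 'I_n * 'I_n | (p.1 < p.2)%N && (s p.2 < s p.1)%N]%SET|.

Definition mallows_Z (R : realType) (n : nat) (q : R) : R :=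
  \prod_(1 <= k < n.+1) ((1 - q ^+ k) / (1 - q)).

Definition mallows_mass (R : realType) (n : nat) (q : R) (s : 'S_n) : R :=
  q ^+ inv_perm s / mallows_Z n q.

(** The random permutation [tau], defined on the probability space
    [(Omega, P)], has law Mallows(n, q); ['S_n] is discrete and finite. *)
Definition mallows_rv (R : realType) (d : measure_display)
    (Omega : measurableType d) (P : probability Omega R) (n : nat) (q : R)
    (tau : Omega -> 'S_n) : Prop :=
  forall s : 'S_n, measurable (tau @^-1` [set s]) /\
    P (tau @^-1` [set s]) = (mallows_mass q s)%:E.

(** [has_pat I tau pi] says that [I = {i_0 < ... < i_(r-1)}] and that
    [pat (I, tau) = pi], where [e] is the enumeration [j |-> i_j]. *)
Definition has_pat (n r : nat) (I : {set 'I_n}) (tau : 'S_n) (pi : 'S_r) : bool :=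
  [exists e : {ffun 'I_r -> 'I_n},
    [&& [forall j : 'I_r, forall k : 'I_r, (j < k)%N ==> (e j < e k)%N],
        I == [set e j | j : 'I_r]%SET
      & [forall j : 'I_r, forall k : 'I_r, (pi j < pi k)%N == (tau (e j) < tau (e k))%N]]].

Definition Occ (n r : nat) (pi : 'S_r) (tau : 'S_n) : nat :=
  #|[set I : {set 'I_n} | has_pat I tau pi]%SET|.

Definition unif_mean (R : realType) (n : nat) (F : 'S_n -> R) : R :=
  (\sum_(s : 'S_n) F s) / (n`!)%:R.

Definition unif_cov (R : realType) (n : nat) (F G : 'S_n -> R) : R :=
  unif_mean (fun s => (F s - unif_mean F) * (G s - unif_mean G)).

Definition nu_cov (R : realType) (r1 r2 : nat) (pi : 'S_r1) (rho : 'S_r2) : R :=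
  limn (fun n : nat =>
    unif_cov (fun u : 'S_n => (Occ pi u)%:R : R) (fun u : 'S_n => (Occ rho u)%:R)
    / n%:R ^+ (r1 + r2).-1).

Definition nu (R : realType) (r : nat) (pi : 'S_r) : R :=
  Num.sqrt (nu_cov R pi pi).

Definition occ_normalized (R : realType) (n r : nat) (pi : 'S_r) (tau : 'S_n) : R :=
  ((Occ pi tau)%:R - (r`!)%:R^-1 * ('C(n, r))%:R) / n%:R `^ (r%:R - 2^-1).

(** Convergence in distribution of [X n], defined on [(Omega n, P n)], to [Y],
    defined on [(Omega', Q)], tested against bounded continuous functions. *)
Definition cvg_in_distribution (R : realType) (E : topologicalType)
    (d : nat -> measure_display) (Omega : forall n, measurableType (d n))
    (P : forall n, probability (Omega n) R) (X : forall n, Omega n -> E)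
    (d' : measure_display) (Omega' : measurableType d')
    (Q : probability Omega' R) (Y : Omega' -> E) : Prop :=
  forall f : E -> R, continuous f -> bounded_fun f ->
    (fun n => ('E_(P n)[fun w => f (X n w)])%E) @ \oo --> ('E_Q[fun w => f (Y w)])%E.

(** The centered normal law with variance [v].  The degenerate case is separate
    since [normal_prob m 0] is not the Dirac mass at [m]. *)
Definition centered_normal (R : realType) (v : R) : set R -> \bar R :=
  if v == 0 then \d_(0 : R) else normal_prob 0 (Num.sqrt v).

(** [G] is a centered Gaussian vector with covariance matrix [S]: every linear
    combination of its coordinates is centered normal, with the variance
    prescribed by [S]. *)
Definition centered_gaussian_vector (R : realType) (m : nat)
    (d : measure_display) (Omega : measurableType d)
    (Q : probability Omega R) (G : 'I_m -> {RV Q >-> R}) (S : 'M[R]_m) : Prop :=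
  forall (a : 'I_m -> R) (A : set R), measurable A ->
    Q ((fun w => \sum_(i < m) a i * G i w) @^-1` A) =
    centered_normal (\sum_(i < m) \sum_(j < m) a i * a j * S i j) A.

(* Main.v *)
(** Replace the uniform permutation by [n] independent uniform values in
    [{0, ..., N-1}] with [N = n^4]: these are distinct with probability
    [1 - O(n^-2)], and then their relative order is a uniform permutation.  In this
    model [Occ pi] is a generalised U-statistic.  Its Hoeffding projection is a sum of
    independent terms, one for each position, and the remainder is of order [n^-1] in
    squared [L^2] norm after normalisation.  The projection has characteristic
    function close to that of a Gaussian, with covariance converging to a limit
    which must be the one of [nu_cov]; it is positive for a single pattern because
    the kernel is bounded below in absolute value near the corner of the first
    positions and values.  Convergence in law follows from convergence of the
    characteristic functions and tightness, a bounded continuous function being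
    approximated on boxes by trigonometric polynomials.

    For the Mallows measure, put [q = exp (- l)].  The density with respect to the
    uniform law is at least [1 - l (inv - E inv) - l^2 n^3].  As [inv] is the number
    of occurrences of a pattern of size 2, its fluctuations are of order [n^(3/2)],
    so that the total variation distance is [O(l n^(3/2))], which tends to 0, and
    the uniform limit theorem carries over. *)

Require Import Defs.
From HB Require Import structures.
From mathcomp Require Import all_boot all_order all_algebra all_fingroup.
From mathcomp Require Import ring lra zify.

Set Implicit Arguments.
Unset Strict Implicit.
Unset Printing Implicit Defensive.

Import Order.TTheory GRing.Theory Num.Theory.

Local Open Scope ring_scope.

(** * Expectations of functions of independent variables *)

Section ProductExpectation.
Variables (R : realFieldType) (I T : finType).
Implicit Types (w : I -> T -> R) (F G : {ffun I -> T} -> R) (D : {set I}).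

(** Values in a finite set, rather than in the unit interval, keep every expectation a finite
    weighted sum ([pexp]): independence, conditioning and second moments need no integration, and
    measure theory enters only with the Gaussian limit. The price is ties. A normalised count is
    bounded by [sqrt n], so ties, of probability at most [n ^ 2 / N], change the mean of a product
    of two counts by at most a constant times [n ^ 3 / N]; the choice [N = n ^ 4] makes this
    [O(1 / n)]. Characteristic functions appear as means of [cos (theta + ...)] with a free phase
    [theta], which replaces complex exponentials. The constant [nu_cov] is a limit whose existence
    has to be shown: the covariance of the projections splits into products of averages of arrays
    that are polynomial in [i / n] up to [O(1 / n)], and the covariance of the counts stays close to
    it. For the Mallows law a lower bound on the density suffices because both laws have mass one,
    so that the total excess of the density over 1 equals its total deficit. *)

Definition pexp w F : R := \sum_(f : {ffun I -> T}) (\prod_i w i (f i)) * F f.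

Definition depends_on D F := forall f g : {ffun I -> T},
  {in D, f =1 g} -> F f = F g.

Definition splice D (f g : {ffun I -> T}) : {ffun I -> T} :=
  [ffun i => if i \in D then f i else g i].

Definition upd (f : {ffun I -> T}) i t : {ffun I -> T} :=
  [ffun k => if k == i then t else f k].

Lemma depends_onS D D' F : D \subset D' -> depends_on D F -> depends_on D' F.
Proof. by move=> /subsetP sDD' hF f g fg; apply: hF => i /sDD'/fg. Qed.

Lemma eq_pexp w F G : F =1 G -> pexp w F = pexp w G.
Proof. by move=> FG; apply: eq_bigr => f _; rewrite FG. Qed.

Lemma pexpD w F G : pexp w (fun f => F f + G f) = pexp w F + pexp w G.
Proof. by rewrite -big_split; apply: eq_bigr => f _; rewrite mulrDr. Qed.

Lemma pexpZ w a F : pexp w (fun f => a * F f) = a * pexp w F.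
Proof. by rewrite big_distrr; apply: eq_bigr => f _; rewrite /= mulrCA. Qed.

Lemma pexpZr w a F : pexp w (fun f => F f * a) = pexp w F * a.
Proof. by rewrite mulrC -pexpZ; apply: eq_pexp => f; rewrite mulrC. Qed.

Lemma pexpN w F : pexp w (fun f => - F f) = - pexp w F.
Proof. by rewrite -mulN1r -pexpZ; apply: eq_pexp => f; rewrite mulN1r. Qed.

Lemma pexpB w F G : pexp w (fun f => F f - G f) = pexp w F - pexp w G.
Proof. by rewrite pexpD pexpN. Qed.

Lemma pexp_sum w (J : Type) (s : seq J) (P : pred J) (F : J -> {ffun I -> T} -> R) :
  pexp w (fun f => \sum_(j <- s | P j) F j f) = \sum_(j <- s | P j) pexp w (F j).
Proof.
rewrite /pexp exchange_big; apply: eq_bigr => f _ /=.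
by rewrite mulr_sumr.
Qed.

Section Probability.
Variable w : I -> T -> R.
Hypothesis w1 : forall i, \sum_t w i t = 1.

Lemma pexp1 : pexp w (fun=> 1) = 1.
Proof.
rewrite /pexp; under eq_bigr do rewrite mulr1.
by rewrite -(bigA_distr_bigA (fun i t => w i t)) big1.
Qed.

Lemma pexp_cst a : pexp w (fun=> a) = a.
Proof.
rewrite -[RHS]mulr1 -pexp1 -pexpZ.
by apply: eq_pexp => f; rewrite mulr1.
Qed.

Lemma pexp_coord i (phi : T -> R) :
  pexp w (fun f => phi (f i)) = \sum_t w i t * phi t.
Proof.
transitivity (\sum_(f : {ffun I -> T}) \prod_k (w k (f k) * (if k == i then phi (f k) else 1))
  : R).
  rewrite /pexp; apply: eq_bigr => f _; rewrite big_split; congr (_ * _).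
  by rewrite (bigD1 i)//= eqxx big1 ?mulr1// => k /negbTE ->.
rewrite -(bigA_distr_bigA (fun k t => w k t * (if k == i then phi t else 1))).
rewrite (bigD1 i)//= [X in _ * X]big1 ?mulr1.
  by apply: eq_bigr => t _; rewrite eqxx.
by move=> k /negbTE ki; under eq_bigr do rewrite ki mulr1.
Qed.

(* Exchanging the coordinates in [D] of two independent copies preserves their
   joint law. *)
Lemma pexp_splice D (H : {ffun I -> T} -> {ffun I -> T} -> R) :
  pexp w (fun f => pexp w (fun g => H f g)) =
  pexp w (fun f => pexp w (fun g => H (splice D f g) (splice D g f))).
Proof.
have E (K : {ffun I -> T} -> {ffun I -> T} -> R) :
  pexp w (fun f => pexp w (fun g => K f g)) =
  \sum_(p : {ffun I -> T} * {ffun I -> T})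
    (\prod_i w i (p.1 i)) * (\prod_i w i (p.2 i)) * K p.1 p.2.
  rewrite /pexp; under eq_bigr do rewrite big_distrr /=.
  rewrite pair_big; apply: eq_bigr => p _; by rewrite mulrA.
rewrite !E.
pose sw (p : {ffun I -> T} * {ffun I -> T}) :=
  (splice D p.1 p.2, splice D p.2 p.1).
have swK : involutive sw.
  move=> [f g]; rewrite /sw/=; congr pair; apply/ffunP => i;
  by rewrite !ffunE; case: (i \in D).
rewrite (reindex_inj (inv_inj swK)); apply: eq_bigr => -[f g] _ /=.
congr (_ * _); rewrite -!big_split; apply: eq_bigr => i _ /=.
by rewrite !ffunE; case: (i \in D) => //; rewrite mulrC.
Qed.

(** Duplicate the variables and exchange the two copies outside [D]: [F] then reads only the first
    copy and [G] only the second, so the double expectation factors. *)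
Lemma pexpM D F G : depends_on D F -> depends_on (~: D) G ->
  pexp w (fun f => F f * G f) = pexp w F * pexp w G.
Proof.
move=> hF hG.
rewrite -pexpZr -[LHS](pexp_cst) -[LHS]/(pexp w (fun=> pexp w (fun f => F f * G f))).
rewrite -[LHS]/(pexp w (fun f => pexp w (fun g => F g * G g))).
rewrite (pexp_splice (~: D)).
have -> : pexp w (fun f => pexp w (fun g =>
    F (splice (~: D) g f) * G (splice (~: D) g f))) =
  pexp w (fun f => pexp w (fun g => F f * G g)).
  apply: eq_pexp => f; apply: eq_pexp => g; congr (_ * _).
    by apply: hF => i iD; rewrite ffunE inE iD.
  by apply: hG => i iD; rewrite ffunE iD.
by apply: eq_pexp => f; rewrite pexpZ.
Qed.

(** Resampling coordinate [i] independently does not change the law of the family; this expresses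
    conditioning on the value of that coordinate. *)
Lemma pexp_upd i F :
  pexp w F = \sum_t w i t * pexp w (fun f => F (upd f i t)).
Proof.
rewrite -(pexp_coord i (fun t => pexp w (fun f => F (upd f i t)))).
transitivity (pexp w (fun f => pexp w (fun g => F g))).
  by rewrite pexp_cst.
rewrite (pexp_splice (~: [set i])).
apply: eq_pexp => f; apply: eq_pexp => g; congr F.
by apply/ffunP => k; rewrite !ffunE !inE; case: eqP => //= ->.
Qed.

(** Conditional independence: once the only common coordinate [i] is frozen, the two factors depend
    on disjoint sets of variables. *)
Lemma pexpM_overlap i D D' F G :
  depends_on D F -> depends_on D' G -> D :&: D' \subset [set i] ->
  pexp w (fun f => F f * G f) =
  \sum_t w i t * (pexp w (fun f => F (upd f i t)) * pexp w (fun f => G (upd f i t))).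
Proof.
move=> hF hG /subsetP sDD'; rewrite (pexp_upd i); apply: eq_bigr => t _.
congr (_ * _); apply: (@pexpM D).
  move=> f g fg; apply: hF => k kD; rewrite !ffunE.
  by case: eqP => // _; exact: fg.
move=> f g fg; apply: hG => k kD'; rewrite !ffunE.
case: eqP => // /eqP ki; apply: fg; rewrite inE; apply/negP => kD.
by have := sDD' k; rewrite !inE kD kD' (negbTE ki) => /(_ isT).
Qed.

End Probability.

Section ProbabilityOrder.
Variable w : I -> T -> R.
Hypothesis w0 : forall i t, 0 <= w i t.
Hypothesis w1 : forall i, \sum_t w i t = 1.

Lemma ler_pexp F G : (forall f, F f <= G f) -> pexp w F <= pexp w G.
Proof.
move=> FG; apply: ler_sum => f _; apply: ler_wpM2l => //.
by apply: prodr_ge0.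
Qed.

Lemma pexp_ge0 F : (forall f, 0 <= F f) -> 0 <= pexp w F.
Proof. by move=> F0; rewrite -[leLHS](pexp_cst w1); exact: ler_pexp. Qed.

Lemma ler_norm_pexp F : `|pexp w F| <= pexp w (fun f => `|F f|).
Proof.
rewrite ler_norml -pexpN; apply/andP; split; apply: ler_pexp => f.
  by rewrite lerNl -normrN ler_norm.
exact: ler_norm.
Qed.

Lemma pexp_sqr_le F : pexp w F ^+ 2 <= pexp w (fun f => F f ^+ 2).
Proof.
have : 0 <= pexp w (fun f => (F f - pexp w F) ^+ 2).
  by apply: pexp_ge0 => f; exact: sqr_ge0.
have -> : pexp w (fun f => (F f - pexp w F) ^+ 2) =
    pexp w (fun f => F f ^+ 2 - 2 * pexp w F * F f + pexp w F ^+ 2).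
  by apply: eq_pexp => f; ring.
rewrite pexpD pexpB pexpZ pexp_cst//; set a := pexp w F; set b := pexp w _.
by rewrite (_ : b - 2 * a * a + a ^+ 2 = b - a ^+ 2) ?subr_ge0//; ring.
Qed.

Lemma pexp_var_sum (J : finType) (e : J -> I) (phi : J -> T -> R) :
  injective e -> (forall j, \sum_t w (e j) t * phi j t = 0) ->
  pexp w (fun f => (\sum_j phi j (f (e j))) ^+ 2) =
  \sum_j \sum_t w (e j) t * phi j t ^+ 2.
Proof.
move=> inje phi0.
under eq_pexp => f do rewrite expr2 mulr_suml.
rewrite pexp_sum; apply: eq_bigr => j _.
under eq_pexp => f do rewrite mulr_sumr.
rewrite pexp_sum (bigD1 j)//= big1 ?addr0.
  by rewrite -(pexp_coord w1 (e j) (fun t => phi j t ^+ 2)).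
move=> k kj; rewrite (pexpM w1 (D := [set e j])).
- by rewrite (pexp_coord w1 (e j) (phi j)) phi0 mul0r.
- by move=> f g fg; rewrite fg ?inE.
- by move=> f g fg; rewrite fg ?inE// (inj_eq inje).
Qed.

End ProbabilityOrder.
End ProductExpectation.

Lemma pexp_marginal (R : realFieldType) (I J T : finType) (w : I -> T -> R)
    (e : J -> I) (F : {ffun J -> T} -> R) :
  (forall i, \sum_t w i t = 1) -> injective e ->
  pexp w (fun f => F [ffun j => f (e j)]) = pexp (fun j => w (e j)) F.
Proof.
move=> w1 inje; rewrite /pexp.
rewrite (partition_big (fun f : {ffun I -> T} => [ffun j => f (e j)]) xpredT)//=.
apply: eq_bigr => z _.
transitivity (\sum_(f : {ffun I -> T} | [ffun j => f (e j)] == z)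
   (\prod_i w i (f i)) * F z).
  by apply: eq_bigr => f /eqP ->.
rewrite -big_distrl /=; congr (_ * _).
(* [v] carries the constraint [f (e j) = z j] as an indicator inside each coordinate weight, so that
   the sum over a fibre becomes a product of sums; coordinates outside the image of [e] contribute
   1. *)
pose v i t := w i t * [forall j, (e j == i) ==> (t == z j)]%:R.
transitivity (\sum_(f : {ffun I -> T}) \prod_i v i (f i)).
  rewrite [RHS](bigID (fun f : {ffun I -> T} => [ffun j => f (e j)] == z))/=.
  rewrite [X in _ + X]big1 ?addr0 => [|f fz].
    apply: eq_bigr => f /eqP fz; apply: eq_bigr => i _; rewrite /v.
    have -> : [forall j, (e j == i) ==> (f i == z j)]; last by rewrite mulr1.
    by apply/forallP => j; apply/implyP => /eqP <-; rewrite -fz ffunE.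
  have [j fzj] : exists j, f (e j) != z j.
    apply/existsP; apply: contraR fz; rewrite negb_exists => /forallP fz.
    by apply/eqP/ffunP => j; rewrite ffunE; apply/eqP; rewrite -[_ == _]negbK fz.
  rewrite (bigD1 (e j))//= /v; have -> : [forall k, (e k == e j) ==> (f (e j) == z k)] = false.
    by apply/negP => /forallP /(_ j); rewrite eqxx (negbTE fzj).
  by rewrite mulr0 mul0r.
rewrite -(bigA_distr_bigA v) (bigID (mem (e @: [set: J])))/=.
rewrite [X in _ * X]big1 ?mulr1 => [|i ie]; last first.
  rewrite -[RHS](w1 i); apply: eq_bigr => t _; rewrite /v.
  have -> : [forall j, (e j == i) ==> (t == z j)]; last by rewrite mulr1.
  apply/forallP => j; apply/implyP => /eqP eji.
  by rewrite -eji imset_f ?inE in ie.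
rewrite big_imset/=; last by move=> j k _ _; exact: inje.
apply: eq_big => [j|j _]; first by rewrite inE.
rewrite (bigD1 (z j))//= big1 ?addr0 => [|t tz]; rewrite /v.
  have -> : [forall k, (e k == e j) ==> (z j == z k)]; last by rewrite mulr1.
  by apply/forallP => k; apply/implyP => /eqP /inje ->.
have -> : [forall k, (e k == e j) ==> (t == z k)] = false; last by rewrite mulr0.
by apply/negP => /forallP /(_ j); rewrite eqxx (negbTE tz).
Qed.

(** * Patterns in sequences of independent values *)

Definition incr (r n : nat) (e : {ffun 'I_r -> 'I_n}) : bool :=
  [forall j : 'I_r, forall k : 'I_r, (j < k)%N ==> (e j < e k)%N].

Definition pat (r : nat) (pi : 'S_r) (g : 'I_r -> nat) : bool :=
  [forall j : 'I_r, forall k : 'I_r, (pi j < pi k)%N == (g j < g k)%N].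

(** Counts increasing embeddings instead of subsets, for an arbitrary sequence [g] of naturals: the
    same count then serves permutations and words with possible ties. *)
Definition occ_fun (r n : nat) (pi : 'S_r) (g : 'I_n -> nat) : nat :=
  #|[set e : {ffun 'I_r -> 'I_n} | incr e & pat pi (fun j => g (e j))]|.

Lemma patP (r : nat) (pi : 'S_r) (g : 'I_r -> nat) :
  reflect (forall j k, (g j < g k)%N = (pi j < pi k)%N) (pat pi g).
Proof.
apply: (iffP forallP) => [h j k|h j]; first by have /forallP/(_ k)/eqP := h j.
by apply/forallP => k; rewrite h.
Qed.

Lemma incr_lt (r n : nat) (e : {ffun 'I_r -> 'I_n}) : incr e ->
  forall j k, (e j < e k)%N = (j < k)%N.
Proof.
move=> /forallP h j k.
have {}h (j' k' : 'I_r) : (j' < k')%N -> (e j' < e k')%N.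
  by have /forallP/(_ k')/implyP := h j'.
have [/h //|kj|jk] := ltngtP j k; last by rewrite (val_inj jk) ltnn.
by have := h _ _ kj; lia.
Qed.

Lemma incr_inj (r n : nat) (e : {ffun 'I_r -> 'I_n}) : incr e -> injective e.
Proof.
move=> he j k ejk; apply/val_inj/eqP.
have := incr_lt he j k; have := incr_lt he k j; rewrite ejk ltnn.
by case: ltngtP.
Qed.

Lemma card_ord_lt (n j : nat) : (j <= n)%N -> #|[set k : 'I_n | (k < j)%N]| = j.
Proof.
move=> jn; rewrite -sum1dep_card -(big_ord_widen n (fun=> 1%N) jn).
by rewrite sum1_card card_ord.
Qed.

Lemma card_ord_gt (n j : nat) : (j < n)%N -> #|[set k : 'I_n | (j < k)%N]| = (n.-1 - j)%N.
Proof.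
move=> jn; have := cardsC [set k : 'I_n | (k < j.+1)%N].
rewrite card_ord card_ord_lt//.
have -> : ~: [set k : 'I_n | (k < j.+1)%N] = [set k : 'I_n | (j < k)%N].
  by apply/setP => k; rewrite !inE -leqNgt.
lia.
Qed.

(** The index of a point is recovered from the image set alone, as its rank there; hence an
    increasing enumeration is determined by its image. *)
Lemma incr_rank (r n : nat) (e : {ffun 'I_r -> 'I_n}) (j : 'I_r) : incr e ->
  #|[set x in [set e k | k : 'I_r] | (x < e j)%N]| = j.
Proof.
move=> he; rewrite -[RHS](card_ord_lt (ltnW (ltn_ord j))) -(card_imset _ (incr_inj he)).
apply: eq_card => x; rewrite !inE; apply/andP/imsetP => [[/imsetP[k _ ->]]|[k]].
  by rewrite (incr_lt he) => kj; exists k; rewrite ?inE.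
by rewrite inE => kj ->; rewrite (incr_lt he) imset_f.
Qed.

Lemma incr_imset_inj (r n : nat) (e e' : {ffun 'I_r -> 'I_n}) :
  incr e -> incr e' -> [set e k | k : 'I_r] = [set e' k | k : 'I_r] -> e = e'.
Proof.
move=> he he' E; apply/ffunP => j.
have /imsetP[k _ ejk] : e j \in [set e' k | k : 'I_r] by rewrite -E imset_f.
rewrite ejk; congr (e' _); apply/val_inj => /=.
by rewrite -(incr_rank j he) -(incr_rank k he') E ejk.
Qed.

Lemma incr_enum (r n : nat) (I : {set 'I_n}) : #|I| = r ->
  exists2 e : {ffun 'I_r -> 'I_n}, incr e & [set e k | k : 'I_r] = I.
Proof.
move=> cI; pose e := [ffun k : 'I_r => enum_val (cast_ord (esym cI) k)].
have srt : sorted (fun x y : 'I_n => (x < y)%N) (enum I).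
  rewrite /enum_mem -enumT; apply: sorted_filter; first by move=> ? ? ?; exact: ltn_trans.
  by have := iota_ltn_sorted 0 n; rewrite -val_enum_ord sorted_map.
exists e.
  apply/forallP => j; apply/forallP => k; apply/implyP => jk; rewrite !ffunE.
  have x0 := e j; rewrite !(enum_val_nth x0).
  apply: (sorted_ltn_nth (leT := fun x y : 'I_n => (x < y)%N)) => //=.
  - by move=> ? ? ?; exact: ltn_trans.
  - by rewrite inE -cardE cI.
  - by rewrite inE -cardE cI.
apply/setP => x; apply/imsetP/idP => [[k _ ->]|xI].
  by rewrite ffunE enum_valP.
exists (cast_ord cI (enum_rank_in xI x)) => //.
by rewrite ffunE cast_ordK enum_rankK_in.
Qed.

Lemma Occ_occ_fun (r n : nat) (pi : 'S_r) (tau : 'S_n) :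
  Occ pi tau = occ_fun pi (fun i => tau i).
Proof.
rewrite /Occ /occ_fun.
rewrite -(card_in_imset (f := fun e : {ffun 'I_r -> 'I_n} => [set e k | k : 'I_r])).
  apply: eq_card => I; rewrite inE; apply/existsP/imsetP => [[e /and3P[he /eqP -> hp]]|[e]].
    exists e => //; rewrite inE; apply/andP; split; first exact: he.
    exact: hp.
  rewrite inE => /andP[he hp] ->; exists e; apply/and3P; split => //; exact: hp.
move=> e e'; rewrite !inE => /andP[he _] /andP[he' _]; exact: incr_imset_inj.
Qed.

(* An increasing [e] with [e j = i] amounts to [j] values below [i] and
   [r - 1 - j] values above it. *)
Lemma card_incr_at (r n : nat) (j : 'I_r) (i : 'I_n) :
  #|[set e : {ffun 'I_r -> 'I_n} | incr e & e j == i]| =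
  ('C(i, j) * 'C(n.-1 - i, r.-1 - j))%N.
Proof.
pose L := [set x : 'I_n | (x < i)%N]; pose U := [set x : 'I_n | (i < x)%N].
have cL : #|L| = i by rewrite card_ord_lt// ltnW.
have cU : #|U| = (n.-1 - i)%N by rewrite card_ord_gt.
pose im (e : {ffun 'I_r -> 'I_n}) := [set e k | k : 'I_r].
have splitI (I : {set 'I_n}) : i \in I -> I = i |: ((I :&: L) :|: (I :&: U)).
  move=> iI; apply/setP => x; rewrite !inE -andb_orr -neq_ltn.
  by have [->|/negbTE] := eqVneq x i; [rewrite iI | move=> xi; rewrite (inj_eq val_inj) xi andbT].
have cardI (I : {set 'I_n}) : i \in I -> #|I| = (#|I :&: L| + #|I :&: U|).+1.
  move=> iI; rewrite {1}(splitI _ iI) cardsU1 !inE ltnn !andbF/= add1n.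
  rewrite cardsU; have -> : I :&: L :&: (I :&: U) = set0; last by rewrite cards0 subn0.
  by apply/setP => x; rewrite !inE; apply/negP => /and3P[/andP[_ a] _]; lia.
rewrite -{1}cL -{1}cU -!cards_draws -cardsX.
rewrite -(card_in_imset (f := fun e => (im e :&: L, im e :&: U))); last first.
  move=> e e'; rewrite !inE => /andP[he /eqP ei] /andP[he' /eqP ei'] [EL EU].
  apply: incr_imset_inj => //; rewrite -/(im e) -/(im e').
  have ie : i \in im e by rewrite -ei imset_f.
  have ie' : i \in im e' by rewrite -ei' imset_f.
  by rewrite (splitI _ ie) [RHS](splitI _ ie') EL EU.
apply: eq_card => -[A B]; rewrite !inE/=; apply/imsetP/idP => [[e]|].
  rewrite inE => /andP[he /eqP ei] [-> ->].
  have ie : i \in im e by rewrite -ei imset_f.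
  have cr : #|im e :&: L| = j.
    by rewrite -[RHS](incr_rank j he) ei; apply: eq_card => x; rewrite !inE.
  have := cardI _ ie; rewrite card_imset ?card_ord; last exact: incr_inj.
  by rewrite cr !subsetIr eqxx/=; move: #|_| => u; lia.
move=> /andP[/andP[AL /eqP cA] /andP[BU /eqP cB]].
pose I := i |: (A :|: B).
have iI : i \in I by rewrite !inE eqxx.
have IL : I :&: L = A.
  apply/setP => x; rewrite !inE; have := subsetP AL x; have := subsetP BU x.
  rewrite !inE; case: (x \in A) => [_ /(_ isT) xi|].
    by rewrite orbT xi.
  case: (x \in B) => [/(_ isT) ix _|_ _]; first by apply/negbTE; lia.
  by rewrite !orbF; case: eqP => // ->; rewrite ltnn.
have IU : I :&: U = B.
  apply/setP => x; rewrite !inE; have := subsetP AL x; have := subsetP BU x.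
  rewrite !inE; case: (x \in B) => [/(_ isT) xi _|_].
    by rewrite !orbT xi.
  case: (x \in A) => [/(_ isT) ix|_]; first by apply/negbTE; lia.
  by rewrite !orbF; case: eqP => // ->; rewrite ltnn.
have cI : #|I| = r by rewrite (cardI _ iI) IL IU cA cB; have := ltn_ord j; lia.
have [e he eI] := incr_enum cI.
exists e; last by rewrite /im eI IL IU.
rewrite inE he/=; move: iI; rewrite -eI => /imsetP[k _ ik]; rewrite ik.
apply/eqP; congr (e _); apply/val_inj => /=.
rewrite -(incr_rank k he) -ik eI -cA -IL.
by apply: eq_card => x; rewrite !inE.
Qed.

Lemma card_perm_lt (n : nat) (s : 'S_n) (i : 'I_n) : #|[set k | (s k < s i)%N]| = s i.
Proof.
rewrite -[RHS](card_ord_lt (ltnW (ltn_ord (s i)))) -(card_imset _ (@perm_inj _ s)).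
apply: eq_card => x; rewrite !inE; apply/imsetP/idP => [[k]|xi].
  by rewrite inE => ? ->.
by exists (s^-1%g x); rewrite ?inE permKV.
Qed.

Lemma pat_uniq (n : nat) (s s' : 'S_n) (g : 'I_n -> nat) :
  pat s g -> pat s' g -> s = s'.
Proof.
move=> /patP h /patP h'; apply/permP => i; apply/val_inj => /=.
rewrite -(card_perm_lt s) -(card_perm_lt s').
by apply: eq_card => k; rewrite !inE -h h'.
Qed.

Lemma pat_injective (n : nat) (s : 'S_n) (g : 'I_n -> nat) : pat s g -> injective g.
Proof.
move=> /patP h i k gik; apply: (@perm_inj _ s); apply/val_inj.
have := h i k; have := h k i; rewrite gik ltnn.
by case: ltngtP.
Qed.

(** The permutation sends [i] to the rank of [g i] among all the values. *)
Lemma pat_exists (n : nat) (g : 'I_n -> nat) : injective g -> exists s : 'S_n, pat s g.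
Proof.
move=> injg; pose rk (i : 'I_n) := #|[set k | (g k < g i)%N]|.
have rk_lt i k : (g i < g k)%N -> (rk i < rk k)%N.
  move=> ik; apply/proper_card/properP; split.
    by apply/subsetP => x; rewrite !inE => /ltn_trans; apply.
  by exists i; rewrite !inE ?ltnn.
have rkn i : (rk i < n)%N.
  rewrite -[X in (_ < X)%N]card_ord -cardsT; apply/proper_card/properP; split => //.
  by exists i; rewrite !inE ?ltnn.
have injrk : injective (fun i => Ordinal (rkn i)).
  move=> i k [] E; apply: injg; have := rk_lt i k; have := rk_lt k i.
  by rewrite E ltnn; case: ltngtP => // _ h1 h2; [have := h1 isT | have := h2 isT].
exists (perm injrk); apply/patP => i k; rewrite !permE /=.
have := rk_lt i k; have := rk_lt k i; case: (ltngtP (g i) (g k)) => [||gik].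
- by move=> _ _ /(_ isT) ->.
- by move=> _ /(_ isT) h _; apply/esym/negbTE; rewrite -leqNgt ltnW.
- by rewrite (injg _ _ gik) ltnn.
Qed.

Lemma occ_fun_pat (r n : nat) (pi : 'S_r) (s : 'S_n) (g : 'I_n -> nat) :
  pat s g -> occ_fun pi g = occ_fun pi (fun i => s i).
Proof.
move=> /patP h; apply: eq_card => e; rewrite !inE; congr (_ && _).
by apply/patP/patP => H j k; rewrite -H ?h.
Qed.

(** Permuting positions maps the words of pattern [s] bijectively onto the increasing ones. All
    patterns are thus equally likely, which is how independent values produce a uniform
    permutation. *)
Lemma card_pat (n N : nat) (s : 'S_n) :
  #|[set Y : {ffun 'I_n -> 'I_N} | pat s (fun i => Y i)]| =
  #|[set Y : {ffun 'I_n -> 'I_N} | pat 1%g (fun i : 'I_n => Y i)]|.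
Proof.
pose h (t : 'S_n) (Y : {ffun 'I_n -> 'I_N}) := [ffun i => Y (t i)].
have hK t : cancel (h t) (h t^-1%g).
  by move=> Y; apply/ffunP => i; rewrite !ffunE permKV.
rewrite -(card_imset _ (can_inj (hK s^-1%g))); apply: eq_card => Y.
rewrite [RHS]inE; apply/imsetP/patP => [[Z]|hY].
  rewrite inE => /patP hZ -> j k; rewrite !ffunE !perm1.
  by rewrite hZ !permKV.
exists (h s Y); last by rewrite hK.
by rewrite inE; apply/patP => j k; rewrite !ffunE hY !perm1.
Qed.

(** * Uniform words, ties, and the passage to uniform permutations *)

Section UniformValues.
Variables (R : realFieldType) (n N : nat).
Hypothesis N0 : (0 < N)%N.

Definition unifw {I : finType} : I -> 'I_N -> R := fun _ _ => N%:R^-1.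

Lemma unifw_ge0 {I : finType} (i : I) t : 0 <= unifw i t.
Proof. by rewrite invr_ge0. Qed.

Lemma unifw_sum {I : finType} (i : I) : \sum_t unifw i t = 1.
Proof.
by rewrite sumr_const card_ord -[LHS]mulr_natr mulVf// pnatr_eq0 -lt0n.
Qed.

Lemma pexp_unifwE (I : finType) (F : {ffun I -> 'I_N} -> R) :
  pexp unifw F = (\sum_f F f) / N%:R ^+ #|I|.
Proof.
rewrite mulr_suml; apply: eq_bigr => f _.
by rewrite prodr_const exprVn mulrC.
Qed.

Local Notation Yspace := {ffun 'I_n -> 'I_N}.

(** Union bound over the ordered pairs of distinct positions, each of which agrees with probability
    [1 / N]. *)
Lemma pexp_noninjective :
  pexp unifw (fun Y : Yspace => (~~ injectiveb Y)%:R) <= n%:R ^+ 2 / N%:R.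
Proof.
apply: (@le_trans _ _ (pexp unifw (fun Y : Yspace =>
    \sum_(i : 'I_n) \sum_(k : 'I_n | k != i) (Y i == Y k)%:R))).
  apply: ler_pexp => [|Y]; first exact: unifw_ge0.
  case: (boolP (injectiveb Y)) => [_|/injectivePn[i [k ik Yik]]] /=.
    by apply: sumr_ge0 => i _; apply: sumr_ge0 => k _.
  rewrite (bigD1 i)//= (bigD1 k)/=; last by rewrite eq_sym.
  rewrite Yik eqxx -addrA lerDl addr_ge0//; apply: sumr_ge0 => // l _.
  exact: sumr_ge0.
rewrite pexp_sum expr2 -mulrA.
have -> : n%:R * (n%:R / N%:R) = \sum_(i < n) (n%:R / N%:R) :> R.
  by rewrite sumr_const card_ord mulr_natl.
apply: ler_sum => i _; rewrite pexp_sum.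
apply: (@le_trans _ _ (\sum_(k : 'I_n | k != i) N%:R^-1)); last first.
  rewrite sumr_const -[leLHS]mulr_natl ler_wpM2r ?invr_ge0// ler_nat.
  by rewrite -[X in (_ <= X)%N]card_ord max_card.
apply: ler_sum => k ki; rewrite (pexp_upd unifw_sum k).
apply: (@le_trans _ _ (\sum_t unifw k t * pexp unifw (fun Y : Yspace => (Y i == t)%:R))).
  apply: ler_sum => t _; rewrite ler_wpM2l ?unifw_ge0//.
  apply: ler_pexp => [|Y]; first exact: unifw_ge0.
  by rewrite !ffunE eqxx (negbTE (_ : i != k))// eq_sym.
rewrite -mulr_sumr -pexp_sum.
have -> : pexp unifw (fun Y : Yspace => \sum_(t : 'I_N) (Y i == t)%:R) = pexp unifw (fun _ : Yspace => 1) :> R.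
  apply: eq_pexp => Y; rewrite (bigD1 (Y i))//= eqxx big1 ?addr0// => t.
  by rewrite eq_sym => /negbTE ->.
by rewrite (pexp1 unifw_sum) mulr1.
Qed.

(** Transfer from words to permutations. Given that there is no tie, the pattern of the word is
    uniform; the tie event, of probability at most [n ^ 2 / N], costs at most [M] times its
    probability on each side. *)
Lemma pexp_perm_mean (M : R) (F : Yspace -> R) (Phi : 'S_n -> R) :
  (forall Y, `|F Y| <= M) -> (forall s, `|Phi s| <= M) ->
  (forall (Y : Yspace) (s : 'S_n), pat s (fun i : 'I_n => Y i) -> F Y = Phi s) ->
  `|pexp unifw F - (\sum_s Phi s) / n`!%:R| <= 2 * M * (n%:R ^+ 2 / N%:R).
Proof.
move=> FM PhiM FPhi.
have M0 : 0 <= M by apply: le_trans (PhiM 1%g).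
pose c := pexp unifw (fun Y : Yspace => (pat 1%g (fun i : 'I_n => Y i))%:R).
have cE s : pexp unifw (fun Y : Yspace => (pat s (fun i : 'I_n => Y i))%:R) = c.
  rewrite /c !pexp_unifwE; congr (_ / _).
  have H t : \sum_(Y : Yspace) (pat t (fun i : 'I_n => Y i))%:R =
      #|[set Y : Yspace | pat t (fun i : 'I_n => Y i)]|%:R :> R.
    rewrite -natr_sum -sum1dep_card [in RHS]big_mkcond.
    by congr (_%:R); apply: eq_bigr => Y _; case: pat.
  by rewrite !H card_pat.
have Einj (Y : Yspace) : (injectiveb Y)%:R = \sum_s (pat s (fun i : 'I_n => Y i))%:R :> R.
  case: (boolP (injectiveb Y)) => [/injectiveP injY|ninj].
    have [s sY] := @pat_exists n (fun i : 'I_n => Y i) (inj_comp val_inj injY).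
    rewrite (bigD1 s)//= sY big1 ?addr0// => t ts.
    by case: (boolP (pat t _)) => // /(pat_uniq sY) st; rewrite st eqxx in ts.
  rewrite big1// => s _; case: (boolP (pat s _)) => // /pat_injective injY.
  case/negP: ninj; apply/injectiveP => i k Yik; apply: injY.
  by rewrite Yik.
have cinj : c * n`!%:R = pexp unifw (fun Y : Yspace => (injectiveb Y)%:R).
  under eq_pexp => Y do rewrite Einj.
  rewrite pexp_sum; under eq_bigr do rewrite cE.
  by rewrite sumr_const card_Sn mulr_natr.
have Finj : pexp unifw (fun Y : Yspace => (injectiveb Y)%:R * F Y) = c * \sum_s Phi s.
  under eq_pexp => Y do rewrite Einj mulr_suml.
  rewrite pexp_sum mulr_sumr; apply: eq_bigr => s _.
  rewrite -(cE s) -pexpZr; apply: eq_pexp => Y.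
  by case: (boolP (pat s _)) => [/FPhi ->//|_]; rewrite !mul0r.
pose d := pexp unifw (fun Y : Yspace => (~~ injectiveb Y)%:R) : R.
have dE : pexp unifw (fun Y : Yspace => (injectiveb Y)%:R) = 1 - d.
  rewrite /d -[X in X - _](pexp1 (I := 'I_n) unifw_sum) -pexpB.
  by apply: eq_pexp => Y; case: (injectiveb Y); rewrite ?subr0 ?subrr.
have f0 : n`!%:R != 0 :> R by rewrite pnatr_eq0 -lt0n fact_gt0.
have -> : pexp unifw F - (\sum_s Phi s) / n`!%:R =
    pexp unifw (fun Y : Yspace => (~~ injectiveb Y)%:R * F Y) - d * ((\sum_s Phi s) / n`!%:R).
  have -> : pexp unifw F = pexp unifw (fun Y : Yspace => (injectiveb Y)%:R * F Y) +
     pexp unifw (fun Y : Yspace => (~~ injectiveb Y)%:R * F Y).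
    rewrite -pexpD; apply: eq_pexp => Y; rewrite -mulrDl.
    by case: injectiveb; rewrite ?addr0 ?add0r mul1r.
  rewrite Finj; have : c = (1 - d) / n`!%:R by rewrite -dE -cinj mulfK.
  move=> ->; rewrite mulrAC -mulrA mulrBl mul1r addrAC [_ - _ - _]addrAC subrr.
  by rewrite add0r addrC.
have mean_le : `|(\sum_s Phi s) / n`!%:R| <= M.
  rewrite normrM normfV (ger0_norm (ler0n _ _)) ler_pdivrMr ?ltr0n ?fact_gt0//.
  apply: (le_trans (ler_norm_sum _ _ _)); rewrite mulr_natr -card_Sn -sumr_const.
  exact: ler_sum.
have d0 : 0 <= d by apply: pexp_ge0 => *; rewrite ?unifw_ge0 ?unifw_sum// ler0n.
have dle : d <= n%:R ^+ 2 / N%:R := pexp_noninjective.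
rewrite mulrAC; apply: (@le_trans _ _ (2 * d * M)); last first.
  by rewrite ler_wpM2r// ler_wpM2l.
apply: (le_trans (ler_normB _ _)); rewrite normrM (ger0_norm d0).
rewrite -mulrA mulrDl mul1r lerD// ?ler_wpM2l//.
apply: (le_trans (ler_norm_pexp _ _)); first exact: unifw_ge0.
rewrite /d -pexpZr; apply: ler_pexp => [|Y]; first exact: unifw_ge0.
by rewrite normrM; case: injectiveb; rewrite ?normr0 ?mul0r// normr1 !mul1r.
Qed.

End UniformValues.

Lemma card_incr (r n : nat) : #|[set e : {ffun 'I_r -> 'I_n} | incr e]| = 'C(n, r).
Proof.
rewrite -[n in RHS]card_ord -card_draws.
rewrite -(card_in_imset (f := fun e : {ffun 'I_r -> 'I_n} => [set e k | k : 'I_r])).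
  apply: eq_card => I; rewrite inE; apply/imsetP/eqP => [[e]|/incr_enum[e he <-]].
    by rewrite inE => /incr_inj inje ->; rewrite card_imset// card_ord.
  by exists e; rewrite ?inE.
by move=> e e'; rewrite !inE => he he'; exact: incr_imset_inj.
Qed.

Lemma pat_incr (r n : nat) (pi : 'S_r) (z : {ffun 'I_r -> 'I_n}) :
  pat pi (fun j => z j) = incr [ffun k => z (pi^-1%g k)].
Proof.
apply/patP/idP => [h|/incr_lt h j k].
  apply/forallP => j; apply/forallP => k; apply/implyP => jk.
  by rewrite !ffunE h !permKV.
by have := h (pi j) (pi k); rewrite !ffunE !permK.
Qed.

Lemma precomp_perm_inj (r : nat) (T : finType) (pi : 'S_r) :
  injective (fun z : {ffun 'I_r -> T} => [ffun k => z (pi k)]).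
Proof.
move=> z z' /= /ffunP E; apply/ffunP => k.
by have := E (pi^-1%g k); rewrite !ffunE permKV.
Qed.

(** Reading a word of pattern [pi] in the order of its values gives an increasing word, so counts
    under a side condition reduce to counts of increasing sequences. *)
Lemma card_pat_incr (r n : nat) (pi : 'S_r) (P : pred {ffun 'I_r -> 'I_n}) :
  #|[set z : {ffun 'I_r -> 'I_n} | pat pi (fun j => z j) & P [ffun k => z (pi^-1%g k)]]| =
  #|[set e : {ffun 'I_r -> 'I_n} | incr e & P e]|.
Proof.
rewrite -(card_imset _ (@precomp_perm_inj _ _ pi^-1%g)).
apply: eq_card => e; apply/imsetP/idP => [[z]|].
  by rewrite !inE pat_incr => h ->.
rewrite inE => he; have eK : [ffun k => [ffun l => e (pi l)] (pi^-1%g k)] = e.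
  by apply/ffunP => k; rewrite !ffunE permKV.
by exists [ffun l => e (pi l)]; rewrite // inE pat_incr eK.
Qed.

(** * Hoeffding projection of the count and second moment of the remainder *)

Section Hoeffding.
Variables (R : realFieldType) (r n N : nat) (pi : 'S_r).
Hypothesis N0 : (0 < N)%N.

(** Number of increasing sequences of length [r] in [{0, ..., m - 1}] whose term of index [k] is
    [i]. It is used with positions ([m = n]) and with values ([m = N]) alike. *)
Definition pos_count (m k i : nat) : nat := ('C(i, k) * 'C(m.-1 - i, r.-1 - k))%N.

(** Probability that [r] independent values have a given pattern. It is the same for all patterns
    and differs from [1 / r!] only through ties. *)
Definition pat_prob : R := 'C(N, r)%:R / N%:R ^+ r.

(** First-order Hoeffding component: the conditional probability of the pattern given that the entry
    of rank [k] has value [y], minus the unconditional one. *)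
Definition pat_proj (k : nat) (y : 'I_N) : R :=
  (pos_count N k y)%:R / N%:R ^+ r.-1 - pat_prob.

Local Notation Yspace := {ffun 'I_n -> 'I_N}.
Local Notation E := (pexp (unifw R (N := N))).
Local Notation w1 := (unifw_sum R N0).
Local Notation w0 := (@unifw_ge0 R N _).

Let ind (e : {ffun 'I_r -> 'I_n}) (Y : Yspace) : R := (pat pi (fun j => Y (e j)))%:R.

Let Nr0 : N%:R != 0 :> R. Proof. by rewrite pnatr_eq0 -lt0n. Qed.

Lemma natr_card (T : finType) (P : pred T) :
  #|[set x | P x]|%:R = \sum_x (P x)%:R :> R.
Proof.
rewrite -sum1dep_card natr_sum big_mkcond; apply: eq_bigr => x _.
by case: (P x).
Qed.

Lemma pexp_pat : E (fun z : {ffun 'I_r -> 'I_N} => (pat pi (fun j => z j))%:R) = pat_prob.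
Proof.
rewrite pexp_unifwE card_ord -natr_card /pat_prob -card_incr; congr (_%:R / _).
have <- : #|[set e : {ffun 'I_r -> 'I_N} | incr e & xpredT e]| =
    #|[set e : {ffun 'I_r -> 'I_N} | incr e]|.
  by apply: eq_card => e; rewrite !inE andbT.
rewrite -(card_pat_incr pi).
by apply: eq_card => z; rewrite !inE andbT.
Qed.

Lemma pexp_pat_at (j : 'I_r) (y : 'I_N) :
  E (fun z : {ffun 'I_r -> 'I_N} => (pat pi (fun k => upd z j y k))%:R) =
  pat_proj (pi j) y + pat_prob.
Proof.
rewrite /pat_proj subrK.
have -> : (pos_count N (pi j) y)%:R =
    \sum_(z : {ffun 'I_r -> 'I_N}) (pat pi (fun k => z k) && (z j == y))%:R :> R.
  rewrite -natr_card /pos_count -card_incr_at; congr (_%:R).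
  rewrite -(card_pat_incr pi (fun e => e (pi j) == y)).
  by apply: eq_card => z; rewrite !inE ffunE permK.
have -> : \sum_(z : {ffun 'I_r -> 'I_N}) (pat pi (fun k => z k) && (z j == y))%:R =
    N%:R ^+ r * E (fun z : {ffun 'I_r -> 'I_N} => (pat pi (fun k => z k) && (z j == y))%:R).
  by rewrite pexp_unifwE card_ord mulrC divfK// expf_neq0.
(* Removing the constraint [z j = y] costs a factor [1 / N]; this is why [pat_proj] is normalised by
   [N ^ (r - 1)]. *)
have -> : E (fun z : {ffun 'I_r -> 'I_N} => (pat pi (fun k => z k) && (z j == y))%:R) =
    N%:R^-1 * E (fun z : {ffun 'I_r -> 'I_N} => (pat pi (fun k => upd z j y k))%:R).
  rewrite (pexp_upd w1 j) (bigD1 y)//= [X in _ + X]big1 ?addr0 => [|t ty].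
    by congr (_ * _); apply: eq_pexp => z; rewrite ffunE !eqxx andbT.
  apply/eqP; rewrite mulf_eq0; apply/orP; right; apply/eqP.
  rewrite -[RHS](pexp_cst (I := 'I_r) w1 0).
  by apply: eq_pexp => z; rewrite ffunE eqxx (negbTE ty) andbF.
have r0 : (0 < r)%N by apply: leq_trans (ltn_ord j).
move: (E _) => x; rewrite -[in N%:R ^+ r](prednK r0) exprS mulrACA mulfV// mul1r.
by rewrite mulrC mulKf// expf_neq0.
Qed.

Lemma sum_pat_proj (k : 'I_r) : \sum_y N%:R^-1 * pat_proj k y = 0.
Proof.
have r0 : (0 < r)%N by apply: leq_trans (ltn_ord k).
rewrite -mulr_sumr sumrB sumr_const card_ord -mulr_suml -natr_sum.
have -> : (\sum_(y < N) pos_count N k y)%N = 'C(N, r).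
  rewrite -card_incr -sum1dep_card (partition_big (fun e : {ffun 'I_r -> 'I_N} => e k) xpredT)//=.
  by apply: eq_bigr => y _; rewrite /pos_count -card_incr_at sum1dep_card.
rewrite /pat_prob -[in N%:R ^+ r](prednK r0) exprS.
apply/eqP; rewrite mulf_eq0 subr_eq0; apply/orP; right; apply/eqP.
by rewrite -[RHS]mulr_natr invfM mulrA mulrAC divfK.
Qed.

Lemma pat_prob01 : 0 <= pat_prob <= 1.
Proof.
rewrite -pexp_pat; apply/andP; split.
  by apply: pexp_ge0 => [||z]; [exact: w0|exact: w1|rewrite ler0n].
rewrite -[leRHS](pexp1 (I := 'I_r) w1); apply: ler_pexp => [|z]; first exact: w0.
by rewrite -[leRHS]/1%:R ler_nat leq_b1.
Qed.

Lemma pat_proj_le (j : 'I_r) y : `|pat_proj (pi j) y| <= 1.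
Proof.
have : 0 <= pat_proj (pi j) y + pat_prob <= 1.
  rewrite -pexp_pat_at; apply/andP; split.
    by apply: pexp_ge0 => [||z]; [exact: w0|exact: w1|rewrite ler0n].
  rewrite -[leRHS](pexp1 (I := 'I_r) w1); apply: ler_pexp => [|z]; first exact: w0.
  by rewrite -[leRHS]/1%:R ler_nat leq_b1.
by have := pat_prob01; rewrite ler_norml; lra.
Qed.

Let rem (e : {ffun 'I_r -> 'I_n}) (Y : Yspace) : R :=
  ind e Y - pat_prob - \sum_j pat_proj (pi j) (Y (e j)).

Let pexp_coord0 (i : 'I_n) (j : 'I_r) : E (fun Y : Yspace => pat_proj (pi j) (Y i)) = 0.
Proof. by rewrite (pexp_coord w1) sum_pat_proj. Qed.

Let pexp_ind (e : {ffun 'I_r -> 'I_n}) : incr e -> E (ind e) = pat_prob.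
Proof.
move=> he; rewrite -pexp_pat -(pexp_marginal _ w1 (incr_inj he)).
apply: eq_pexp => Y; rewrite /ind; congr (nat_of_bool _)%:R.
by apply/patP/patP => H j k; have := H j k; rewrite !ffunE.
Qed.

Let pexp_rem (e : {ffun 'I_r -> 'I_n}) : incr e -> E (rem e) = 0.
Proof.
move=> he; rewrite /rem 2!pexpB pexp_sum pexp_cst//; last exact: w1.
rewrite pexp_ind// subrr big1 ?subr0// => j _; exact: pexp_coord0.
Qed.

(** Degeneracy: conditioning on any single value still gives mean 0. At a position used by [e] the
    projection cancels the conditional probability; at any other position [rem e] does not read the
    value. *)
Let pexp_rem_upd (e : {ffun 'I_r -> 'I_n}) i y : incr e ->
  E (fun Y => rem e (upd Y i y)) = 0.
Proof.
move=> he; rewrite /rem 2!pexpB pexp_sum pexp_cst//; last exact: w1.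
have [/codomP[j ij]|ie] := boolP (i \in codom e); last first.
  have ek k : (e k == i) = false by apply/negbTE; apply: contra ie => /eqP <-; exact: codom_f.
  have -> : E (fun Y => ind e (upd Y i y)) = E (ind e).
    apply: eq_pexp => Y; rewrite /ind; congr (nat_of_bool _)%:R.
    by apply/patP/patP => H j k; have := H j k; rewrite !ffunE !ek.
  rewrite pexp_ind// subrr big1 ?subr0// => j _.
  by under eq_pexp => Y do rewrite ffunE ek; exact: pexp_coord0.
subst i.
have -> : E (fun Y => ind e (upd Y (e j) y)) = pat_proj (pi j) y + pat_prob.
  rewrite -pexp_pat_at -(pexp_marginal _ w1 (incr_inj he)).
  apply: eq_pexp => Y; rewrite /ind; congr (nat_of_bool _)%:R.
  by apply/patP/patP => H k l; have := H k l; rewrite !ffunE !(inj_eq (incr_inj he)).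
rewrite addrK (bigD1 j)//= big1 ?addr0 => [|k kj].
  under eq_pexp => Y do rewrite ffunE eqxx.
  by rewrite pexp_cst ?subrr//; exact: w1.
under eq_pexp => Y do rewrite ffunE (inj_eq (incr_inj he)) (negbTE kj).
exact: pexp_coord0.
Qed.

Let rem_depends (e : {ffun 'I_r -> 'I_n}) : depends_on [set e j | j : 'I_r] (rem e).
Proof.
move=> Y Z YZ; have eYZ j : Y (e j) = Z (e j) by apply: YZ; rewrite imset_f.
rewrite /rem /ind; congr (_%:R - _ - _).
  by congr nat_of_bool; apply/patP/patP => H j k; have := H j k; rewrite !eYZ.
by apply: eq_bigr => j _; rewrite eYZ.
Qed.

Let rem_le (e : {ffun 'I_r -> 'I_n}) Y : `|rem e Y| <= r.+1%:R.
Proof.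
rewrite -natr1 addrC; apply: (le_trans (ler_normB _ _)); apply: lerD.
  by have := pat_prob01; rewrite /ind ler_norml; case: pat; rewrite /=; lra.
apply: (le_trans (ler_norm_sum _ _ _)); rewrite -[in leRHS](card_ord r) -sumr_const.
by apply: ler_sum => j _; exact: pat_proj_le.
Qed.

(** For increasing embeddings, positive exactly when they share at least two positions. Being a sum
    of coincidences rather than an indicator, it can be averaged term by term. *)
Let overlap (e e' : {ffun 'I_r -> 'I_n}) : nat :=
  \sum_(j : 'I_r * 'I_r | j.1 != j.2) \sum_(k : 'I_r * 'I_r | k.1 != k.2)
     (e j.1 == e' k.1) && (e j.2 == e' k.2).

(** Embeddings sharing at most one position contribute 0, by conditioning on that position and
    degeneracy; for the others the crude bound [r + 1] on each factor is enough. *)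
Let pexp_remM (e e' : {ffun 'I_r -> 'I_n}) : incr e -> incr e' ->
  E (fun Y => rem e Y * rem e' Y) <= r.+1%:R ^+ 2 * (overlap e e')%:R.
Proof.
move=> he he'.
have [ov|] := boolP (overlap e e' == 0%N); last first.
  rewrite -lt0n => ov.
  have : E (fun Y => rem e Y * rem e' Y) <= E (fun _ : Yspace => r.+1%:R ^+ 2).
    apply: ler_pexp => [|Y]; first exact: w0.
    by rewrite (le_trans (ler_norm _))// normrM ler_pM.
  rewrite pexp_cst//; last exact: w1.
  move=> /le_trans; apply; rewrite -[leLHS]mulr1; apply: ler_wpM2l.
    by rewrite exprn_ge0.
  by rewrite -[leLHS]/1%:R ler_nat.
rewrite (eqP ov) mulr0.
have [i iP|no] := pickP (mem ([set e j | j : 'I_r] :&: [set e' j | j : 'I_r])).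
  rewrite (pexpM_overlap w1 (i := i) (@rem_depends e) (@rem_depends e')).
    by rewrite big1// => t _; rewrite pexp_rem_upd// mul0r mulr0.
  apply/subsetP => x xP; rewrite inE; apply/negPn/negP => xi.
  move: iP xP ov; rewrite /= !inE => /andP[/imsetP[j1 _ i1] /imsetP[k1 _ i2]].
  move=> /andP[/imsetP[j2 _ x1] /imsetP[k2 _ x2]].
  have j12 : j1 != j2 by apply: contraNneq xi => jj; rewrite x1 i1 jj.
  have k12 : k1 != k2 by apply: contraNneq xi => kk; rewrite x2 i2 kk.
  rewrite /overlap (bigD1 (j1, j2))//= (bigD1 (k1, k2))//=.
  by rewrite -i1 -i2 -x1 -x2 !eqxx.
rewrite (pexpM w1 (@rem_depends e)) ?pexp_rem ?mul0r//.
apply: depends_onS (@rem_depends e'); apply/subsetP => x xe'.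
by rewrite inE; apply/negP => xe; have := no x; rewrite /= inE xe xe'.
Qed.

(** Summing over all maps, not only increasing ones, makes the entries of [e'] independent and
    uniform: two prescribed coincidences cost [n ^ -2], and there are at most [r ^ 4] choices of
    indices. *)
Let pexp_overlap : (0 < n)%N ->
  \sum_(e : {ffun 'I_r -> 'I_n}) \sum_(e' : {ffun 'I_r -> 'I_n}) (overlap e e')%:R
   <= r%:R ^+ 4 * n%:R ^+ r * n%:R ^+ r / n%:R ^+ 2 :> R.
Proof.
move=> n0; have nn0 : n%:R != 0 :> R by rewrite pnatr_eq0 -lt0n.
have nw1 := @unifw_sum R n n0.
have coin (k : 'I_r) (a : 'I_n) :
    pexp (unifw R (N := n)) (fun e : {ffun 'I_r -> 'I_n} => (a == e k)%:R) = n%:R^-1.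
  rewrite (pexp_coord (nw1 _) k (fun t => (a == t)%:R)) (bigD1 a)//= eqxx mulr1.
  by rewrite big1 ?addr0// => t; rewrite eq_sym => /negbTE ->; rewrite mulr0.
have coin2 (k : 'I_r * 'I_r) (a b : 'I_n) : k.1 != k.2 ->
    \sum_(e : {ffun 'I_r -> 'I_n}) ((a == e k.1) && (b == e k.2))%:R =
    n%:R ^+ r / n%:R ^+ 2 :> R.
  move=> kk; have := @pexp_unifwE R n _ (fun e : {ffun 'I_r -> 'I_n} =>
     (a == e k.1)%:R * (b == e k.2)%:R); rewrite (pexpM (nw1 _) (D := [set k.1])).
  - rewrite !coin card_ord -expr2 exprVn => /(canLR (mulfVK _)) H.
    rewrite mulrC H ?expf_neq0//; apply: eq_bigr => e _.
    by case: eqP; case: eqP; rewrite /= ?mulr1 ?mulr0.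
  - by move=> f g fg; rewrite fg ?inE.
  - by move=> f g fg; rewrite fg ?inE// eq_sym.
rewrite /overlap.
under eq_bigr => e _ do under eq_bigr => e' _ do rewrite natr_sum.
under eq_bigr => e _ do rewrite exchange_big.
rewrite exchange_big.
under eq_bigr => j _.
  under eq_bigr => e _.
    under eq_bigr => e' _ do rewrite natr_sum.
    rewrite exchange_big/=.
    under eq_bigr => k kk do rewrite coin2//.
    rewrite sumr_const.
    over.
  rewrite sumr_const.
  over.
rewrite sumr_const card_ffun !card_ord -!mulrnA -[leLHS]mulr_natl.
rewrite [leRHS](_ : _ = (r ^ 4 * n ^ r)%:R * (n%:R ^+ r / n%:R ^+ 2)); last first.
  by rewrite natrM !natrX; ring.
apply: ler_wpM2r; first by rewrite divr_ge0 ?exprn_ge0.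
rewrite ler_nat.
have le2 : (#|[pred j : 'I_r * 'I_r | j.1 != j.2]| <= r ^ 2)%N.
  by rewrite (leq_trans (max_card _))// card_prod card_ord mulnn.
rewrite (_ : r ^ 4 = r ^ 2 * r ^ 2)%N; last by rewrite -expnD.
by rewrite -[(_ * _ * n ^ r)%N]mulnA [(r ^ 2 * n ^ r)%N]mulnC !leq_mul.
Qed.

(** Expanding the square gives a sum over pairs of embeddings, of which only those with two common
    positions survive. The bound has order [n ^ (2 r - 2)], so dividing by the squared normalisation
    [n ^ (2 r - 1)] leaves [O(1 / n)]. *)
Theorem hoeffding_remainder : (0 < n)%N ->
  E (fun Y : Yspace => ((occ_fun pi (fun i : 'I_n => Y i))%:R - 'C(n, r)%:R * pat_prob -
     \sum_(i < n) \sum_(j : 'I_r) (pos_count n j i)%:R * pat_proj (pi j) (Y i)) ^+ 2)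
  <= r.+1%:R ^+ 2 * r%:R ^+ 4 * (n%:R ^+ r * n%:R ^+ r / n%:R ^+ 2).
Proof.
move=> n0.
have -> : E (fun Y : Yspace => ((occ_fun pi (fun i : 'I_n => Y i))%:R - 'C(n, r)%:R * pat_prob -
     \sum_(i < n) \sum_(j : 'I_r) (pos_count n j i)%:R * pat_proj (pi j) (Y i)) ^+ 2) =
   E (fun Y : Yspace => \sum_(e | incr e) \sum_(e' | incr e') rem e Y * rem e' Y).
  apply: eq_pexp => Y; rewrite expr2.
  have -> : (occ_fun pi (fun i : 'I_n => Y i))%:R - 'C(n, r)%:R * pat_prob -
     \sum_(i < n) \sum_(j : 'I_r) (pos_count n j i)%:R * pat_proj (pi j) (Y i) =
     \sum_(e | incr e) rem e Y.
    rewrite /rem 2!sumrB; congr (_ - _ - _).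
    - rewrite /occ_fun natr_card [RHS]big_mkcond; apply: eq_bigr => e _.
      by rewrite /ind; case: (incr e).
    - by rewrite sumr_const -card_incr cardsE mulr_natl.
    - rewrite exchange_big [RHS]exchange_big; apply: eq_bigr => j _ /=.
      (* The projections of all embeddings are regrouped by the position [i = e j], which occurs
         [pos_count n j i] times. *)
      rewrite [RHS](partition_big (fun e : {ffun 'I_r -> 'I_n} => e j) xpredT)//=.
      apply: eq_bigr => i _.
      rewrite /pos_count -card_incr_at -sum1dep_card natr_sum mulr_suml.
      by apply: eq_bigr => e /andP[_ /eqP ->]; rewrite mul1r.
  by rewrite mulr_suml; apply: eq_bigr => e _; rewrite mulr_sumr.
rewrite pexp_sum.
apply: (@le_trans _ _ (\sum_(e | incr e) \sum_(e' | incr e') r.+1%:R ^+ 2 * (overlap e e')%:R)).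
  by apply: ler_sum => e he; rewrite pexp_sum; apply: ler_sum => e' he'; exact: pexp_remM.
apply: (@le_trans _ _ (\sum_(e : {ffun 'I_r -> 'I_n}) \sum_(e' : {ffun 'I_r -> 'I_n})
    r.+1%:R ^+ 2 * (overlap e e')%:R)).
  rewrite big_mkcond; apply: ler_sum => e _.
  have ge0 e' : 0 <= r.+1%:R ^+ 2 * (overlap e e')%:R :> R by rewrite mulr_ge0 ?exprn_ge0.
  case: (incr e); last exact: sumr_ge0.
  by rewrite big_mkcond; apply: ler_sum => e' _; case: incr.
under eq_bigr do rewrite -mulr_sumr.
rewrite -mulr_sumr -mulrA; apply: ler_wpM2l; first by rewrite exprn_ge0.
by rewrite !mulrA; exact: pexp_overlap.
Qed.

End Hoeffding.

From mathcomp Require Import all_classical all_reals all_analysis.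
From mathcomp Require Import measurable_realfun.

Import Order.TTheory GRing.Theory Num.Theory.
Import numFieldTopology.Exports numFieldNormedType.Exports.

Local Open Scope classical_set_scope.
Local Open Scope ring_scope.

(** * Limit covariance of the projections *)

Section PolyArray.
Variable R : realType.
Implicit Types (u v : nat -> nat -> R) (p : {poly R}).

(** Arrays equal to a polynomial in [i / n] up to [O(1 / n)], uniformly in [i]. The class is stable
    under sums and products, its averages are close to Riemann sums and hence converge, and near
    [i = 0] its members are close to a constant. *)
Definition poly_array u := exists p C, forall n i, (i < n)%N ->
  `|u n i - p.[i%:R / n%:R]| <= C / n%:R.

Definition avg u n : R := (\sum_(i < n) u n i) / n%:R.

Lemma poly_array_ext u v : (forall n i, (i < n)%N -> u n i = v n i) ->
  poly_array u -> poly_array v.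
Proof. by move=> uv [p [C h]]; exists p, C => n i ni; rewrite -uv// h. Qed.

Lemma poly_array_cst c : poly_array (fun _ _ => c).
Proof. by exists c%:P, 0 => n i ni; rewrite hornerC subrr normr0 mul0r. Qed.

Lemma poly_array_D u v : poly_array u -> poly_array v ->
  poly_array (fun n i => u n i + v n i).
Proof.
move=> [p [C hu]] [q [D hv]]; exists (p + q), (C + D) => n i ni.
rewrite hornerD opprD addrACA mulrDl (le_trans (ler_normD _ _))//.
by rewrite lerD// ?hu ?hv.
Qed.

Lemma ratio01 n i : (i < n)%N -> 0 <= (i%:R / n%:R : R) <= 1.
Proof.
move=> ni; rewrite divr_ge0//= ler_pdivrMr ?ltr0n ?(leq_ltn_trans _ ni)//.
by rewrite mul1r ler_nat ltnW.
Qed.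

Lemma poly_bounded p : exists2 B : R, 0 <= B & forall x, 0 <= x <= 1 -> `|p.[x]| <= B.
Proof.
exists (\sum_(i < size p) `|p`_i|); first exact: sumr_ge0.
move=> x /andP[x0 x1]; rewrite horner_coef (le_trans (ler_norm_sum _ _ _))//.
apply: ler_sum => i _; rewrite normrM ler_piMr// normrX ger0_norm//.
exact: exprn_ile1.
Qed.

Lemma poly_array_M u v : poly_array u -> poly_array v ->
  poly_array (fun n i => u n i * v n i).
Proof.
move=> [p [C hu]] [q [D hv]].
have [P P0 hP] := poly_bounded p; have [Q Q0 hQ] := poly_bounded q.
exists (p * q), (C * (Q + `|D|) + P * D) => n i ni; rewrite hornerM.
have n1 : 1 <= n%:R :> R by rewrite ler1n (leq_ltn_trans _ ni).
have {}hP := hP _ (ratio01 ni); have {}hQ := hQ _ (ratio01 ni).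
have {}hu := hu _ _ ni; have {}hv := hv _ _ ni.
set x := p.[_] in hu hP *; set y := q.[_] in hv hQ *.
have -> : u n i * v n i - x * y = (u n i - x) * (y + (v n i - y)) + x * (v n i - y) by ring.
set a := u n i - x in hu *; set b := v n i - y in hv *.
have n0 : 0 < n%:R :> R by apply: lt_le_trans n1.
have yb : `|y + b| <= Q + `|D|.
  rewrite (le_trans (ler_normD _ _))// lerD// (le_trans hv)//.
  by rewrite ler_pdivrMr// (le_trans (ler_norm _))// ler_peMr.
rewrite (le_trans (ler_normD _ _))// !normrM mulrDl lerD//.
  by rewrite mulrAC ler_pM.
by rewrite -mulrA ler_pM.
Qed.

Lemma poly_array_B u v : poly_array u -> poly_array v ->
  poly_array (fun n i => u n i - v n i).
Proof.
move=> hu hv; apply: (@poly_array_ext (fun n i => u n i + (-1) * v n i)).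
  by move=> n i _; rewrite mulN1r.
by apply: poly_array_D => //; apply: poly_array_M => //; exact: poly_array_cst.
Qed.

(** Induction on [k] through [(k + 1) C(a, k + 1) = (a - k) C(a, k)]. Truncated subtraction is
    harmless, since [a - k] differs from [a] by at most [k], which is [O(1 / n)] after division. *)
Lemma poly_array_bin (a : nat -> nat -> nat) k :
  poly_array (fun n i => (a n i)%:R / n%:R) ->
  poly_array (fun n i => 'C(a n i, k)%:R / n%:R ^+ k).
Proof.
move=> ha; elim: k => [|k IHk].
  by apply: poly_array_ext (poly_array_cst 1) => n i _; rewrite bin0 expr0 divr1.
have hak : poly_array (fun n i => (a n i - k)%:R / n%:R).
  have [p [C h]] := ha; exists p, (C + k%:R) => n i ni.
  have -> : (a n i - k)%:R / n%:R - p.[i%:R / n%:R] =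
    ((a n i)%:R / n%:R - p.[i%:R / n%:R]) + ((a n i - k)%:R - (a n i)%:R) / n%:R by ring.
  rewrite (le_trans (ler_normD _ _))// [leRHS]mulrDl lerD ?h// normrM normfV.
  rewrite (ger0_norm (ler0n _ n)) ler_wpM2r ?invr_ge0//.
  rewrite -normrN opprB; have [ka|ak] := leqP k (a n i).
    by rewrite natrB// opprB addrC subrK ger0_norm.
  by rewrite (eqP (ltnW ak : (a n i - k == 0)%N)) subr0 ger0_norm// ler_nat ltnW.
have := poly_array_M (poly_array_M hak IHk) (poly_array_cst k.+1%:R^-1).
apply: poly_array_ext => n i ni.
have n0 : n%:R != 0 :> R by rewrite pnatr_eq0 -lt0n (leq_ltn_trans _ ni).
have : (k.+1)%:R * 'C(a n i, k.+1)%:R = (a n i - k)%:R * 'C(a n i, k)%:R :> R.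
  by rewrite -!natrM mul_bin_left.
have k0 : k.+1%:R != 0 :> R by rewrite pnatr_eq0.
move=> /(canRL (mulKf k0)) ->; rewrite exprS.
move: (k.+1%:R) k0 => z k0; field.
by rewrite n0 k0 expf_neq0.
Qed.

(** The limiting polynomial is [x ^ k (1 - x) ^ (r - 1 - k)] up to factorials; counting the places
    above [i] as [n.-1 - i] instead of [n - i] is an error of [1 / n]. *)
Lemma poly_array_pos r (k : 'I_r) :
  poly_array (fun n i => (pos_count r n k i)%:R / n%:R ^+ r.-1).
Proof.
have r0 : (0 < r)%N by apply: leq_ltn_trans (ltn_ord k).
have h1 : poly_array (fun n i => 'C(i, k)%:R / n%:R ^+ k).
  apply: (@poly_array_bin (fun _ i => i)).
  by exists 'X, 0 => n i _; rewrite hornerX subrr normr0 mul0r.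
have h2 : poly_array (fun n i => 'C(n.-1 - i, r.-1 - k)%:R / n%:R ^+ (r.-1 - k)).
  apply: (@poly_array_bin (fun n i => (n.-1 - i)%N)).
  exists (1 - 'X), 1 => n i ni; rewrite !hornerE natrB; last by lia.
  have n0 : n%:R != 0 :> R by rewrite pnatr_eq0 -lt0n (leq_ltn_trans _ ni).
  rewrite -subn1 natrB ?(leq_ltn_trans _ ni)//.
  rewrite (_ : _ - _ = - (1 / n%:R)); last by field.
  by rewrite mul1r normrN normfV ger0_norm.
apply: poly_array_ext (poly_array_M h1 h2) => n i ni.
rewrite /pos_count natrM mulrACA -invfM -exprD subnKC// -ltnS prednK//.
Qed.

Lemma poly_array_pat_prob r : poly_array (fun n _ => pat_prob R r n).
Proof.
apply: (@poly_array_bin (fun n _ => n)); exists 1, 0 => n i ni.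
by rewrite hornerC divff ?subrr ?normr0 ?mul0r// pnatr_eq0 -lt0n (leq_ltn_trans _ ni).
Qed.

(** The powers [i ^ k] are compared with the increments of [m ^ (k + 1)], whose sum telescopes: a
    discrete form of the comparison between sum and integral. *)
Lemma sum_pow_bounds k n :
  `|\sum_(i < n) (i%:R : R) ^+ k - n%:R ^+ k.+1 / k.+1%:R| <= n%:R ^+ k.
Proof.
have k0 : 0 < k.+1%:R :> R by rewrite ltr0n.
have sumE (a : R) : k.+1%:R * a = \sum_(i < k.+1) a.
  by rewrite sumr_const card_ord mulr_natl.
have powE m : m.+1%:R ^+ k.+1 - m%:R ^+ k.+1 = \sum_(i < k.+1) m.+1%:R ^+ (k - i) * m%:R ^+ i :> R.
  rewrite subrXX (_ : m.+1%:R - m%:R = 1) ?mul1r//.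
  by rewrite -natr1 addrAC subrr add0r.
have step1 m : k.+1%:R * m%:R ^+ k <= m.+1%:R ^+ k.+1 - m%:R ^+ k.+1 :> R.
  rewrite powE sumE; apply: ler_sum => i _.
  rewrite -[in leLHS](subnK (ltn_ord i : i <= k)%N) exprD ler_wpM2r ?exprn_ge0//.
  by rewrite lerXn2r ?nnegrE// ler_nat.
have step2 m : m.+1%:R ^+ k.+1 - m%:R ^+ k.+1 <= k.+1%:R * m.+1%:R ^+ k :> R.
  rewrite powE sumE; apply: ler_sum => i _.
  rewrite -[in leRHS](subnK (ltn_ord i : i <= k)%N) exprD ler_wpM2l ?exprn_ge0//.
  by rewrite lerXn2r ?nnegrE// ler_nat.
have le1 m : k.+1%:R * \sum_(i < m) (i%:R : R) ^+ k <= m%:R ^+ k.+1.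
  elim: m => [|m IHm]; first by rewrite big_ord0 mulr0 exprn_ge0.
  rewrite big_ord_recr mulrDr; apply: le_trans (lerD IHm (step1 m)) _.
  by rewrite addrC subrK.
have le2 m : m%:R ^+ k.+1 <= k.+1%:R * (\sum_(i < m) (i%:R : R) ^+ k + m%:R ^+ k).
  elim: m => [|m IHm]; first by rewrite big_ord0 expr0n mulr_ge0 ?addr_ge0 ?exprn_ge0.
  rewrite big_ord_recr mulrDr; apply: le_trans _ (lerD IHm (step2 m)).
  by rewrite addrC subrK.
have {}le1 : \sum_(i < n) (i%:R : R) ^+ k <= n%:R ^+ k.+1 / k.+1%:R.
  by rewrite ler_pdivlMr// mulrC le1.
have {}le2 : n%:R ^+ k.+1 / k.+1%:R <= \sum_(i < n) (i%:R : R) ^+ k + n%:R ^+ k.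
  by rewrite ler_pdivrMr// mulrC le2.
rewrite ler_norml lerNl opprB !lerBlDr [X in _ <= X]addrC le2.
by rewrite (le_trans le1)// lerDr exprn_ge0.
Qed.

Lemma cvg_harmonic0 (C : R) : (fun n : nat => C / n%:R) @ \oo --> (0 : R).
Proof.
rewrite -[X in _ --> X](mulr0 C); apply: cvgMr.
apply/cvgrPdist_le => e e0; exists (Num.bound e^-1) => // n /= hn.
have ei : e^-1 < n%:R by rewrite (lt_le_trans (archi_boundP _)) ?ler_nat// invr_ge0 ltW.
have n0 : 0 < n%:R :> R by rewrite (lt_trans _ ei)// invr_gt0.
by rewrite sub0r normrN normfV ger0_norm// -[leRHS]invrK lef_pV2 ?posrE ?invr_gt0// ltW.
Qed.

Lemma cvg_sumr (I : Type) (s : seq I) (P : pred I) (f : I -> nat -> R) (l : I -> R) :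
  (forall i, P i -> f i @ \oo --> l i) ->
  (fun n => \sum_(i <- s | P i) f i n) @ \oo --> \sum_(i <- s | P i) l i.
Proof.
move=> h; elim: s => [|i s IHs].
  rewrite big_nil; under eq_fun do rewrite big_nil; exact: cvg_cst.
rewrite big_cons; under eq_fun do rewrite big_cons.
by case: ifPn => // Pi; apply: cvgD => //; exact: h.
Qed.

Lemma cvg_avg_pow k : avg (fun n i => (i%:R / n%:R) ^+ k) @ \oo --> (k.+1%:R^-1 : R).
Proof.
apply/cvgrPdist_le => e e0.
near=> n.
have n0 : 0 < n%:R :> R by rewrite ltr0n; near: n; exact: nbhs_infty_gt.
have ne : 1 / n%:R <= e.
  near: n; have := cvg_harmonic0 1 => /cvgrPdist_le /(_ _ e0); apply: filterS => n.
  by rewrite sub0r normrN ger0_norm// divr_ge0.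
rewrite /avg; under eq_bigr do rewrite expr_div_n; rewrite -mulr_suml.
have := sum_pow_bounds k n; set s := \sum_(_ < _) _ => hs.
have -> : k.+1%:R^-1 - s / n%:R ^+ k / n%:R = (n%:R ^+ k.+1 / k.+1%:R - s) / n%:R ^+ k.+1.
  have k0 : k.+1%:R != 0 :> R by rewrite pnatr_eq0.
  rewrite exprS; move: (k.+1%:R) k0 => z k0; field.
  by rewrite ?k0 ?expf_neq0 ?lt0r_neq0.
rewrite normrM normfV distrC (@ger0_norm _ (n%:R ^+ k.+1)) ?exprn_ge0//.
rewrite ler_pdivrMr ?exprn_gt0// (le_trans hs)// exprS mulrA.
by rewrite ler_peMl ?exprn_ge0 ?(ltW n0)// -ler_pdivrMr.
Unshelve. all: by end_near. Qed.

(** The limit is the integral over [[0, 1]] of the underlying polynomial; the error [C / n] is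
    uniform in [i] and so survives averaging. *)
Lemma cvg_avg u : poly_array u -> cvg (avg u @ \oo).
Proof.
move=> [p [C h]].
pose l := \sum_(k < size p) p`_k * k.+1%:R^-1.
have cp : avg (fun n i => p.[i%:R / n%:R]) @ \oo --> l.
  have -> : avg (fun n i => p.[i%:R / n%:R]) =
      fun n => \sum_(k < size p) p`_k * avg (fun n i => (i%:R / n%:R) ^+ k) n.
    apply/funext => n; rewrite /avg; under eq_bigr do rewrite horner_coef.
    rewrite exchange_big mulr_suml; apply: eq_bigr => k _.
    by rewrite -mulr_sumr mulrA.
  apply: cvg_sumr => k _; apply: cvgMr; exact: cvg_avg_pow.
apply/cvg_ex; exists l; rewrite -[l]addr0.
have -> : avg u = (fun n => avg (fun n i => p.[i%:R / n%:R]) n +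
    avg (fun n i => u n i - p.[i%:R / n%:R]) n).
  by apply/funext => n; rewrite /avg -mulrDl -big_split; congr (_ / _); apply: eq_bigr => i _ /=; ring.
apply: cvgD => //; apply/cvgrPdist_le => e e0.
have := cvg_harmonic0 C => /cvgrPdist_le /(_ _ e0); apply: filterS => n.
rewrite !sub0r !normrN => /(le_trans (ler_norm _)); apply: le_trans.
have [->|n0] := posnP n; first by rewrite /avg !invr0 !mulr0 normr0.
rewrite normrM normfV [X in _ / X]ger0_norm// ler_pdivrMr ?ltr0n//.
rewrite (le_trans (ler_norm_sum _ _ _))// mulr_natr.
have -> : C / n%:R *+ n = \sum_(i < n) C / n%:R by rewrite sumr_const card_ord.
by apply: ler_sum => i _; exact: h.
Qed.

(** The hypothesis along [i = 0] identifies the value at 0 of the underlying polynomial with [l];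
    continuity of that polynomial at 0 does the rest. *)
Lemma poly_array_corner u (l : R) : poly_array u -> (fun n => u n 0) @ \oo --> l ->
  forall e : R, 0 < e -> exists2 d : R, 0 < d & \forall n \near \oo,
    forall i, (i < n)%N -> i%:R <= d * n%:R :> R -> `|u n i - l| <= e.
Proof.
move=> [p [C h]] ul e e0.
have pl : p.[0] = l.
  apply: (cvg_unique _ _ ul) => //.
  apply/cvgrPdist_le => e' e'0; near=> n.
  have n0 : (0 < n)%N by near: n; exact: nbhs_infty_gt.
  have := h _ _ n0; rewrite mul0r distrC => /le_trans; apply.
  rewrite (le_trans (ler_norm _))//; near: n.
  have := cvg_harmonic0 C => /cvgrPdist_le /(_ _ e'0); apply: filterS => n.
  by rewrite sub0r normrN.
have e20 : 0 < e / 2 by rewrite divr_gt0.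
have /cvgrPdist_le/(_ _ e20)[d/= d0 hd] := @continuous_horner R p 0.
exists (d / 2); first by rewrite divr_gt0.
near=> n => i ni id.
have n0 : 0 < n%:R :> R by rewrite ltr0n (leq_ltn_trans _ ni).
have Ce : C / n%:R <= e / 2.
  rewrite (le_trans (ler_norm _))//; near: n.
  have := cvg_harmonic0 C => /cvgrPdist_le /(_ _ e20); apply: filterS => n.
  by rewrite sub0r normrN.
have xd : `|0 - (i%:R / n%:R : R)| < d.
  rewrite sub0r normrN ger0_norm ?divr_ge0// ltr_pdivrMr// (le_lt_trans id)//.
  by rewrite ltr_pM2r// ltr_pdivrMr// ltr_pMr// ltr1n.
have := hd _ xd; rewrite pl => hp.
have -> : u n i - l = (u n i - p.[i%:R / n%:R]) + (p.[i%:R / n%:R] - l) by ring.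
rewrite (le_trans (ler_normD _ _))// [e]splitr lerD// ?(le_trans (h _ _ ni))//.
by rewrite distrC.
Unshelve. all: by end_near. Qed.

End PolyArray.

(** * Covariance of the projections: convergence and positivity *)

Section Projections.
Variable R : realType.

Definition pos_array (r k n i : nat) : R := (pos_count r n k i)%:R / n%:R ^+ r.-1.

Definition centered_array (r k N y : nat) : R := pos_array r k N y - pat_prob R r N.

(** Contribution of value [y] at position [i] to the projection of the count, divided by
    [n ^ (r - 1)]. It is a finite sum of products of a function of the position and a function of
    the value. *)
Definition lin_kernel (r : nat) (pi : 'S_r) (n N i y : nat) : R :=
  \sum_(j < r) pos_array r j n i * centered_array r (pi j) N y.

Definition lin_cov (r1 r2 : nat) (pi : 'S_r1) (rho : 'S_r2) (n N : nat) : R :=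
  (\sum_(i < n) (\sum_(y < N) lin_kernel pi n N i y * lin_kernel rho n N i y) / N%:R) / n%:R.

Lemma poly_array_centered (r : nat) (k : 'I_r) : poly_array (centered_array r k).
Proof.
by apply: poly_array_B; [exact: poly_array_pos|exact: poly_array_pat_prob].
Qed.

Lemma cvg_pow4 : (fun n : nat => (n ^ 4)%N) @ \oo --> \oo.
Proof.
move=> A [M _ hM]; exists M => //= n /= Mn; apply: hM => /=.
apply: leq_trans Mn _; case: n => // n.
by rewrite -[X in (X <= _)%N](expn1 n.+1) leq_pexp2l.
Qed.

(** Positions and values separate, so the covariance is a finite combination of products of averages
    of polynomial arrays; convergence follows although [n] and [N] grow at different speeds. *)
Lemma lin_covE (r1 r2 : nat) (pi : 'S_r1) (rho : 'S_r2) (n N : nat) :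
  lin_cov pi rho n N = \sum_(j < r1) \sum_(k < r2)
    avg (fun n i => pos_array r1 j n i * pos_array r2 k n i) n *
    avg (fun N y => centered_array r1 (pi j) N y * centered_array r2 (rho k) N y) N.
Proof.
rewrite /lin_cov /avg.
transitivity (\sum_(i < n) \sum_(j < r1) \sum_(k < r2)
    (pos_array r1 j n i * pos_array r2 k n i) / n%:R *
   ((\sum_(y < N) centered_array r1 (pi j) N y * centered_array r2 (rho k) N y) / N%:R)).
  rewrite mulr_suml; apply: eq_bigr => i _.
  have -> : \sum_(y < N) lin_kernel pi n N i y * lin_kernel rho n N i y =
     \sum_(j < r1) \sum_(k < r2) pos_array r1 j n i * pos_array r2 k n i *
       \sum_(y < N) centered_array r1 (pi j) N y * centered_array r2 (rho k) N y.
    under eq_bigr do rewrite /lin_kernel big_distrlr/=.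
    rewrite exchange_big; apply: eq_bigr => j _ /=.
    rewrite exchange_big; apply: eq_bigr => k _ /=.
    by rewrite mulr_sumr; apply: eq_bigr => y _; rewrite mulrACA.
  rewrite -mulrA mulr_suml; apply: eq_bigr => j _; rewrite mulr_suml; apply: eq_bigr => k _.
  by rewrite [_^-1 * _]mulrC mulrACA.
rewrite exchange_big; apply: eq_bigr => j _; rewrite exchange_big; apply: eq_bigr => k _ /=.
by rewrite -mulr_suml -mulr_suml.
Qed.

Lemma cvg_lin_cov (r1 r2 : nat) (pi : 'S_r1) (rho : 'S_r2) :
  cvg ((fun n => lin_cov pi rho n (n ^ 4)) @ \oo).
Proof.
under eq_fun do rewrite lin_covE.
apply/cvg_ex; eexists; apply: cvg_sumr => j _; apply: cvg_sumr => k _; apply: cvgM.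
  apply: cvg_avg; apply: poly_array_M; exact: poly_array_pos.
apply: (cvg_comp _ _ cvg_pow4); apply: cvg_avg.
by apply: poly_array_M; exact: poly_array_centered.
Qed.

Lemma pos_array01 (r : nat) (k : 'I_r) n i : (i < n)%N -> 0 <= pos_array r k n i <= 1.
Proof.
move=> ni; have n0 : (0 < n)%N by apply: leq_ltn_trans ni.
(* Positions are read here as values of a uniform word: [pos_array] becomes a conditional
   probability for the identity pattern, hence lies in [[0, 1]]. *)
have := pexp_pat_at R 1%g n0 k (Ordinal ni); rewrite perm1 /pat_proj subrK.
rewrite -/(pos_array r k n i) => <-.
have w1 := @unifw_sum R n n0; apply/andP; split.
  by apply: pexp_ge0 => [*|*|z]; rewrite ?unifw_ge0 ?w1 ?ler0n.
rewrite -[leRHS](pexp1 (I := 'I_r) (w1 _)); apply: ler_pexp => [*|z]; rewrite ?unifw_ge0//.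
by rewrite -[leRHS]/1%:R ler_nat leq_b1.
Qed.

Lemma centered_array_le (r : nat) (k : 'I_r) n i : (i < n)%N -> `|centered_array r k n i| <= 1.
Proof.
move=> ni; have n0 : (0 < n)%N by apply: leq_ltn_trans ni.
by have := pat_proj_le R 1%g n0 k (Ordinal ni); rewrite perm1.
Qed.

Lemma lin_kernel_le (r : nat) (pi : 'S_r) n N i y : (i < n)%N -> (y < N)%N ->
  `|lin_kernel pi n N i y| <= r%:R.
Proof.
move=> ni yN; apply: (le_trans (ler_norm_sum _ _ _)).
have -> : r%:R = \sum_(j < r) 1 :> R by rewrite sumr_const card_ord.
apply: ler_sum => j _; rewrite normrM.
have /andP[p0 p1] := pos_array01 j ni.
by rewrite ger0_norm// mulr_ile1// centered_array_le.
Qed.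

Lemma cvg_bin (a : nat -> nat) (x : R) k : (fun n => (a n)%:R / n%:R) @ \oo --> x ->
  (fun n => 'C(a n, k)%:R / n%:R ^+ k) @ \oo --> x ^+ k / k`!%:R.
Proof.
move=> ax; elim: k => [|k IHk].
  under eq_fun do rewrite bin0 expr0.
  by rewrite expr0 fact0; apply: cvg_cst.
have hak : (fun n => (a n - k)%:R / n%:R) @ \oo --> x.
  apply/cvgrPdist_le => e e0.
  have e20 : 0 < e / 2 by rewrite divr_gt0.
  near=> n.
  have h1 : `|x - (a n)%:R / n%:R| <= e / 2.
    by near: n; move/cvgrPdist_le : ax; exact.
  have h2 : k%:R / n%:R <= e / 2 :> R.
    near: n; have := @cvg_harmonic0 R k%:R => /cvgrPdist_le /(_ _ e20); apply: filterS => n.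
    by rewrite sub0r normrN => /(le_trans (ler_norm _)).
  have -> : x - (a n - k)%:R / n%:R = (x - (a n)%:R / n%:R) + ((a n)%:R - (a n - k)%:R) / n%:R by ring.
  rewrite (le_trans (ler_normD _ _))// [e]splitr lerD// (le_trans _ h2)//.
  rewrite normrM normfV (ger0_norm (ler0n _ n)) ler_wpM2r ?invr_ge0//.
  have [ka|ak] := leqP k (a n); first by rewrite natrB// opprB addrC subrK ger0_norm.
  by rewrite (eqP (ltnW ak : (a n - k == 0)%N)) subr0 ger0_norm// ler_nat ltnW.
have : (fun n => (a n - k)%:R / n%:R * ('C(a n, k)%:R / n%:R ^+ k) / k.+1%:R) @ \oo -->
    x * (x ^+ k / k`!%:R) / k.+1%:R.
  by apply: cvgM; [exact: cvgM|exact: cvg_cst].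
rewrite factS natrM exprS invfM [_^-1 * _]mulrC !mulrA; apply: cvg_trans.
rewrite [X in X @ _](_ : _ = (fun n => (a n - k)%:R / n%:R * ('C(a n, k)%:R / n%:R ^+ k) / k.+1%:R))//.
apply/funext => n.
have k0 : k.+1%:R != 0 :> R by rewrite pnatr_eq0.
have : (k.+1)%:R * 'C(a n, k.+1)%:R = (a n - k)%:R * 'C(a n, k)%:R :> R.
  by rewrite -!natrM mul_bin_left.
move=> /(canRL (mulKf k0)) ->; rewrite exprS invfM; ring.
Unshelve. all: by end_near. Qed.

Lemma cvg_pat_prob r : (fun n => pat_prob R r n) @ \oo --> (r`!%:R^-1 : R).
Proof.
rewrite -[_^-1]mul1r -[X in X / _](expr1n _ r); apply: cvg_bin.
apply: cvg_near_cst; exists 1%N => //= n n0.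
by rewrite divff// pnatr_eq0 -lt0n.
Qed.

(** Nothing lies below [i = 0], so only the index [k = 0] survives. *)
Lemma cvg_pos_array0 r (k : 'I_r) :
  (fun n => pos_array r k n 0) @ \oo --> ((k == 0 :> nat)%:R / (r.-1)`!%:R : R).
Proof.
rewrite /pos_array /pos_count; case: (nat_of_ord k) => [|k'] /=; last first.
  under eq_fun do rewrite bin0n mul0n mul0r.
  by rewrite mul0r; exact: cvg_cst.
under eq_fun do rewrite bin0n mul1n !subn0.
rewrite -[X in X / _](expr1n _ r.-1); apply: cvg_bin.
have -> : (fun n => n.-1%:R / n%:R) = (fun n : nat => n%:R / n%:R - (n != 0)%:R / n%:R) :> (nat -> R).
  apply/funext => -[|n]; first by rewrite !invr0 !mulr0 subr0.
  by rewrite -mulrBl -natr1 addrK.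
have h1 : (fun n : nat => n%:R / n%:R) @ \oo --> (1 : R).
  by apply: cvg_near_cst; exists 1%N => //= n n0; rewrite divff// pnatr_eq0 -lt0n.
have h2 : (fun n : nat => (n != 0)%:R / n%:R) @ \oo --> (0 : R).
  rewrite [X in X @ _](_ : _ = (fun n => 1 / n%:R)); first exact: cvg_harmonic0.
  by apply/funext => -[|n]; rewrite ?invr0 ?mulr0.
by have := cvgB h1 h2; rewrite subr0; exact.
Qed.

(** Filter of pairs [(n, i)] with [n] tending to infinity and [i / n] tending to 0. It is based on
    proportions [i <= d n], so that for large [n] its sets keep a positive fraction of the
    indices. *)
Definition corner : set_system (nat * nat) :=
  filter_from [set p : R * nat | 0 < p.1]
    (fun p => [set q : nat * nat | [/\ (p.2 <= q.1)%N, (q.2 < q.1)%N & q.2%:R <= p.1 * q.1%:R :> R]]).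

Global Instance corner_filter : Filter corner.
Proof.
apply: filter_from_filter; first by exists (1, 0%N) => /=.
move=> [d M] [d' M'] /= d0 d'0; exists (Num.min d d', maxn M M') => /=.
  by rewrite lt_min d0.
move=> [n i] /= []; rewrite geq_max => /andP[h1 h2] ni h; split; split => //=.
  by rewrite (le_trans h)// ler_wpM2r// ge_min lexx.
by rewrite (le_trans h)// ler_wpM2r// ge_min lexx orbT.
Qed.

Lemma cvg_corner (u : nat -> nat -> R) (l : R) : poly_array u ->
  (fun n => u n 0%N) @ \oo --> l -> (fun q => u q.1 q.2) @ corner --> l.
Proof.
move=> pu ul; apply/cvgrPdist_le => e e0.
have [d d0 [M _ hM]] := poly_array_corner pu ul e0.
exists (d, M) => //= -[n i] /= [Mn ni id].
by rewrite distrC; apply: hM.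
Qed.

Lemma count_corner (d : R) (n : nat) : 0 < d <= 1 ->
  d * n%:R <= \sum_(i < n) (i%:R <= d * n%:R)%R%:R.
Proof.
move=> /andP[d0 d1]; have dn0 : 0 <= d * n%:R by rewrite mulr_ge0// ltW.
have /andP[t1 t2] := truncn_itv dn0.
have [tn|nt] := leqP (Num.truncn (d * n%:R)).+1 n.
  apply: (le_trans (ltW t2)).
  rewrite -[in leLHS](card_ord_lt tn) natr_card; apply: ler_sum => i _.
  have [it|_] /= := ltnP i (Num.truncn (d * n%:R)).+1; last exact: ler0n.
  by rewrite (le_trans _ t1)// ler_nat.
(* Here the truncated part of [d n] is at least [n], so every index counts, and [d <= 1]
   concludes. *)
have E : \sum_(i < n) (i%:R <= d * n%:R)%R%:R = n%:R :> R.
  rewrite -[in RHS](card_ord n) -sum1_card natr_sum; apply: eq_bigr => i _.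
  by rewrite (le_trans _ t1)// ler_nat -ltnS (leq_trans (ltn_ord i))// ltnW.
by rewrite E ler_piMl.
Qed.

Theorem lin_cov_gt0 (r : nat) (pi : 'S_r) : (2 <= r)%N ->
  0 < limn (fun n => lin_cov pi pi n (n ^ 4)).
Proof.
move=> r2; have r0 : (0 < r)%N by lia.
pose o : 'I_r := Ordinal r0.
(* [c] is the limit of the centred value term for [j = 0] at the corner. It is nonzero because [0],
   [1 / r!] and [1 / (r - 1)!] are distinct for [r >= 2]. *)
pose c : R := (pi o == 0 :> nat)%:R / (r.-1)`!%:R - r`!%:R^-1.
have f1 : 0 < (r.-1)`!%:R :> R by rewrite ltr0n fact_gt0.
have c0 : c != 0.
  have fE : r`!%:R = r%:R * (r.-1)`!%:R :> R by rewrite -natrM -{1 2}(prednK r0) -factS.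
  have r1 : 1 < r%:R :> R by rewrite ltr1n.
  rewrite /c; case: (nat_of_ord (pi o) == 0)%N => /=; last by rewrite mul0r sub0r oppr_eq0 invr_eq0 pnatr_eq0 -lt0n fact_gt0.
  rewrite mul1r subr_eq0 fE (inj_eq invr_inj) -{1}[(r.-1)`!%:R]mul1r.
  by rewrite (inj_eq (mulIf (lt0r_neq0 f1))) lt_eqF.
pose D (q : (nat * nat) * (nat * nat)) := lin_kernel pi q.1.1 q.2.1 q.1.2 q.2.2.
have cvgD : D @ filter_prod corner corner --> (r.-1)`!%:R^-1 * c.
  have -> : (r.-1)`!%:R^-1 * c = \sum_(j < r) ((j == 0 :> nat)%:R / (r.-1)`!%:R) *
      ((pi j == 0 :> nat)%:R / (r.-1)`!%:R - r`!%:R^-1).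
    rewrite (bigD1 o)//= big1 ?addr0 ?mul1r// => j /negP jo.
    rewrite (_ : (j == 0 :> nat) = false) ?mul0r//; apply/negP => j0; apply: jo.
    by rewrite -val_eqE.
  rewrite /D /lin_kernel; apply: cvg_big => [|j _].
    by move=> x; exact: add_continuous.
  apply: cvgM.
    apply: (cvg_comp fst (fun q : nat * nat => pos_array r j q.1 q.2)); first exact: cvg_fst.
    apply: cvg_corner; first exact: poly_array_pos.
    exact: cvg_pos_array0.
  apply: (cvg_comp snd (fun q : nat * nat => centered_array r (pi j) q.1 q.2)); first exact: cvg_snd.
  apply: cvg_corner; first exact: poly_array_centered.
  by apply: cvgB; [exact: cvg_pos_array0|exact: cvg_pat_prob].
set l := _ * c in cvgD.
have l0 : 0 < `|l| / 2 by rewrite divr_gt0// normr_gt0 mulf_neq0// invr_neq0 ?lt0r_neq0.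
have /cvgrPdist_le/(_ _ l0)[[A B]/= [[[dA MA]/= dA0 sA] [[dB MB]/= dB0 sB]] sAB] := cvgD.
pose d := Num.min 1 (Num.min dA dB).
have d01 : 0 < d <= 1 by rewrite !lt_min ltr01 dA0 dB0/= ge_min lexx.
have [dA' dB'] : d <= dA /\ d <= dB by split; rewrite !ge_min lexx ?orbT.
(* Near the corner the kernel is at least half of its limit in absolute value, and a fraction at
   least [d] of the positions, and of the values, lies there. *)
apply: (@lt_le_trans _ _ ((`|l| / 2) ^+ 2 * d ^+ 2)).
  by rewrite mulr_gt0 ?exprn_gt0//; case/andP: d01.
apply: limr_ge; first exact: cvg_lin_cov.
near=> n.
have n0 : (0 < n)%N by near: n; exact: nbhs_infty_gt.
have nA : (MA <= n)%N by near: n; exact: nbhs_infty_ge.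
have nB : (MB <= n ^ 4)%N.
  apply: (@leq_trans n); first by near: n; exact: nbhs_infty_ge.
  by rewrite -[X in (X <= _)%N](expn1 n) leq_pexp2l.
have N0 : (0 < n ^ 4)%N by rewrite expn_gt0 n0.
rewrite /lin_cov ler_pdivlMr ?ltr0n//.
have S1 := count_corner n d01.
have S2 := count_corner (n ^ 4) d01.
have key (i : 'I_n) (y : 'I_(n ^ 4)) :
    (`|l| / 2) ^+ 2 * ((i%:R <= d * n%:R)%R%:R * (y%:R <= d * (n ^ 4)%N%:R)%R%:R) <=
    lin_kernel pi n (n ^ 4) i y * lin_kernel pi n (n ^ 4) i y.
  rewrite -expr2; case: (boolP (i%:R <= _)) => [hi|_]; last by rewrite mul0r mulr0 sqr_ge0.
  case: (boolP (y%:R <= _)) => [hy|_]; last by rewrite mulr0 mulr0 sqr_ge0.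
  rewrite !mulr1 -[leRHS]real_normK ?num_real// ler_sqr ?nnegrE// ?(ltW l0)//.
  have : `|l - D ((n, nat_of_ord i), ((n ^ 4)%N, nat_of_ord y))| <= `|l| / 2.
    apply: (sAB ((n, nat_of_ord i), ((n ^ 4)%N, nat_of_ord y))); split => /=.
      by apply: sA; split => //=; rewrite (le_trans hi)// ler_wpM2r.
    by apply: sB; split => //=; rewrite (le_trans hy)// ler_wpM2r.
  rewrite /D /=; move: (lin_kernel _ _ _ _ _) => z hz.
  have := ler_normD (l - z) z; rewrite subrK; lra.
apply: (@le_trans _ _ (\sum_(i < n) ((`|l| / 2) ^+ 2 * (i%:R <= d * n%:R)%R%:R) * d)).
  rewrite -mulr_suml -mulr_sumr.
  have -> : (`|l| / 2) ^+ 2 * d ^+ 2 * n%:R = (`|l| / 2) ^+ 2 * (d * n%:R) * d by ring.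
  by rewrite ler_wpM2r ?ler_wpM2l ?exprn_ge0 ?(ltW l0)//; case/andP: d01 => /ltW.
apply: ler_sum => i _; rewrite ler_pdivlMr ?ltr0n//.
apply: (le_trans _ (ler_sum _ (fun y _ => key i y))).
rewrite -mulr_sumr -mulr_sumr.
move: (i%:R <= _)%R => b; move: S2; set s := \sum_(_ < _) _ => S2.
have -> : (`|l| / 2) ^+ 2 * b%:R * d * (n ^ 4)%:R = (`|l| / 2) ^+ 2 * (b%:R * (d * (n ^ 4)%:R)).
  by rewrite -!mulrA.
by apply: ler_wpM2l; [rewrite exprn_ge0 ?(ltW l0)|exact: ler_wpM2l].
Unshelve. all: by end_near. Qed.

End Projections.

(** * Characteristic functions *)

Section Taylor.
Variable R : realType.
Implicit Types x y a b : R.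

Lemma ler_norm_MVT (f df : R -> R) (B x y : R) :
  (forall z : R, is_derive z 1 f (df z)) ->
  (forall z, (x <= z <= y) || (y <= z <= x) -> `|df z| <= B) ->
  `|f y - f x| <= B * `|y - x|.
Proof.
move=> fdf; wlog xy : x y / x <= y.
  move=> H; have [xy|/ltW yx] := leP x y; first exact: H.
  move=> hB; rewrite distrC (distrC y); apply: H => // z.
  by rewrite orbC; exact: hB.
move=> hB.
have [|c + ->] := MVT_segment xy (fun z _ => fdf z).
  apply: derivable_within_continuous => z _.
  by have [] := fdf z.
rewrite in_itv/= => cxy; rewrite normrM ler_wpM2r// hB// cxy//.
Qed.

Lemma norm_sin_le x : `|sin x| <= `|x|.
Proof.
have := @ler_norm_MVT sin cos 1 0 x (fun z => is_derive_sin z).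
by rewrite sin0 !subr0 mul1r; apply => z _; exact: cos_max.
Qed.

Lemma norm_cosB x y : `|cos y - cos x| <= `|y - x|.
Proof.
have := @ler_norm_MVT cos (fun z => - sin z) 1 x y (fun z => is_derive_cos z).
by rewrite mul1r; apply => z _; rewrite normrN; exact: sin_max.
Qed.

Lemma sandwiched_norm x z : (0 <= z <= x) || (x <= z <= 0) -> `|z| <= `|x|.
Proof.
case/orP => /andP[h1 h2]; first by rewrite !ger0_norm// (le_trans h1).
by rewrite !ler0_norm ?lerN2// (le_trans h1).
Qed.

Lemma cos_Taylor1 x : `|cos x - 1| <= x ^+ 2 / 2.
Proof.
have -> : cos x - 1 = - (sin (x / 2) ^+ 2 *+ 2).
  rewrite -{1}[x](divfK (x := 2))// mulr_natr cos_mulr2n cos2sin2; ring.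
rewrite normrN ger0_norm ?mulrn_wge0 ?sqr_ge0//.
have := norm_sin_le (x / 2); rewrite -(ler_sqr (x := `|sin _|)) ?nnegrE//.
rewrite !real_normK ?num_real// => h; rewrite -[leLHS]mulr_natr.
rewrite (_ : x ^+ 2 / 2 = (x / 2) ^+ 2 * 2); last by field.
by rewrite ler_wpM2r.
Qed.

Lemma sin_Taylor x : `|sin x - x| <= `|x| ^+ 3 / 2.
Proof.
have h (z : R) : is_derive z 1 (fun x => sin x - x) (cos z - 1) by exact: is_deriveB.
have := @ler_norm_MVT _ _ (`|x| ^+ 2 / 2) 0 x h.
rewrite sin0 !subr0 => /(_ _)/le_trans; apply.
  move=> z /sandwiched_norm zx; apply: (le_trans (cos_Taylor1 z)).
  by rewrite ler_wpM2r// -[z ^+ 2]real_normK ?num_real// ler_sqr ?nnegrE.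
by rewrite mulrAC -exprSr.
Qed.

Lemma cos_Taylor2 x : `|cos x - (1 - x ^+ 2 / 2)| <= `|x| ^+ 4 / 2.
Proof.
have h (z : R) : is_derive z 1 (fun x => cos x - (1 - x ^+ 2 / 2)) (- (sin z - z)).
  by apply: is_derive_eq; rewrite /GRing.scale/=; field.
have := @ler_norm_MVT _ _ (`|x| ^+ 3 / 2) 0 x h.
rewrite cos0 expr0n/= mul0r !subr0 subrr subr0 => /(_ _)/le_trans; apply.
  move=> z /sandwiched_norm zx; rewrite normrN; apply: (le_trans (sin_Taylor z)).
  by rewrite ler_wpM2r// lerXn2r ?nnegrE.
by rewrite mulrAC -exprSr.
Qed.

(** Squeezed between [1 - x <= exp (- x)] and [exp (- x) <= 1 / (1 + x) <= 1 - x + x ^ 2]. *)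
Lemma expRN_Taylor x : 0 <= x -> `|expR (- x) - (1 - x)| <= x ^+ 2.
Proof.
move=> x0; have h1 := expR_ge1Dx (- x); have h2 := expR_ge1Dx x.
have x1 : 0 < 1 + x by rewrite ltr_pwDl.
have h3 : expR (- x) <= (1 + x)^-1 by rewrite expRN lef_pV2 ?posrE ?expR_gt0.
have h4 : (1 + x)^-1 <= 1 - x + x ^+ 2.
  rewrite -[leLHS]mul1r ler_pdivrMr//.
  rewrite (_ : _ * _ = 1 + x ^+ 3); last by ring.
  by rewrite lerDl exprn_ge0.
rewrite ger0_norm; first by rewrite lerBlDl (le_trans h3).
by rewrite subr_ge0.
Qed.

End Taylor.

(** * Characteristic function of a sum of bounded independent terms *)

Section IndependentSum.
Variables (R : realType) (I T : finType) (w : I -> T -> R) (eta : I -> T -> R) (b : R).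
Hypothesis w0 : forall i t, 0 <= w i t.
Hypothesis w1 : forall i, \sum_t w i t = 1.
Hypothesis b01 : 0 <= b <= 1.
Hypothesis eta_le : forall i t, `|eta i t| <= b.
Hypothesis eta0 : forall i, \sum_t w i t * eta i t = 0.

Local Notation var i := (\sum_t w i t * eta i t ^+ 2).

Let sum_le (i : I) (F G : T -> R) (c : R) : (forall t, `|F t - G t| <= c) ->
  `|\sum_t w i t * F t - \sum_t w i t * G t| <= c.
Proof.
move=> h; rewrite -sumrB (le_trans (ler_norm_sum _ _ _))//.
rewrite -[leRHS]mul1r -(w1 i) mulr_suml; apply: ler_sum => t _.
by rewrite -mulrBr normrM ger0_norm// ler_wpM2l.
Qed.

Let var01 i : 0 <= var i <= b ^+ 2.
Proof.
rewrite sumr_ge0 => [/=|t _]; last by rewrite mulr_ge0 ?sqr_ge0.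
rewrite -[leRHS]mul1r -(w1 i) mulr_suml; apply: ler_sum => t _.
rewrite ler_wpM2l// -real_normK ?num_real// ler_sqr ?nnegrE//.
by case/andP: b01.
Qed.

Let sin_step i : `|\sum_t w i t * sin (eta i t)| <= b ^+ 3 / 2.
Proof.
have -> : \sum_t w i t * sin (eta i t) =
  \sum_t w i t * sin (eta i t) - \sum_t w i t * eta i t by rewrite eta0 subr0.
apply: sum_le => t; apply: (le_trans (sin_Taylor _)).
rewrite ler_wpM2r// lerXn2r ?nnegrE//; by case/andP: b01.
Qed.

Let cos_step i : `|\sum_t w i t * cos (eta i t) - expR (- (var i / 2))| <= b ^+ 3.
Proof.
have /andP[b0 b1] := b01.
have E : 1 - var i / 2 = \sum_t w i t * (1 - eta i t ^+ 2 / 2).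
  under [RHS]eq_bigr do rewrite mulrBr mulr1 mulrA.
  by rewrite sumrB w1 -mulr_suml.
have h1 : `|\sum_t w i t * cos (eta i t) - (1 - var i / 2)| <= b ^+ 4 / 2.
  rewrite E; apply: sum_le => t; apply: (le_trans (cos_Taylor2 _)).
  by rewrite ler_wpM2r// lerXn2r ?nnegrE.
have /andP[v0 vb] := var01 i.
have h2 : `|expR (- (var i / 2)) - (1 - var i / 2)| <= (var i / 2) ^+ 2.
  by apply: expRN_Taylor; rewrite divr_ge0.
have h3 : (var i / 2) ^+ 2 <= b ^+ 4 / 2.
  have : var i ^+ 2 <= b ^+ 4 by rewrite (_ : b ^+ 4 = (b ^+ 2) ^+ 2) ?lerXn2r ?nnegrE ?exprn_ge0// -exprM.
  have : 0 <= var i ^+ 2 by rewrite exprn_ge0.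
  rewrite expr_div_n; lra.
have h4 : b ^+ 4 <= b ^+ 3 by rewrite exprS ler_piMl ?exprn_ge0.
rewrite (_ : _ - _ = (\sum_t w i t * cos (eta i t) - (1 - var i / 2)) -
  (expR (- (var i / 2)) - (1 - var i / 2))); last by ring.
rewrite (le_trans (ler_normB _ _))//; lra.
Qed.

(** One variable is split off at a time with the addition formula. Centring makes the mean of its
    sine [O(b ^ 3)], and the mean of its cosine matches [exp (- var / 2)] up to [b ^ 3]. Each step
    thus costs at most [2 b ^ 3], and the sine of the remaining sum need only be bounded by 1. *)
Lemma pexp_cos_sum (s : seq I) (theta : R) : uniq s ->
  `|pexp w (fun f => cos (theta + \sum_(i <- s) eta i (f i))) -
    cos theta * expR (- ((\sum_(i <- s) var i) / 2))| <= (2 * b ^+ 3) *+ size s.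
Proof.
have /andP[b0 b1] := b01.
elim: s => [_|i s IHs /andP[si us]].
  rewrite big_nil mul0r oppr0 expR0 mulr1 (_ : pexp _ _ = cos theta) ?subrr ?normr0 ?mulr0n//.
  rewrite -[RHS](pexp_cst w1); apply: eq_pexp => f; by rewrite big_nil addr0.
pose A (f : {ffun I -> T}) := theta + \sum_(k <- s) eta k (f k).
have depA (g : R -> R) : depends_on (~: [set i])%SET (fun f => g (A f)).
  move=> f f' ff'; congr g; congr (_ + _); rewrite !big_seq; apply: eq_bigr => k ks.
  by rewrite ff'// !inE; apply: contraNneq si => <-.
have depi (g : R -> R) : depends_on [set i]%SET (fun f : {ffun I -> T} => g (eta i (f i))).
  by move=> f f' ff'; rewrite ff'// inE.
have -> : pexp w (fun f => cos (theta + \sum_(k <- i :: s) eta k (f k))) =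
   (\sum_t w i t * cos (eta i t)) * pexp w (fun f => cos (A f)) -
   (\sum_t w i t * sin (eta i t)) * pexp w (fun f => sin (A f)).
  rewrite -(pexp_coord w1 i (fun t => cos (eta i t))) -(pexp_coord w1 i (fun t => sin (eta i t))).
  rewrite -(pexpM w1 (depi cos) (depA cos)) -(pexpM w1 (depi sin) (depA sin)) -pexpB.
  by apply: eq_pexp => f; rewrite big_cons addrCA cosD.
rewrite big_cons mulrDl opprD expRD.
have := IHs us; rewrite -/(A _); set X := cos theta * _; set EA := pexp w _ => hA.
have hA' : `|EA| <= 1.
  rewrite -(pexp1 w1); apply: (le_trans (ler_norm_pexp w0 _)).
  by apply: ler_pexp => // f; exact: cos_max.
have hS : `|pexp w (fun f => sin (A f))| <= 1.
  rewrite -(pexp1 w1); apply: (le_trans (ler_norm_pexp w0 _)).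
  by apply: ler_pexp => // f; exact: sin_max.
have hc := cos_step i; have hs := sin_step i.
set e := expR (- (var i / 2)) in hc *.
have e01 : `|e| <= 1.
  rewrite ger0_norm ?expR_ge0// -[leRHS]expR0 ler_expR oppr_le0 divr_ge0//.
  by have /andP[] := var01 i.
set C := \sum_t w i t * cos _ in hc *; set S := \sum_t w i t * sin _ in hs *.
set ES := pexp w _ in hS *.
rewrite (_ : _ - _ = (C - e) * EA + e * (EA - X) - S * ES); last by rewrite /X; ring.
rewrite (le_trans (ler_normB _ _))// mulrS.
have p1 : `|(C - e) * EA| <= b ^+ 3 by rewrite normrM -[leRHS]mulr1 ler_pM.
have p2 : `|e * (EA - X)| <= (2 * b ^+ 3) *+ size s by rewrite normrM -[leRHS]mul1r ler_pM.
have p3 : `|S * ES| <= b ^+ 3 / 2 by rewrite normrM -[leRHS]mulr1 ler_pM.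
have b3 : 0 <= b ^+ 3 by rewrite exprn_ge0.
have := ler_normD ((C - e) * EA) (e * (EA - X)); lra.
Qed.

End IndependentSum.

(** * Characteristic function of the normal law *)

Section GaussianCharacteristic.
Variables (R : realType) (s : R).
Hypothesis s0 : 0 < s.
Local Notation mu := (@lebesgue_measure R).
Local Notation pdf := (normal_pdf 0 s).

Let s_neq0 : s != 0. Proof. by rewrite gt_eqF. Qed.

Let pdfE x : pdf x = normal_peak s * expR (- x ^+ 2 / (s ^+ 2 *+ 2)).
Proof. by rewrite normal_pdfE// /normal_fun subr0. Qed.

Let is_derive_pdf (x : R) : is_derive x 1 pdf (- (x / s ^+ 2) * pdf x).
Proof.
rewrite (_ : pdf = fun x => normal_peak s * expR (- x ^+ 2 / (s ^+ 2 *+ 2))); last first.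
  by apply/funext => y; exact: pdfE.
have h : is_derive x 1 (fun x : R => - x ^+ 2 / (s ^+ 2 *+ 2)) (- (x / s ^+ 2)).
  apply: is_derive_eq; rewrite /GRing.scale/=; field; exact: s_neq0.
have h2 : is_derive x 1 (fun x : R => expR (- x ^+ 2 / (s ^+ 2 *+ 2)))
   (- (x / s ^+ 2) * expR (- x ^+ 2 / (s ^+ 2 *+ 2))).
  by apply: is_derive_eq; rewrite mulrC.
by apply: is_derive_eq; rewrite /GRing.scale/=; ring.
Qed.

Lemma integrable_bounded_pdf (f : R -> R) (B : R) : measurable_fun [set: R] f ->
  (forall x, `|f x| <= B) -> mu.-integrable [set: R] (fun x => (f x * pdf x)%:E).
Proof.
move=> mf fB; have iB := integrableZl measurableT B (integrable_normal_pdf 0 s).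
apply: le_integrable iB => //.
  apply/measurable_EFinP/measurable_funM => //; exact: measurable_normal_pdf.
move=> x _ /=; rewrite lee_fin !normrM ler_wpM2r// (le_trans (fB x))//.
exact: ler_norm.
Qed.

Let xexp_le : exists K : R, forall x, `|x| * expR (- x ^+ 2 / (s ^+ 2 *+ 2)) <=
  K * expR (- x ^+ 2 / ((2 * s) ^+ 2 *+ 2)).
Proof.
(* [3 / (8 s ^ 2)] is the difference [1 / (2 s ^ 2) - 1 / (8 s ^ 2)] between the exponents for
   standard deviations [s] and [2 s]; the wider Gaussian absorbs the factor [|x|]. *)
have c0 : 0 < 3 / (8 * s ^+ 2) by rewrite divr_gt0 ?mulr_gt0 ?exprn_gt0.
set c := 3 / (8 * s ^+ 2) in c0.
exists (Num.max 1 c^-1) => x; set K := Num.max _ _.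
have K1 : 1 <= K by rewrite le_max lexx.
have Kc : 1 <= K * c by rewrite -ler_pdivrMr// mul1r le_max lexx orbT.
have -> : - x ^+ 2 / ((2 * s) ^+ 2 *+ 2) = c * x ^+ 2 + - x ^+ 2 / (s ^+ 2 *+ 2).
  by rewrite /c; field; exact: s_neq0.
rewrite expRD mulrA ler_wpM2r ?expR_ge0//.
apply: (@le_trans _ _ (K * (1 + c * x ^+ 2))); last first.
  by rewrite ler_wpM2l ?expR_ge1Dx// (le_trans ler01).
rewrite mulrDr mulr1 mulrA.
apply: (@le_trans _ _ (1 + x ^+ 2)); last by rewrite lerD// ler_peMl ?sqr_ge0.
rewrite -[x ^+ 2]real_normK ?num_real//; have := sqr_ge0 (`|x| - 1).
by have := normr_ge0 x; rewrite sqrrB1 mulr2n; lra.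
Qed.

Lemma integrable_xpdf : mu.-integrable [set: R] (fun x => (`|x| * pdf x)%:E).
Proof.
have [K hK] := xexp_le.
have s20 : 2 * s != 0 by rewrite mulf_neq0.
have peak2 : 0 < normal_peak (2 * s) by exact: normal_peak_gt0.
have := integrable_normal_pdf 0 (2 * s) =>
  /(integrableZl measurableT (normal_peak s * K / normal_peak (2 * s))).
apply: le_integrable => //.
  apply/measurable_EFinP/measurable_funM; last exact: measurable_normal_pdf.
  exact: normr_measurable.
move=> x _ /=; rewrite lee_fin.
rewrite ger0_norm ?mulr_ge0 ?normal_pdf_ge0// (le_trans _ (ler_norm _))//.
rewrite pdfE [in leRHS]normal_pdfE// /normal_fun subr0.
rewrite [leRHS]mulrA divfK ?gt_eqF// [leLHS]mulrCA -[leRHS]mulrA.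
by rewrite ler_wpM2l// normal_peak_ge0.
Qed.

Lemma integrable_le_xpdf (f : R -> R) : measurable_fun [set: R] f ->
  (forall x, `|f x| <= `|x|) -> mu.-integrable [set: R] (fun x => (f x * pdf x)%:E).
Proof.
move=> mf fx; apply: le_integrable integrable_xpdf => //.
  apply/measurable_EFinP/measurable_funM => //; exact: measurable_normal_pdf.
move=> x _ /=; rewrite lee_fin !normrM normr_id ler_wpM2r//.
Qed.

Let measurable_cos_affine (t theta : R) : measurable_fun [set: R] (fun x => cos (t * x + theta)).
Proof.
apply: measurableT_comp; first exact: continuous_measurable_fun (@continuous_cos R).
by apply: measurable_funD => //; exact: measurable_funM.
Qed.

Let measurable_sin_affine (t theta : R) : measurable_fun [set: R] (fun x => sin (t * x + theta)).
Proof.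
apply: measurableT_comp; first exact: continuous_measurable_fun (@continuous_sin R).
by apply: measurable_funD => //; exact: measurable_funM.
Qed.

Let phi (theta t : R) : R := (\int[mu]_x (cos (t * x + theta) * pdf x))%R.

Let is_derive_cos_pdf (theta t x : R) :
  is_derive t 1 (fun t => cos (t * x + theta) * pdf x) (- x * sin (t * x + theta) * pdf x).
Proof.
by apply: is_derive_eq; rewrite /GRing.scale/=; ring.
Qed.

(** Differentiation under the integral sign, dominated by the integrable function [|x| pdf x]. *)
Let is_derive_phi (theta t : R) : is_derive t 1 (phi theta)
  (\int[mu]_x (- x * sin (t * x + theta) * pdf x))%R.
Proof.
have tI : `]t - 1, t + 1[%classic t by rewrite /= in_itv/= ltrDl ltrBlDr ltrDl ltr01.
pose ker (u x : R) : R := cos (u * x + theta) * pdf x.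
have d1 (u x : R) : partial1of2 ker u x = - x * sin (u * x + theta) * pdf x.
  by rewrite partial1of2E; have [_ ->] := is_derive_cos_pdf theta u x.
have h1 (u : R) : `]t - 1, t + 1[%classic u -> mu.-integrable setT (EFin \o ker u).
  move=> _; apply: (@integrable_bounded_pdf (fun y => cos (u * y + theta)) 1) => // y.
  exact: cos_max.
have h2 (u y : R) : `]t - 1, t + 1[%classic u -> setT y -> derivable (ker ^~ y) u 1.
  by move=> _ _; have [] := is_derive_cos_pdf theta u y.
have h3 (y : R) : 0 <= `|y| * pdf y by rewrite mulr_ge0 ?normal_pdf_ge0.
have h4 (u y : R) : `]t - 1, t + 1[%classic u -> setT y ->
    `|partial1of2 ker u y| <= `|y| * pdf y.
  move=> _ _; rewrite d1 !normrM normrN (ger0_norm (normal_pdf_ge0 _ _ _)).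
  by rewrite ler_wpM2r ?normal_pdf_ge0// ler_piMr// sin_max.
have := derivable_under_integral measurableT tI h1 h2 h3 integrable_xpdf h4.
move=> dphi; apply: DeriveDef => //.
rewrite -derive1E (differentiation_under_integral measurableT tI h1 h2 h3 integrable_xpdf h4).
by apply: eq_Rintegral => x _; rewrite d1.
Qed.

(** Derivative in [x] of [s ^ 2 sin (t x + theta) pdf x]. That its integral vanishes is Stein's
    identity, which turns the formula for the derivative of [phi] into the differential equation
    [phi' = - s ^ 2 t phi]. *)
Let stein_fun (theta t x : R) : R :=
  - x * sin (t * x + theta) * pdf x + s ^+ 2 * t * (cos (t * x + theta) * pdf x).

Let stein_prim (theta t x : R) : R := s ^+ 2 * (sin (t * x + theta) * pdf x).

Let is_derive_stein (theta t x : R) :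
  is_derive x 1 (stein_prim theta t) (stein_fun theta t x).
Proof.
have hsin : is_derive x 1 (fun x : R => sin (t * x + theta)) (t * cos (t * x + theta)).
  by apply: is_derive_eq; rewrite /GRing.scale/=; ring.
have hM := is_deriveM hsin (is_derive_pdf x).
have := is_deriveZ (s ^+ 2) hM.
rewrite /stein_prim /stein_fun => /is_derive_eq; apply.
by rewrite /GRing.scale/=; field; exact: s_neq0.
Qed.

Let continuous_stein (theta t : R) : continuous (stein_fun theta t).
Proof.
move=> x; apply/differentiable_continuous/derivable1_diffP.
have hsin : is_derive x 1 (fun x : R => sin (t * x + theta)) (t * cos (t * x + theta)).
  by apply: is_derive_eq; rewrite /GRing.scale/=; ring.
have hcos : is_derive x 1 (fun x : R => cos (t * x + theta)) (- t * sin (t * x + theta)).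
  by apply: is_derive_eq; rewrite /GRing.scale/=; ring.
have hid : is_derive x 1 (fun x : R => - x) (-1) by exact: is_deriveN.
have h1 := is_deriveM (is_deriveM hid hsin) (is_derive_pdf x).
have h2 := is_deriveZ (s ^+ 2 * t) (is_deriveM hcos (is_derive_pdf x)).
by have [] := is_deriveD h1 h2.
Qed.

Let integral_stein_segment (theta t : R) (n : nat) : (0 < n)%N ->
  (\int[mu]_(x in `[(- n%:R)%R, n%:R%R]) (stein_fun theta t x)%:E =
  (stein_prim theta t n%:R - stein_prim theta t (- n%:R))%R%:E)%E.
Proof.
move=> n0; have nn : - n%:R < n%:R :> R by rewrite (@lt_trans _ _ 0) ?oppr_lt0 ?ltr0n.
have cprim : continuous (stein_prim theta t).
  move=> x; apply/differentiable_continuous/derivable1_diffP.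
  by have [] := is_derive_stein theta t x.
rewrite EFinB; apply: continuous_FTC2 => //.
- by apply: continuous_subspaceT; exact: continuous_stein.
- split.
  + by move=> x _; have [] := is_derive_stein theta t x.
  + by apply: cvg_at_right_filter; exact: cprim.
  + by apply: cvg_at_left_filter; exact: cprim.
- by move=> x _; rewrite derive1E; have [_ ->] := is_derive_stein theta t x.
Qed.

(** From [exp (- u) <= 1 / u]; polynomial decay suffices to make the boundary terms vanish. *)
Let pdf_le (x : R) : 0 < x -> pdf x <= normal_peak s * (s ^+ 2 *+ 2) / x ^+ 2.
Proof.
move=> x0; rewrite pdfE -mulrA ler_wpM2l ?normal_peak_ge0// mulNr expRN.
have u0 : 0 < x ^+ 2 / (s ^+ 2 *+ 2) by rewrite divr_gt0 ?exprn_gt0// mulrn_wgt0 ?exprn_gt0.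
rewrite -[leRHS]invf_div lef_pV2 ?posrE ?expR_gt0//.
by rewrite (le_trans _ (expR_ge1Dx _))// lerDr.
Qed.

Let pdfN x : pdf (- x) = pdf x.
Proof. by rewrite !pdfE sqrrN. Qed.

Let cvg_stein_prim (theta t : R) :
  (fun n : nat => stein_prim theta t n%:R - stein_prim theta t (- n%:R)) @ \oo --> 0.
Proof.
pose C : R := s ^+ 2 * (normal_peak s * (s ^+ 2 *+ 2)) *+ 2.
apply/cvgrPdist_le => e e0.
have := cvg_harmonic0 C => /cvgrPdist_le /(_ _ e0); apply: filter_app.
near=> n; rewrite !sub0r !normrN => /(le_trans (ler_norm _)); apply: le_trans.
have n1 : 1 <= n%:R :> R by rewrite ler1n; near: n; exact: nbhs_infty_gt.
have n0 : 0 < n%:R :> R by apply: lt_le_trans n1.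
have h (x : R) : `|s ^+ 2 * (sin x * pdf n%:R)| <= s ^+ 2 * (normal_peak s * (s ^+ 2 *+ 2) / n%:R).
  rewrite normrM [`|s ^+ 2|]ger0_norm ?sqr_ge0// ler_wpM2l ?sqr_ge0//.
  rewrite normrM (ger0_norm (normal_pdf_ge0 _ _ _)).
  apply: (@le_trans _ _ (pdf n%:R)).
    by rewrite ler_piMl ?normal_pdf_ge0// sin_max.
  apply: (le_trans (pdf_le n0)).
  rewrite ler_wpM2l ?mulr_ge0 ?normal_peak_ge0 ?mulrn_wge0 ?sqr_ge0//.
  by rewrite lef_pV2 ?posrE ?exprn_gt0// expr2 ler_peMl// ltW.
rewrite /stein_prim pdfN (le_trans (ler_normB _ _))//.
by rewrite /C mulrnAl mulr2n -mulrA lerD.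
Unshelve. all: by end_near. Qed.

Let integrable_stein1 (theta t : R) : mu.-integrable [set: R]
  (fun x => (- x * sin (t * x + theta) * pdf x)%:E).
Proof.
apply: integrable_le_xpdf => [|x].
  by apply: measurable_funM => //; exact: measurable_funN.
by rewrite normrM normrN ler_piMr// sin_max.
Qed.

Let integrable_stein2 (theta t : R) : mu.-integrable [set: R]
  (fun x => (cos (t * x + theta) * pdf x)%:E).
Proof. by apply: (@integrable_bounded_pdf _ 1) => // x; exact: cos_max. Qed.

Let integrable_stein (theta t : R) : mu.-integrable [set: R]
  (fun x => (stein_fun theta t x)%:E).
Proof.
have h := integrableD measurableT (integrable_stein1 theta t)
  (integrableZl measurableT (s ^+ 2 * t) (integrable_stein2 theta t)).
by apply: eq_integrable h.
Qed.

Let integral_stein (theta t : R) : (\int[mu]_x (stein_fun theta t x)%:E = 0)%E.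
Proof.
(* Truncation to [[-n, n]]: the fundamental theorem of calculus evaluates these integrals, and
   dominated convergence relates them to the integral over the line. *)
pose f_ n (x : R) := ((stein_fun theta t \_ `[- n%:R, n%:R]) x)%:E.
have mstein : measurable_fun [set: R] (stein_fun theta t).
  by apply: continuous_measurable_fun; exact: continuous_stein.
have patchE n (x : R) : (stein_fun theta t \_ `[- n%:R, n%:R]) x =
    stein_fun theta t x * (`|x| <= n%:R)%R%:R.
  by rewrite patchE mem_setE in_itv/= -ler_norml; case: ifP => _; rewrite ?mulr1 ?mulr0.
have h1 n : measurable_fun [set: R] (f_ n).
  apply/measurable_EFinP; apply/(measurable_restrictT _ _).1 => //.
  exact: measurable_funTS.
have h2 : {ae mu, forall x, [set: R] x -> f_ ^~ x @ \oo --> (stein_fun theta t x)%:E}.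
  apply: aeW => x _; apply: cvg_near_cst; near=> n; rewrite /f_ patchE.
  rewrite (_ : (`|x| <= n%:R)%R) ?mulr1//; near: n.
  exists (Num.truncn `|x|).+1 => // n /= xn.
  have /andP[_ /ltW/le_trans] := truncn_itv (normr_ge0 x); apply; by rewrite ler_nat.
have h3 : {ae mu, forall x n, [set: R] x -> (`|f_ n x| <= `|(stein_fun theta t x)%:E|)%E}.
  apply: aeW => x n _; rewrite lee_fin patchE normrM ler_piMr//.
  by case: (`|x| <= n%:R)%R; rewrite ?normr1 ?normr0.
have h4 := integrable_abse (integrable_stein theta t).
have [_ _ lim1] := dominated_convergence (mu := mu) measurableT h1
  ((measurable_int mu (integrable_stein theta t))) h2 h4 h3.
have lim0 : (fun n => (\int[mu]_x f_ n x)%E) @ \oo --> (0 : \bar R)%E.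
  have : (fun n : nat => (stein_prim theta t n%:R - stein_prim theta t (- n%:R))%:E) @ \oo --> (0%:E : \bar R).
    apply: cvg_EFin; first by near=> n.
    exact: cvg_stein_prim.
  apply: cvg_trans; apply: near_eq_cvg; near=> n.
  rewrite -integral_stein_segment; last by near: n; exact: nbhs_infty_gt.
  by rewrite [LHS]integral_mkcond/= restrict_EFin.
exact: (cvg_unique _ lim1 lim0).
Unshelve. all: by end_near. Qed.

Let is_derive_phi' (theta t : R) : is_derive t 1 (phi theta) (- (s ^+ 2 * t * phi theta t)).
Proof.
suff <- : (\int[mu]_x (- x * sin (t * x + theta) * pdf x))%R = - (s ^+ 2 * t * phi theta t).
  exact: is_derive_phi.
apply/eqP; rewrite -subr_eq0 opprK.
have iZ := integrableZl measurableT (s ^+ 2 * t) (integrable_stein2 theta t).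
have := RintegralD measurableT (integrable_stein1 theta t) iZ.
rewrite RintegralZl//; last exact: integrable_stein2.
by rewrite -/(phi theta t) => <-; rewrite /Rintegral integral_stein.
Qed.

Let phi0 (theta : R) : phi theta 0 = cos theta.
Proof.
rewrite /phi.
have -> : (\int[mu]_x (cos (0 * x + theta) * pdf x))%R = (\int[mu]_x (cos theta * pdf x))%R.
  by apply: eq_Rintegral => x _; rewrite mul0r add0r.
rewrite RintegralZl//; last exact: integrable_normal_pdf.
by rewrite /Rintegral integral_normal_pdf mulr1.
Qed.

(** By the differential equation the product of [phi theta u] and [exp (s ^ 2 u ^ 2 / 2)] has zero
    derivative in [u], and it equals [cos theta] at 0. *)
Lemma normal_pdf_cos (theta t : R) :
  (\int[mu]_x (cos (t * x + theta) * pdf x))%R = cos theta * expR (- (s ^+ 2 * t ^+ 2 / 2)).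
Proof.
have H (u : R) : is_derive u 1 (fun u => phi theta u * expR (s ^+ 2 * u ^+ 2 / 2)) 0.
  have h1 : is_derive u 1 (fun u : R => s ^+ 2 * u ^+ 2 / 2) (s ^+ 2 * u).
    by apply: is_derive_eq; rewrite /GRing.scale/=; field.
  have h2 : is_derive u 1 (fun u : R => expR (s ^+ 2 * u ^+ 2 / 2)) (s ^+ 2 * u * expR (s ^+ 2 * u ^+ 2 / 2)).
    by apply: is_derive_eq; rewrite mulrC.
  have := is_deriveM (is_derive_phi' theta u) h2 => /is_derive_eq; apply.
  by rewrite /GRing.scale/=; ring.
have := is_derive_0_is_cst t 0 H.
rewrite phi0 expr0n/= mulr0 mul0r expR0 mulr1 => <-.
by rewrite -mulrA -expRD subrr expR0 mulr1.
Qed.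

End GaussianCharacteristic.

(** * Trigonometric approximation and convergence in law *)

Section TrigPolynomial.
Variables (R : realType) (m : nat).
Implicit Types (f g : 'rV[R]_m -> R) (x : 'rV[R]_m).

Definition trig_phase (t : 'I_m -> R) x : R := \sum_j t j * x ord0 j.

(** Each triple consists of a coefficient, a frequency vector and a phase. The free phase covers
    sines, and the product-to-sum formula makes the class closed under products. *)
Definition trig_poly g := exists s : seq (R * ('I_m -> R) * R),
  forall x, g x = \sum_(p <- s) p.1.1 * cos (trig_phase p.1.2 x + p.2).

Lemma trig_poly_ext f g : f =1 g -> trig_poly f -> trig_poly g.
Proof. by move=> fg [s hs]; exists s => x; rewrite -fg. Qed.

Lemma trig_poly_cos t theta : trig_poly (fun x => cos (trig_phase t x + theta)).
Proof. by exists [:: (1, t, theta)] => x; rewrite big_seq1 mul1r. Qed.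

Lemma trig_polyZ c f : trig_poly f -> trig_poly (fun x => c * f x).
Proof.
move=> [s hs]; exists [seq (c * p.1.1, p.1.2, p.2) | p <- s] => x.
by rewrite hs big_map mulr_sumr; apply: eq_bigr => p _; rewrite mulrA.
Qed.

Lemma trig_polyD f g : trig_poly f -> trig_poly g -> trig_poly (fun x => f x + g x).
Proof. by move=> [s hs] [u hu]; exists (s ++ u) => x; rewrite big_cat hs hu. Qed.

Lemma trig_poly_cst c : trig_poly (fun=> c).
Proof.
apply: trig_poly_ext (trig_polyZ c (trig_poly_cos (fun=> 0) 0)) => x.
by rewrite /trig_phase big1 ?addr0 ?cos0 ?mulr1// => j _; rewrite mul0r.
Qed.

Lemma trig_poly_sum (I : Type) (s : seq I) (P : pred I) (F : I -> 'rV[R]_m -> R) :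
  (forall i, trig_poly (F i)) -> trig_poly (fun x => \sum_(i <- s | P i) F i x).
Proof.
move=> h; elim: s => [|i s IHs].
  by apply: trig_poly_ext (trig_poly_cst 0) => x; rewrite big_nil.
case Pi : (P i); last by apply: trig_poly_ext IHs => x; rewrite big_cons Pi.
by apply: trig_poly_ext (trig_polyD (h i) IHs) => x; rewrite big_cons Pi.
Qed.

Lemma trig_polyM f g : trig_poly f -> trig_poly g -> trig_poly (fun x => f x * g x).
Proof.
move=> [s hs] [u hu].
pose h (p q : R * ('I_m -> R) * R) x := (p.1.1 * q.1.1 / 2) *
  (cos (trig_phase (fun j => p.1.2 j + q.1.2 j) x + (p.2 + q.2)) +
   cos (trig_phase (fun j => p.1.2 j - q.1.2 j) x + (p.2 - q.2))).
apply: (@trig_poly_ext (fun x => \sum_(p <- s) \sum_(q <- u) h p q x)); last first.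
  apply: trig_poly_sum => p; apply: trig_poly_sum => q; apply: trig_polyZ.
  by apply: trig_polyD; exact: trig_poly_cos.
move=> x; rewrite hs hu mulr_suml; apply: eq_bigr => p _.
rewrite mulr_sumr; apply: eq_bigr => q _; rewrite /h.
set a := trig_phase p.1.2 x; set b := trig_phase q.1.2 x.
have -> : trig_phase (fun j => p.1.2 j + q.1.2 j) x + (p.2 + q.2) = (a + p.2) + (b + q.2).
  rewrite /trig_phase; under eq_bigr do rewrite mulrDl.
  by rewrite big_split/= -/(trig_phase _ _) addrACA.
have -> : trig_phase (fun j => p.1.2 j - q.1.2 j) x + (p.2 - q.2) = (a + p.2) - (b + q.2).
  rewrite /trig_phase; under eq_bigr do rewrite mulrBl.
  by rewrite sumrB/= -/(trig_phase _ _) opprD addrACA.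
by rewrite cosD cosB; field.
Qed.

Lemma trig_poly_prod (I : Type) (s : seq I) (P : pred I) (F : I -> 'rV[R]_m -> R) :
  (forall i, trig_poly (F i)) -> trig_poly (fun x => \prod_(i <- s | P i) F i x).
Proof.
move=> h; elim: s => [|i s IHs].
  by apply: trig_poly_ext (trig_poly_cst 1) => x; rewrite big_nil.
case Pi : (P i); last by apply: trig_poly_ext IHs => x; rewrite big_cons Pi.
by apply: trig_poly_ext (trig_polyM (h i) IHs) => x; rewrite big_cons Pi.
Qed.

Lemma trig_poly_sin (j : 'I_m) (a : R) : trig_poly (fun x => sin (a * x ord0 j)).
Proof.
apply: trig_poly_ext (trig_poly_cos (fun k => (k == j)%:R * a) (- (pi / 2))) => x.
rewrite /trig_phase (bigD1 j)//= eqxx mul1r big1 ?addr0 ?cosBpihalf// => k /negbTE ->.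
by rewrite !mul0r.
Qed.

Section Bernstein.
Variables (n : nat) (F : 'rV[R]_m -> R) (M : R).
Hypothesis n0 : (0 < n)%N.
Hypothesis FM : forall u, `|F u| <= M.

Definition coin_weight (u : 'rV[R]_m) (i : 'I_m * 'I_n) (b : bool) : R :=
  if b then u ord0 i.1 else 1 - u ord0 i.1.

Definition coin_mean (f : {ffun 'I_m * 'I_n -> bool}) : 'rV[R]_m :=
  \row_j ((\sum_(l < n) (f (j, l))%:R) / n%:R).

(** Multivariate Bernstein polynomial of [F], written as the mean of [F] at the empirical
    frequencies of independent coins with biases [u]; the formula is polynomial in [u]. *)
Definition bernstein u : R := pexp (coin_weight u) (F \o coin_mean).

Variable u : 'rV[R]_m.
Hypothesis u01 : forall j, 0 <= u ord0 j <= 1.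

Let w0 i b : 0 <= coin_weight u i b.
Proof. by rewrite /coin_weight; have := u01 i.1; case: b; rewrite ?subr_ge0 => /andP[]. Qed.

Let w1 i : \sum_b coin_weight u i b = 1.
Proof. by rewrite big_bool /coin_weight/=; ring. Qed.

Lemma bernstein_le : `|bernstein u| <= M.
Proof.
rewrite -[leRHS](pexp_cst w1); apply: (le_trans (ler_norm_pexp w0 _)).
by apply: ler_pexp => // f; exact: FM.
Qed.

Lemma coin_variance j :
  pexp (coin_weight u) (fun f : {ffun 'I_m * 'I_n -> bool} => (coin_mean f ord0 j - u ord0 j) ^+ 2) <= n%:R^-1.
Proof.
have nn0 : n%:R != 0 :> R by rewrite pnatr_eq0 -lt0n.
pose phi (l : 'I_n) (b : bool) : R := (b%:R - u ord0 j) / n%:R.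
have -> : pexp (coin_weight u) (fun f : {ffun 'I_m * 'I_n -> bool} => (coin_mean f ord0 j - u ord0 j) ^+ 2) =
  pexp (coin_weight u) (fun f : {ffun 'I_m * 'I_n -> bool} => (\sum_l phi l (f (j, l))) ^+ 2).
  apply: eq_pexp => f; congr (_ ^+ 2); rewrite mxE /phi -mulr_suml sumrB.
  by rewrite sumr_const card_ord mulrBl -[u ord0 j *+ n]mulr_natr mulfK.
rewrite (pexp_var_sum w1 (e := fun l => (j, l))); last 2 first.
- by move=> l l' [].
- by move=> l; rewrite big_bool /phi /coin_weight/=; ring.
have u01j := u01 j.
apply: (@le_trans _ _ (\sum_(l < n) n%:R^-1 ^+ 2)); last first.
  by rewrite sumr_const card_ord expr2 -mulrnAl -[X in X * _]mulr_natr mulVf ?mul1r.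
apply: ler_sum => l _; rewrite big_bool /phi /coin_weight/=.
move: (u ord0 j) u01j => z /andP[z0 z1].
have -> : z * ((1 - z) / n%:R) ^+ 2 + (1 - z) * ((0 - z) / n%:R) ^+ 2 = z * (1 - z) * n%:R^-1 ^+ 2.
  by ring.
rewrite ler_piMl ?sqr_ge0//; have : 0 <= 1 - z by rewrite subr_ge0.
by nra.
Qed.

(** Bernstein's argument: inside the box of radius [d] the oscillation is at most [e]; outside, the
    indicator is dominated by the sum of the squared deviations over [d ^ 2], whose mean is at most
    [m / (n d ^ 2)]. *)
Lemma bernstein_approx (d e : R) : 0 < d ->
  (forall v : 'rV[R]_m, (forall j, `|v ord0 j - u ord0 j| <= d) -> `|F v - F u| <= e) ->
  `|bernstein u - F u| <= e + 2 * M * m%:R / (n%:R * d ^+ 2).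
Proof.
move=> d0 Fu; have M0 : 0 <= M by apply: le_trans (FM u).
have e0 : 0 <= e by apply: le_trans (normr_ge0 _) (Fu u _) => j; rewrite subrr normr0 ltW.
have pw (v : 'rV[R]_m) : `|F v - F u| <= e + 2 * M * \sum_j ((v ord0 j - u ord0 j) ^+ 2 / d ^+ 2).
  have s0 j : 0 <= (v ord0 j - u ord0 j) ^+ 2 / d ^+ 2 by rewrite divr_ge0 ?sqr_ge0.
  have [/forallP h|] := boolP [forall j, `|v ord0 j - u ord0 j| <= d].
    by rewrite (le_trans (Fu v _))// lerDl mulr_ge0 ?mulr_ge0// sumr_ge0.
  rewrite negb_forall => /existsP[j]; rewrite -ltNge => hj.
  apply: (@le_trans _ _ (2 * M)).
    by rewrite (le_trans (ler_normB _ _))// mulr_natl mulr2n lerD.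
  rewrite -[leLHS]add0r lerD// ler_peMr ?mulr_ge0// (bigD1 j)//=.
  rewrite -[leLHS]addr0 lerD ?sumr_ge0// ler_pdivlMr ?exprn_gt0// mul1r.
  by rewrite -[leRHS]real_normK ?num_real// ler_sqr ?nnegrE ?(ltW d0)// ltW.
rewrite /bernstein -[X in _ - X](pexp_cst w1) -pexpB (le_trans (ler_norm_pexp w0 _))//.
apply: (le_trans (ler_pexp w0 (fun f : {ffun 'I_m * 'I_n -> bool} => pw (coin_mean f)))).
rewrite pexpD pexp_cst// lerD// pexpZ -mulrA ler_wpM2l ?mulr_ge0//.
rewrite pexp_sum; apply: (@le_trans _ _ (\sum_(j < m) (n%:R^-1 / d ^+ 2))).
  apply: ler_sum => j _; rewrite pexpZr ler_wpM2r ?invr_ge0 ?sqr_ge0//.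
  exact: coin_variance.
by rewrite sumr_const card_ord -[leLHS]mulr_natl -invfM.
Qed.

End Bernstein.

End TrigPolynomial.

(** * Approximation of continuous functions on boxes *)

Section TrigApproximation.
Variables (R : realType) (m : nat).

(** Only [u] is confined to the cube; [v] is arbitrary, which the covering argument over the compact
    cube permits since [F] is continuous everywhere. *)
Lemma uniform_continuous_box (F : 'rV[R]_m -> R) (e : R) : continuous F -> 0 < e ->
  exists2 d : R, 0 < d & forall u : 'rV[R]_m, (forall j, 0 <= u ord0 j <= 1) ->
    forall v : 'rV[R]_m, (forall j, `|v ord0 j - u ord0 j| <= d) -> `|F v - F u| <= e.
Proof.
move=> cF e0.
have cK : compact [set v : 'rV[R]_m | forall j, `[0, 1]%classic (v ord0 j)].
  have := @rV_compact R m (fun=> `[(0:R), 1]%classic); apply => j; exact: segment_compact.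
pose P (d : R) (u : 'rV[R]_m) := forall v : 'rV[R]_m,
  (forall j, `|v ord0 j - u ord0 j| <= d) -> `|F v - F u| <= e.
have e20 : 0 < e / 2 by rewrite divr_gt0.
have : \forall d \near (0:R)^'+, [set v : 'rV[R]_m | forall j, `[0, 1]%classic (v ord0 j)] `<=` P d.
  apply: (compact_near_coveringP _).1 cK _ _ _ _ _ => u _.
  have /cvgrPdist_le/(_ _ e20)/nbhs_ballP[r/= r0 hr] := cF u.
  have r20 : 0 < r / 2 by rewrite divr_gt0.
  exists (ball u (r / 2), [set d | 0 < d < r / 2]).
    split => /=; first exact: nbhsx_ballx.
    near=> d; apply/andP; split; first by near: d; exact: nbhs_right_gt.
    by near: d; exact: nbhs_right_lt.
  move=> [u' d] /= [uu' /andP[d0 dr]] v hv.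
  have [_ uu'j] := uu'.
  have hu' : `|F u - F u'| <= e / 2.
    apply: hr; split => // i j; apply: le_ball (uu'j i j); lra.
  have hv' : `|F u - F v| <= e / 2.
    apply: hr; split => // i j; have := uu'j i j; have := hv j; rewrite !ord1 => h1 h2.
    rewrite -ball_normE/= in h2 *; have := ler_normD (u ord0 j - u' ord0 j) (u' ord0 j - v ord0 j).
    rewrite addrA subrK [`|u' _ _ - _|]distrC; lra.
  have := ler_normD (F v - F u) (F u - F u'); rewrite addrA subrK distrC [`|F v - F u|]distrC; lra.
move=> hnear; have [d [d0 hd]] : exists d : R, 0 < d /\ [set v : 'rV[R]_m | forall j, `[0, 1]%classic (v ord0 j)] `<=` P d.
  near (0:R)^'+ => d; exists d; split; first by near: d; exact: nbhs_right_gt.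
  by near: d.
exists d => // u hu; apply: hd => j /=; rewrite in_itv/=; exact: hu.
Unshelve. all: by end_near. Qed.

Definition clamp (c y : R) : R := Num.max (- c) (Num.min c y).

Lemma clamp_id c y : `|y| <= c -> clamp c y = y.
Proof. by rewrite ler_norml /clamp => /andP[h1 h2]; rewrite (min_idPr h2) (max_idPr h1). Qed.

Lemma clamp_le c y : 0 <= c -> `|clamp c y| <= c.
Proof.
move=> c0; rewrite ler_norml /clamp le_max lexx/= ge_max ge_min lexx/= andbT.
by rewrite (le_trans _ c0)// oppr_le0.
Qed.

Lemma sin1_01 : 0 < sin (1 : R) < 1.
Proof.
have pi1 : 1 <= pi / 2 :> R := pihalf_ge1 R.
have s0 : 0 < sin 1 :> R by apply: sin2_gt0; rewrite ltr01 ltr1n.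
rewrite s0/=; have := cos2Dsin2 (1 : R); have := @cos1_gt0 R => c0 E.
have : 0 < cos 1 ^+ 2 :> R by rewrite exprn_gt0.
move: E s0; move: (sin 1) (cos 1) => s c E s0; nra.
Qed.

(** For [L > 0], a continuous left inverse on [|x| <= L] of the map sending [x] to
    [(1 + sin (x / L)) / 2]. Clamping at [sin 1 < 1] keeps the argument of [asin] inside []-1, 1[]
    for every real [u]. *)
Definition arcsine (L u : R) : R := L * asin (clamp (sin 1) (2 * u - 1)).

Lemma continuous_arcsine L : continuous (arcsine L).
Proof.
move=> u; apply: cvgMr.
have h1 : {for u, continuous (fun u : R => clamp (sin 1) (2 * u - 1))}.
  apply: continuous_max; first exact: cst_continuous.
  apply: continuous_min; first exact: cst_continuous.
  by apply: cvgB; [apply: cvgMr|apply: cvg_cst].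
have h2 : {for clamp (sin 1) (2 * u - 1), continuous (@asin R)}.
  apply: continuous_asin; rewrite -ltr_norml.
  by have /andP[s0 s1] := sin1_01; rewrite (le_lt_trans (clamp_le _ (ltW s0))).
exact: (continuous_comp h1 h2).
Qed.

Lemma sin_le_sin1 (y : R) : `|y| <= 1 -> `|sin y| <= sin 1.
Proof.
have pi1 : 1 <= pi / 2 :> R := pihalf_ge1 R.
have H (z : R) : `|z| <= 1 -> sin z <= sin 1.
  rewrite ler_norml => /andP[z1 z2]; rewrite leNgt ltr_sin -?leNgt// in_itv/=; apply/andP; split; lra.
move=> y1; rewrite ler_norml H// andbT lerNl -sinN H// normrN//.
Qed.

Lemma arcsineK (L x : R) : 0 < L -> `|x| <= L -> arcsine L ((1 + sin (x / L)) / 2) = x.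
Proof.
move=> L0 xL; have xL1 : `|x / L| <= 1.
  by rewrite normrM normfV (gtr0_norm L0) ler_pdivrMr// mul1r.
rewrite /arcsine (_ : 2 * _ - 1 = sin (x / L)); last by field.
rewrite clamp_id ?sin_le_sin1// sinK; first by rewrite mulrC divfK// gt_eqF.
have pi1 : 1 <= pi / 2 :> R := pihalf_ge1 R.
move: xL1; rewrite in_itv/= ler_norml => /andP[]; lra.
Qed.

Lemma continuous_row (A : R -> R) : continuous A ->
  continuous (fun u : 'rV[R]_m => (\row_j A (u ord0 j)) : 'rV[R]_m).
Proof.
move=> cA u B /nbhs_ballP[e/= e0 eB].
have h j : nbhs u [set v : 'rV[R]_m | ball (A (u ord0 j)) e (A (v ord0 j))].
  have : {for u, continuous (fun v : 'rV[R]_m => A (v ord0 j))}.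
    have h1 := @coord_continuous R 1 m ord0 j u.
    exact: (continuous_comp h1 (cA _)).
  by move=> /(_ (ball (A (u ord0 j)) e)); apply; exact: nbhsx_ballx.
have : nbhs u [set v : 'rV[R]_m | forall j, ball (A (u ord0 j)) e (A (v ord0 j))].
  exact: (@filter_forall _ _ _ _ (@nbhs_filter 'rV[R]_m u) h).
by apply: filterS => v hv; apply: eB; split => // i j; rewrite !mxE; exact: hv.
Qed.

(** The change of variables [u = (1 + sin (x / L)) / 2] turns Bernstein polynomials in [u] into
    trigonometric polynomials in [x]. Since [u] stays in [[0, 1]] for every [x], the bound [M] holds
    on the whole space, not only on the box where the approximation is good. *)
Theorem trig_approx (f : 'rV[R]_m -> R) (M K e : R) : continuous f ->
  (forall x, `|f x| <= M) -> 0 <= K -> 0 < e ->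
  exists g, [/\ trig_poly g, forall x, `|g x| <= M &
    forall x : 'rV[R]_m, (forall j, `|x ord0 j| <= K) -> `|g x - f x| <= e].
Proof.
move=> cf fM K0 e0; pose L := K + 1; have L0 : 0 < L by rewrite ltr_wpDl.
pose F (u : 'rV[R]_m) := f (\row_j arcsine L (u ord0 j)).
have cF : continuous F.
  move=> u; apply: (@continuous_comp _ _ _ (fun u : 'rV[R]_m => \row_j arcsine L (u ord0 j)) f).
    by apply: continuous_row; exact: continuous_arcsine.
  exact: cf.
have FM u : `|F u| <= M by exact: fM.
have M0 : 0 <= M by apply: le_trans (fM 0).
pose U (x : 'rV[R]_m) : 'rV[R]_m := \row_j ((1 + sin (x ord0 j / L)) / 2).
have U01 x j : 0 <= U x ord0 j <= 1.
  rewrite mxE; have := sin_geN1 (x ord0 j / L); have := sin_le1 (x ord0 j / L).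
  move: (sin _) => z; lra.
have e20 : 0 < e / 2 by rewrite divr_gt0.
have [d d0 hd] := uniform_continuous_box cF e20.
(* [n] makes the Chebyshev term [2 M m / (n d ^ 2)] at most [e / 2]. *)
pose n := (Num.truncn (2 * M * m%:R / d ^+ 2 / (e / 2))).+1.
exists (fun x => bernstein n F (U x)); split.
- rewrite /bernstein /pexp; apply: trig_poly_sum => c; apply: trig_polyM; last exact: trig_poly_cst.
  apply: trig_poly_prod => -[j l].
  have tU : trig_poly (fun x => U x ord0 j).
    apply: (@trig_poly_ext _ _ (fun x => 2^-1 * (1 + sin (L^-1 * x ord0 j)))).
      by move=> x; rewrite mxE mulrC [_^-1 * x _ _]mulrC.
    by apply/trig_polyZ/trig_polyD; [exact: trig_poly_cst|exact: trig_poly_sin].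
  rewrite /coin_weight; case: (c (j, l)) => //=.
  apply: (@trig_poly_ext _ _ (fun x => 1 + (-1) * U x ord0 j)).
    by move=> x; rewrite mulN1r.
  by apply: trig_polyD; [exact: trig_poly_cst|exact: trig_polyZ].
- by move=> x; apply: bernstein_le.
- move=> x xK; have fE : f x = F (U x).
    congr f; apply/rowP => j; rewrite !mxE arcsineK// (le_trans (xK j))//.
    by rewrite lerDl.
  have n0 : (0 < n)%N by [].
  rewrite fE (le_trans (bernstein_approx n0 FM (U01 x) d0 (hd _ (U01 x))))//.
  have h0 : 0 <= 2 * M * m%:R / d ^+ 2 / (e / 2).
    by rewrite !divr_ge0 ?mulr_ge0 ?exprn_ge0 ?(ltW d0) ?(ltW e0).
  have /andP[_ /ltW] := truncn_itv h0; rewrite -/n.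
  rewrite ler_pdivrMr// ler_pdivrMr ?exprn_gt0// => h.
  rewrite [leRHS]splitr lerD2l ler_pdivrMr ?mulr_gt0 ?exprn_gt0 ?ltr0n//.
  by rewrite mulrCA mulrA.
Qed.

End TrigApproximation.

(** Boxes grow while the error shrinks, so the sequence converges pointwise everywhere under a
    common bound, as dominated convergence requires. *)
Lemma trig_approx_seq (R : realType) (m : nat) (f : 'rV[R]_m -> R) (M : R) :
  continuous f -> (forall x, `|f x| <= M) ->
  exists g : nat -> 'rV[R]_m -> R, [/\ forall k, trig_poly (g k),
    forall k x, `|g k x| <= M &
    forall k (x : 'rV[R]_m), (forall j, `|x ord0 j| <= k%:R) -> `|g k x - f x| <= k.+1%:R^-1].
Proof.
move=> cf fM; have h k : exists g : 'rV[R]_m -> R, [/\ trig_poly g, forall x, `|g x| <= M &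
    forall x : 'rV[R]_m, (forall j, `|x ord0 j| <= k%:R) -> `|g x - f x| <= k.+1%:R^-1].
  by apply: trig_approx => //; rewrite ?ler0n// invr_gt0 ltr0n.
exists (fun k => projT1 (cid (h k))).
by split => k *; case: (cid (h k)) => g [] /=; auto.
Qed.

(** * Expectations of bounded functions of random vectors *)

Section BoundedExpectation.
Context d (T : measurableType d) (R : realType) (Q : probability T R).

Lemma integrable_bounded (h : T -> R) (M : R) : measurable_fun setT h ->
  (forall w, `|h w| <= M) -> Q.-integrable setT (EFin \o h).
Proof.
move=> mh hM; apply: measurable_bounded_integrable => //.
  by rewrite (le_lt_trans (probability_le1 Q measurableT))// ltry.
by exists M; split; [exact: num_real|move=> x Mx w _; rewrite /= (le_trans (hM w))// ltW].
Qed.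

(** Measurability of the limit belongs to the conclusion: a continuous function of a random vector
    is reached here as a pointwise limit of trigonometric polynomials. *)
Lemma cvg_Rintegral_bounded (h_ : nat -> T -> R) (h : T -> R) (M : R) :
  (forall k, measurable_fun setT (h_ k)) -> (forall k w, `|h_ k w| <= M) ->
  (forall w, (fun k => h_ k w) @ \oo --> h w) ->
  measurable_fun setT h /\
  (fun k => (\int[Q]_w h_ k w)%R) @ \oo --> (\int[Q]_w h w)%R.
Proof.
move=> mh_ hM hh; have mh : measurable_fun setT h.
  by apply: (measurable_fun_cvg mh_) => x _; exact: hh.
split => //.
have hM' w : `|h w| <= M.
  by apply: (cvgr_to_le (cvg_norm (hh w))); exact: nearW.
have h1 k : measurable_fun setT (EFin \o h_ k) by exact/measurable_EFinP.
have h2 : measurable_fun setT (EFin \o h) by exact/measurable_EFinP.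
have h3 : {ae Q, forall w, setT w -> (fun k => (h_ k w)%:E) @ \oo --> (h w)%:E}.
  by apply: aeW => w _; apply: cvg_EFin; [exact: nearW|exact: hh].
have h4 : Q.-integrable setT (cst M%:E).
  by apply: (@integrable_bounded (cst M) `|M|).
have h5 : {ae Q, forall w k, setT w -> (`|(h_ k w)%:E| <= cst M%:E w)%E}.
  by apply: aeW => w k _; rewrite lee_fin.
have [_ _ H] := dominated_convergence (mu := Q) measurableT h1 h2 h3 h4 h5.
rewrite /Rintegral; apply: fine_cvg; rewrite fineK//.
apply: integrable_fin_num => //; exact: integrable_bounded hM'.
Qed.

Lemma Rintegral_bounded_sum (I : Type) (s : seq I) (h : I -> T -> R) (M : I -> R) :
  (forall i, measurable_fun setT (h i)) -> (forall i w, `|h i w| <= M i) ->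
  (\int[Q]_w (\sum_(i <- s) h i w))%R = \sum_(i <- s) (\int[Q]_w h i w)%R.
Proof.
move=> mh hM; elim: s => [|i s IHs].
  rewrite big_nil; under eq_Rintegral do rewrite big_nil.
  by rewrite Rintegral_cst// mul0r.
rewrite big_cons -IHs; under eq_Rintegral do rewrite big_cons.
rewrite RintegralD//; first exact: integrable_bounded (hM i).
apply: (@integrable_bounded _ (\sum_(i <- s) M i)).
  by apply: measurable_sum => j; exact: mh.
by move=> w; rewrite (le_trans (ler_norm_sum _ _ _))// ler_sum.
Qed.

End BoundedExpectation.

Section RandomVector.
Context d (T : measurableType d) (R : realType) (Q : probability T R) (m : nat).
Variable G : 'I_m -> {RV Q >-> R}.

Local Notation row w := (\row_i G i w).

Lemma measurable_phase (t : 'I_m -> R) : measurable_fun setT (fun w => trig_phase t (row w)).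
Proof.
rewrite /trig_phase; under eq_fun do under eq_bigr do rewrite mxE.
by apply: measurable_sum => j; apply: measurable_funM.
Qed.

Lemma measurable_cos_phase (t : 'I_m -> R) (theta : R) :
  measurable_fun setT (fun w => cos (trig_phase t (row w) + theta)).
Proof.
apply: measurableT_comp; first exact: continuous_measurable_fun (@continuous_cos R).
by apply: measurable_funD => //; exact: measurable_phase.
Qed.

Lemma measurable_trig g : trig_poly g -> measurable_fun setT (fun w => g (row w)).
Proof.
move=> [s hs]; under eq_fun do rewrite hs.
apply: measurable_sum => p; apply: measurable_funM => //; exact: measurable_cos_phase.
Qed.

Lemma Rintegral_trig (s : seq (R * ('I_m -> R) * R)) :
  (\int[Q]_w (\sum_(p <- s) p.1.1 * cos (trig_phase p.1.2 (row w) + p.2)))%R =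
  \sum_(p <- s) p.1.1 * (\int[Q]_w cos (trig_phase p.1.2 (row w) + p.2))%R.
Proof.
rewrite (@Rintegral_bounded_sum _ _ _ Q _ s _ (fun p => `|p.1.1|)).
- apply: eq_bigr => p _; rewrite RintegralZl//.
  apply: (@integrable_bounded _ _ _ Q _ 1); first exact: measurable_cos_phase.
  by move=> w; exact: cos_max.
- by move=> p; apply: measurable_funM => //; exact: measurable_cos_phase.
- by move=> p w; rewrite normrM ler_piMr// cos_max.
Qed.

Lemma cvg_Rintegral_approx (f : 'rV[R]_m -> R) (M : R) (g : nat -> 'rV[R]_m -> R) :
  (forall k, trig_poly (g k)) -> (forall k x, `|g k x| <= M) ->
  (forall k (x : 'rV[R]_m), (forall j, `|x ord0 j| <= k%:R) -> `|g k x - f x| <= k.+1%:R^-1) ->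
  measurable_fun setT (fun w => f (row w)) /\
  (fun k => (\int[Q]_w g k (row w))%R) @ \oo --> (\int[Q]_w f (row w))%R.
Proof.
move=> tg gM gf.
apply: (@cvg_Rintegral_bounded _ _ _ Q (fun k w => g k (row w)) (fun w => f (row w)) M) => //.
  by move=> k; exact: measurable_trig.
move=> w; apply/cvgrPdist_le => e e0; near=> k.
rewrite distrC (le_trans (gf k _ _))//.
  near: k; apply: filter_forall => j.
  exists (Num.truncn `|row w ord0 j|).+1 => // k /= hk.
  have /andP[_ /ltW/le_trans] := truncn_itv (normr_ge0 (row w ord0 j)); apply.
  by rewrite ler_nat.
near: k; exists (Num.truncn e^-1).+1 => // k /= hk.
have e'0 : 0 <= e^-1 by rewrite invr_ge0 ltW.
have /andP[_ /ltW ek] := truncn_itv e'0.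
rewrite -[leRHS]invrK lef_pV2 ?posrE ?invr_gt0// (le_trans ek)// ler_nat.
by rewrite (leq_trans hk).
Unshelve. all: by end_near. Qed.

End RandomVector.

Section NormalIntegral.
Variables (R : realType) (s : R).
Hypothesis s0 : 0 < s.

(** The Radon-Nikodym derivative of the normal law is almost everywhere the density, since both have
    the same integrals over measurable sets. *)
Lemma integral_normal_prob (f : R -> R) (B : R) : measurable_fun [set: R] f ->
  (forall x, `|f x| <= B) ->
  (\int[normal_prob 0 s]_x f x)%R = (\int[lebesgue_measure]_x (f x * normal_pdf 0 s x))%R.
Proof.
move=> mf fB; rewrite /Rintegral; congr fine.
have dom := normal_prob_dominates 0 s.
have intf : (normal_prob 0 s).-integrable setT (EFin \o f) by exact: (@integrable_bounded _ _ _ (normal_prob 0 s) f B).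
rewrite -(Radon_Nikodym_change_of_variables dom)//.
have mE : measurable_fun [set: R] (EFin \o f) by exact/measurable_EFinP.
under [RHS]eq_integral do rewrite EFinM.
apply: ae_eq_integral => //.
- by apply: emeasurable_funM => //; apply: (measurable_int lebesgue_measure).
- by apply: emeasurable_funM => //; apply/measurable_EFinP; exact: measurable_normal_pdf.
- apply: ae_eqe_mul2l => /=.
  rewrite Radon_NikodymE//=.
  case: cid => /= h [h1 h2 h3].
  apply: integral_ae_eq => //=.
  + by apply/measurable_EFinP; exact: measurable_normal_pdf.
  + by move=> E E01 mE'; rewrite -h3.
Qed.

Lemma normal_prob_cos (t theta : R) :
  (\int[normal_prob 0 s]_x cos (t * x + theta))%R =
  cos theta * expR (- (s ^+ 2 * t ^+ 2 / 2)).
Proof.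
rewrite (@integral_normal_prob _ 1).
- exact: normal_pdf_cos.
- apply: measurableT_comp; first exact: continuous_measurable_fun (@continuous_cos R).
  by apply: measurable_funD => //; exact: measurable_funM.
- by move=> x; exact: cos_max.
Qed.

End NormalIntegral.

(** * From characteristic functions and tightness to convergence in law *)

Section WeakConvergence.
Variables (R : realType) (m : nat).
Variables (T_ : nat -> finType) (mu : forall n, T_ n -> R) (X : forall n, T_ n -> 'rV[R]_m).
Hypothesis mu0 : forall n s, 0 <= @mu n s.
Hypothesis mu1 : forall n, \sum_s @mu n s = 1.
Context d (T : measurableType d) (Q : probability T R).
Variable G : 'I_m -> {RV Q >-> R}.
Hypothesis cvg_cos : forall (t : 'I_m -> R) (theta : R),
  (fun n => \sum_s @mu n s * cos (trig_phase t (@X n s) + theta)) @ \oo -->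
  (\int[Q]_w cos (trig_phase t (\row_i G i w) + theta))%R.
Hypothesis tight : forall e : R, 0 < e -> exists K : R, \forall n \near \oo,
  \sum_s @mu n s * (~~ [forall j, `|@X n s ord0 j| <= K])%:R <= e.

Lemma cvg_trig g : trig_poly g ->
  (fun n => \sum_s @mu n s * g (@X n s)) @ \oo --> (\int[Q]_w g (\row_i G i w))%R.
Proof.
move=> [s hs].
have -> : (\int[Q]_w g (\row_i G i w))%R =
    \sum_(p <- s) p.1.1 * (\int[Q]_w cos (trig_phase p.1.2 (\row_i G i w) + p.2))%R.
  by rewrite -Rintegral_trig; apply: eq_Rintegral => w _; rewrite hs.
have -> : (fun n => \sum_s @mu n s * g (@X n s)) =
    (fun n => \sum_(p <- s) p.1.1 * \sum_s @mu n s * cos (trig_phase p.1.2 (@X n s) + p.2)).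
  apply/funext => n; under eq_bigr do rewrite hs mulr_sumr.
  rewrite exchange_big; apply: eq_bigr => p _ /=; rewrite mulr_sumr.
  by apply: eq_bigr => x _; rewrite mulrCA.
by apply: cvg_sumr => p _; apply: cvgMr; exact: cvg_cos.
Qed.

(** Both means of [f] are compared with those of a single trigonometric polynomial [g k]. Outside
    the box only the common bound [M] is available: there tightness controls the discrete laws,
    while dominated convergence handles the limit law. *)
Theorem cvg_bounded_continuous (f : 'rV[R]_m -> R) (M : R) : continuous f ->
  (forall x, `|f x| <= M) ->
  (fun n => \sum_s @mu n s * f (@X n s)) @ \oo --> (\int[Q]_w f (\row_i G i w))%R.
Proof.
move=> cf fM; have [g [tg gM gf]] := trig_approx_seq cf fM.
have [_ cvgf] := cvg_Rintegral_approx (Q := Q) G tg gM gf.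
have M0 : 0 <= M by apply: le_trans (fM 0).
apply/cvgrPdist_le => e e0.
have M1 : 0 < 2 * M + 1 by rewrite ltr_wpDl ?mulr_ge0.
have e4 : 0 < e / 4 by rewrite divr_gt0.
(* Outside the box [|g k - f| <= 2 M]; the extra 1 keeps the divisor positive when [M = 0]. *)
have eM : 0 < e / 4 / (2 * M + 1) by rewrite divr_gt0.
have [K hK] := tight eM.
have [k [kK ke kf]] : exists k : nat, [/\ K <= k%:R, k.+1%:R^-1 <= e / 4 &
    `|(\int[Q]_w f (\row_i G i w))%R - (\int[Q]_w g k (\row_i G i w))%R| <= e / 4].
  near \oo => k; exists k; split.
  - near: k; exists (Num.truncn `|K|).+1 => // k /= hk.
    have /andP[_ /ltW h] := truncn_itv (normr_ge0 K).
    by rewrite (le_trans (ler_norm K))// (le_trans h)// ler_nat.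
  - near: k; have := cvg_harmonic0 (1 : R) => /cvgrPdist_le/(_ _ e4) [N _ hN].
    exists N => // k /= Nk; have := hN k.+1 (leqW Nk).
    by rewrite sub0r normrN mul1r ger0_norm.
  - by near: k; move/cvgrPdist_le : cvgf => /(_ _ e4).
near=> n.
have hn : `|(\int[Q]_w g k (\row_i G i w))%R - \sum_s @mu n s * g k (@X n s)| <= e / 4.
  by near: n; have /cvgrPdist_le/(_ _ e4) := cvg_trig (tg k).
have htail : \sum_s @mu n s * (~~ [forall j, `|@X n s ord0 j| <= K])%:R <= e / 4 / (2 * M + 1).
  by near: n.
have hfg : `|\sum_s @mu n s * g k (@X n s) - \sum_s @mu n s * f (@X n s)| <= e / 4 + e / 4.
  rewrite -sumrB (le_trans (ler_norm_sum _ _ _))//.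
  apply: (@le_trans _ _ (\sum_s (@mu n s * (e / 4) +
      (2 * M + 1) * (@mu n s * (~~ [forall j, `|@X n s ord0 j| <= K])%:R)))).
    apply: ler_sum => x _; rewrite -mulrBr normrM ger0_norm//.
    rewrite [(2 * M + 1) * _]mulrCA -mulrDr ler_wpM2l//.
    case: (boolP [forall j, _]) => [/forallP hx|_] /=.
      rewrite mulr0 addr0 (le_trans _ ke)// gf// => j.
      by rewrite (le_trans (hx j)).
    rewrite mulr1 (le_trans (ler_normB _ _))//.
    have := gM k (@X n x); have := fM (@X n x); have := ltW e4; lra.
  rewrite big_split -mulr_suml mu1 mul1r -mulr_sumr lerD2l mulrC -ler_pdivlMr//.
have := ler_normD ((\int[Q]_w f (\row_i G i w))%R - (\int[Q]_w g k (\row_i G i w))%R)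
  ((\int[Q]_w g k (\row_i G i w))%R - \sum_s @mu n s * g k (@X n s)).
have := ler_normD ((\int[Q]_w f (\row_i G i w))%R - \sum_s @mu n s * g k (@X n s))
  (\sum_s @mu n s * g k (@X n s) - \sum_s @mu n s * f (@X n s)).
rewrite !addrA !subrK; lra.
Unshelve. all: by end_near. Qed.

End WeakConvergence.

Definition mkRV d (T : measurableType d) (R : realType) (X : T -> R)
  (mX : measurable_fun setT X) : {mfun T >-> R} :=
  HB.pack_for {mfun T >-> R} X (isMeasurableFun.Build _ _ _ _ X mX).

(** * Uniqueness of a real law with given characteristic function *)

Section LawUnique.
Variable R : realType.
Context d1 (T1 : measurableType d1) (Q1 : probability T1 R) (X1 : {mfun T1 >-> R}).
Context d2 (T2 : measurableType d2) (Q2 : probability T2 R) (X2 : {mfun T2 >-> R}).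
Hypothesis cosE : forall t theta : R,
  (\int[Q1]_w cos (t * X1 w + theta))%R = (\int[Q2]_w cos (t * X2 w + theta))%R.

Let G1 (_ : 'I_1) : {RV Q1 >-> R} := X1.
Let G2 (_ : 'I_1) : {RV Q2 >-> R} := X2.

Lemma law_unique_bounded_continuous (f : R -> R) (M : R) : continuous f ->
  (forall x, `|f x| <= M) ->
  (\int[Q1]_w f (X1 w))%R = (\int[Q2]_w f (X2 w))%R.
Proof.
move=> cf fM; pose h (x : 'rV[R]_1) := f (x ord0 ord0).
have ch : continuous h.
  move=> x; have h1 := @coord_continuous R 1 1 ord0 ord0 x.
  exact: (continuous_comp h1 (cf _)).
have hM x : `|h x| <= M by exact: fM.
have [g [tg gM gh]] := trig_approx_seq ch hM.
have [_ lim1] := cvg_Rintegral_approx (Q := Q1) G1 tg gM gh.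
have [_ lim2] := cvg_Rintegral_approx (Q := Q2) G2 tg gM gh.
have E k : (\int[Q1]_w g k (\row_i G1 i w))%R = (\int[Q2]_w g k (\row_i G2 i w))%R.
  have [s hs] := tg k.
  have -> : (\int[Q1]_w g k (\row_i G1 i w))%R =
    (\int[Q1]_w (\sum_(p <- s) p.1.1 * cos (trig_phase p.1.2 (\row_i G1 i w) + p.2)))%R.
    by apply: eq_Rintegral => w _; rewrite hs.
  have -> : (\int[Q2]_w g k (\row_i G2 i w))%R =
    (\int[Q2]_w (\sum_(p <- s) p.1.1 * cos (trig_phase p.1.2 (\row_i G2 i w) + p.2)))%R.
    by apply: eq_Rintegral => w _; rewrite hs.
  rewrite !Rintegral_trig; apply: eq_bigr => p _; congr (_ * _).
  transitivity (\int[Q1]_w cos (p.1.2 ord0 * X1 w + p.2))%R.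
    by apply: eq_Rintegral => w _; rewrite /trig_phase big_ord1 mxE.
  by rewrite cosE; apply: eq_Rintegral => w _; rewrite /trig_phase big_ord1 mxE.
have lim1' : (fun k => (\int[Q2]_w g k (\row_i G2 i w))%R) @ \oo --> (\int[Q1]_w h (\row_i G1 i w))%R.
  by move: lim1; under eq_fun do rewrite E.
transitivity (\int[Q1]_w h (\row_i G1 i w))%R.
  by apply: eq_Rintegral => w _; rewrite /h mxE.
rewrite (cvg_unique (@Rhausdorff R) lim1' lim2).
by apply: eq_Rintegral => w _; rewrite /h mxE.
Qed.

Let ramp (a : R) (k : nat) (x : R) : R := Num.max 0 (Num.min 1 (k%:R * (a - x))).

Let continuous_ramp a k : continuous (ramp a k).
Proof.
move=> x.
have : {for x, continuous (fun x : R => Num.max 0 (Num.min 1 (k%:R * (a - x))))}; last exact.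
apply: continuous_max; first exact: cst_continuous.
apply: continuous_min; first exact: cst_continuous.
by apply: cvgMr; apply: cvgB; [exact: cvg_cst|exact: cvg_id].
Qed.

Let ramp01 a k x : `|ramp a k x| <= 1.
Proof.
rewrite /ramp ger0_norm; last by rewrite le_max lexx.
by rewrite ge_max ler01 ge_min lexx.
Qed.

Let cvg_ramp a x : (fun k => ramp a k x) @ \oo --> (\1_`]-oo, a[%classic x : R).
Proof.
rewrite indicE mem_setE in_itv/=; have [xa|ax] := ltP x a.
  apply: cvg_near_cst; exists (Num.truncn (a - x)^-1).+1 => // k /= hk.
  have ax0 : 0 < a - x by rewrite subr_gt0.
  have ai0 : 0 <= (a - x)^-1 by rewrite invr_ge0 ltW.
  have /andP[_ /ltW h] := truncn_itv ai0.
  have h1 : 1 <= k%:R * (a - x).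
    by rewrite -ler_pdivrMr// mul1r (le_trans h)// ler_nat.
  by rewrite /ramp (min_idPl h1) (max_idPr ler01).
apply: cvg_near_cst; exists 0%N => // k _ /=.
have h : k%:R * (a - x) <= 0 by rewrite mulr_ge0_le0// subr_le0.
by rewrite /ramp (min_idPr (le_trans h ler01)) (max_idPl h).
Qed.

Let ray_prob d (T : measurableType d) (Q : probability T R) (X : {mfun T >-> R}) a :
  (fun k => (\int[Q]_w ramp a k (X w))%R) @ \oo --> fine (Q (X @^-1` `]-oo, a[%classic)).
Proof.
have h1 k : measurable_fun setT (fun w => ramp a k (X w)).
  apply: measurableT_comp => //.
  by apply: continuous_measurable_fun; exact: continuous_ramp.
have h2 k w : `|ramp a k (X w)| <= 1 by exact: ramp01.
have h3 w : (fun k => ramp a k (X w)) @ \oo --> (\1_(X @^-1` `]-oo, a[%classic) w : R).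
  by have := @cvg_ramp a (X w); rewrite !indicE.
have [_] := cvg_Rintegral_bounded Q h1 h2 h3.
have mXa : measurable (X @^-1` `]-oo, a[%classic).
  by rewrite -[_ @^-1` _]setTI; exact: measurable_funP.
by rewrite {2}/Rintegral integral_indic ?setIT.
Qed.

(** Bounded continuous test functions determine the probability of every open ray []-oo, a[],
    through ramps converging to its indicator; these rays generate the Borel sets and are stable
    under intersection. *)
Theorem law_unique (A : set R) : measurable A -> Q1 (X1 @^-1` A) = Q2 (X2 @^-1` A).
Proof.
move=> mA; rewrite -[LHS]/(distribution Q1 X1 A) -[RHS]/(distribution Q2 X2 A).
apply: (measure_unique (@RGenInftyO.G R) (fun k => `]-oo, k%:R[%classic)) => //.
- exact: RGenInftyO.measurableE.
- move=> _ _ [x ->] [y ->]; exists (Num.min x y); apply/seteqP; split => z /=.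
    by rewrite !in_itv/= lt_min => -[-> ->].
  by rewrite !in_itv/= lt_min => /andP[-> ->].
- by move=> k; exists k%:R.
- apply/seteqP; split => // x _; exists (Num.truncn `|x|).+1 => //=; rewrite in_itv/=.
  have /andP[_ h] := truncn_itv (normr_ge0 x).
  exact: le_lt_trans (ler_norm x) h.
- move=> _ [a ->].
  change (Q1 (X1 @^-1` `]-oo, a[%classic) = Q2 (X2 @^-1` `]-oo, a[%classic)).
  have l1 := @ray_prob _ _ Q1 X1 a; have l2 := @ray_prob _ _ Q2 X2 a.
  have m1 : measurable (X1 @^-1` `]-oo, a[%classic).
    by rewrite -[_ @^-1` _]setTI; exact: measurable_funP.
  have m2 : measurable (X2 @^-1` `]-oo, a[%classic).
    by rewrite -[_ @^-1` _]setTI; exact: measurable_funP.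
  rewrite -(fineK (fin_num_measure Q1 _ m1)) -(fineK (fin_num_measure Q2 _ m2)); congr EFin.
  have := l1; under eq_fun do rewrite (law_unique_bounded_continuous (@continuous_ramp a _) (@ramp01 a _)).
  by move=> l1'; exact: (cvg_unique (@Rhausdorff R) l1' l2).
- by move=> k; rewrite (le_lt_trans (probability_le1 _ _)) ?ltry.
Qed.

End LawUnique.

(** * Gaussian vectors *)

Section PositiveSemidefinite.
Variables (R : rcfType) (m : nat).
Implicit Types (S : 'I_m -> 'I_m -> R) (a : 'I_m -> R).

Definition quad_form S a : R := \sum_i \sum_j a i * a j * S i j.

Let sum_delta (f : 'I_m -> R) k : \sum_j (j == k)%:R * f j = f k.
Proof.
by rewrite (bigD1 k)//= eqxx mul1r big1 ?addr0// => j /negbTE ->; rewrite mul0r.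
Qed.

Lemma quad_form_shift S a k x : (forall i j, S i j = S j i) ->
  quad_form S (fun i => a i + x * (i == k)%:R) =
  quad_form S a + 2 * x * (\sum_j a j * S k j) + x ^+ 2 * S k k.
Proof.
move=> sS; pose L i := \sum_j a j * S i j.
have qE b : quad_form S b = \sum_i b i * \sum_j b j * S i j.
  rewrite /quad_form; apply: eq_bigr => i _; rewrite mulr_sumr.
  by apply: eq_bigr => j _; rewrite mulrA.
have lin i : \sum_j (a j + x * (j == k)%:R) * S i j = L i + x * S i k.
  under eq_bigr do rewrite mulrDl -mulrA.
  by rewrite big_split -mulr_sumr sum_delta.
rewrite !qE -/(L _); under eq_bigr do rewrite lin mulrDr mulrDl [(_ + _ * _) * (x * _)]mulrDl.
rewrite !big_split/=.
have -> : \sum_i x * (i == k)%:R * L i = x * L k.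
  by rewrite -[in RHS](sum_delta L k) mulr_sumr; apply: eq_bigr => i _; rewrite mulrA.
have -> : \sum_i x * (i == k)%:R * (x * S i k) = x ^+ 2 * S k k.
  rewrite -(sum_delta (fun i => S i k) k) mulr_sumr; apply: eq_bigr => i _; ring.
have -> : \sum_i a i * (x * S i k) = x * L k.
  by rewrite mulr_sumr; apply: eq_bigr => i _; rewrite sS mulrCA.
rewrite -/(L k); ring.
Qed.

Lemma quad_form_delta S k : quad_form S (fun i => (i == k)%:R) = S k k.
Proof.
rewrite /quad_form (bigD1 k)//= (bigD1 k)//= eqxx !big1 ?addr0 ?mul1r//.
  by move=> i /negbTE ->; rewrite big1// => j _; rewrite !mul0r.
by move=> j /negbTE ->; rewrite mulr0 mul0r.
Qed.

Lemma psd_diag0 S i j : (forall i j, S i j = S j i) -> (forall a, 0 <= quad_form S a) ->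
  S i i = 0 -> S i j = 0.
Proof.
move=> sS S0 Sii; apply/eqP/negPn/negP => Sij.
(* Along this vector the form equals [S j j - (S j j + 1) = -1], contradicting positivity. *)
have := S0 (fun l => (l == j)%:R + (- (S j j + 1) / (2 * S i j)) * (l == i)%:R).
rewrite quad_form_shift// quad_form_delta Sii mulr0 addr0.
have -> : \sum_l (l == j)%:R * S i l = S i j.
  by rewrite (bigD1 j)//= eqxx mul1r big1 ?addr0// => l /negbTE ->; rewrite mul0r.
have -> : 2 * (- (S j j + 1) / (2 * S i j)) * S i j = - (S j j + 1) by field.
lra.
Qed.

(* Gaussian elimination: subtracting the rank-one term of a nonzero pivot [k]
   kills the diagonal entry [k] and keeps the zero diagonal entries. *)
Lemma psd_rank_one_sum S : (forall i j, S i j = S j i) -> (forall a, 0 <= quad_form S a) ->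
  exists s : seq ('I_m -> R), forall i j, S i j = \sum_(c <- s) c i * c j.
Proof.
have [n] := ubnP #|[set i | S i i != 0]%SET|; elim: n S => // n IHn S; rewrite ltnS => Hn sS S0.
have [k|S00] := pickP (fun i => S i i != 0); last first.
  exists [::] => i j; rewrite big_nil; apply: psd_diag0 => //.
  by have /negbT/negPn/eqP := S00 i.
move=> Skk; have Skk0 : 0 < S k k by rewrite lt0r Skk -quad_form_delta S0.
pose c i := S i k / Num.sqrt (S k k).
have cc i j : c i * c j = S i k * S j k / S k k.
  by rewrite /c mulrACA -invfM -expr2 sqr_sqrtr ?ltW.
pose S' i j := S i j - c i * c j.
have S'kk : S' k k = 0 by rewrite /S' cc mulfK ?subrr.
have sS' i j : S' i j = S' j i by rewrite /S' sS [c i * _]mulrC.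
have quadS' a : quad_form S' a = quad_form S a - (\sum_j a j * S k j) ^+ 2 / S k k.
  have -> : quad_form S' a = quad_form S a - \sum_i \sum_j (a i * c i) * (a j * c j).
    rewrite /quad_form -sumrB; apply: eq_bigr => i _; rewrite -sumrB; apply: eq_bigr => j _.
    by rewrite /S'; ring.
  rewrite -big_distrlr/= -expr2.
  have -> : \sum_i a i * c i = (\sum_j a j * S k j) / Num.sqrt (S k k).
    by rewrite mulr_suml; apply: eq_bigr => i _; rewrite /c mulrA sS.
  by rewrite expr_div_n sqr_sqrtr ?ltW.
have S'0 a : 0 <= quad_form S' a.
  rewrite quadS'; set u := \sum_j _.
  (* This shift is the minimiser in direction [k]; completing the square leaves exactly the reduced
     form. *)
  have := S0 (fun i => a i + (- (u / S k k)) * (i == k)%:R).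
  rewrite quad_form_shift// -/u -addrA.
  by have -> : 2 * - (u / S k k) * u + (- (u / S k k)) ^+ 2 * S k k = - (u ^+ 2 / S k k) by field.
have [|s hs] := IHn S' _ sS' S'0.
  apply: leq_trans Hn; apply/proper_card/properP; split.
    apply/fintype.subsetP => i; rewrite !inE; apply: contra => /eqP Sii.
    by rewrite /S' cc (psd_diag0 k sS S0 Sii) Sii !mul0r subrr.
  by exists k; rewrite !inE ?S'kk ?eqxx.
exists (c :: s) => i j; rewrite big_cons -hs /S'; ring.
Qed.

End PositiveSemidefinite.

Section GaussianVector.
Variable R : realType.
Local Notation borelR := (g_sigma_algebraType R.-ocitv.-measurable).

(** The hypothesis is the characteristic function of the centred normal law of variance [v]. For
    [v = 0] the comparison is with a constant variable, to match [centered_normal]. *)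
Lemma gaussian_law (v : R) d (T : measurableType d) (Q : probability T R)
    (X : {mfun T >-> R}) : 0 <= v ->
  (forall t theta : R, (\int[Q]_w cos (t * X w + theta))%R = cos theta * expR (- (v * t ^+ 2 / 2))) ->
  forall A, measurable A -> Q (X @^-1` A) = centered_normal v A.
Proof.
move=> v0 h A mA; rewrite /centered_normal; case: (eqVneq v 0) => [v0'|vn0].
  pose X0 : {mfun borelR >-> R} := mkRV (@measurable_cst _ _ _ _ setT (0 : R)).
  have cosE t theta : (\int[Q]_w cos (t * X w + theta))%R = (\int[normal_prob 0 1]_w cos (t * X0 w + theta))%R.
    rewrite h v0' mul0r mul0r oppr0 expR0 mulr1.
    transitivity (\int[normal_prob 0 1]_w (cst (cos theta) w))%R.
      by rewrite Rintegral_cst// /= probability_setT mulr1.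
    by apply: eq_Rintegral => w _; rewrite /= mulr0 add0r.
  rewrite (law_unique cosE mA) /X0 /= preimage_cst diracE; case: ifPn => Ai.
    by rewrite probability_setT.
  by rewrite measure0.
have s0 : 0 < Num.sqrt v by rewrite sqrtr_gt0 lt0r vn0.
pose X0 : {mfun borelR >-> R} := mkRV (@measurable_id _ borelR setT).
have cosE t theta : (\int[Q]_w cos (t * X w + theta))%R = (\int[normal_prob 0 (Num.sqrt v)]_w cos (t * X0 w + theta))%R.
  by rewrite h [RHS]normal_prob_cos// sqr_sqrtr.
by rewrite (law_unique cosE mA).
Qed.

Variable m : nat.

(** Induction on the rank-one terms: for each vector [c], an independent standard normal multiple of
    [c] is added on a product space, which by Fubini multiplies the characteristic function by the
    corresponding Gaussian factor. *)
Lemma gaussian_exists (s : seq ('I_m -> R)) :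
  exists (d : measure_display) (T : measurableType d) (Q : probability T R)
    (G : 'I_m -> {mfun T >-> R}), forall (t : 'I_m -> R) (theta : R),
  (\int[Q]_w cos (trig_phase t (\row_i G i w) + theta))%R =
  cos theta * expR (- ((\sum_(c <- s) (\sum_j t j * c j) ^+ 2) / 2)).
Proof.
elim: s => [|c s [d [T [Q [G hG]]]]].
  exists _, _, (normal_prob 0 1), (fun _ => mkRV (@measurable_cst _ _ borelR R setT (0 : R))) => t theta.
  rewrite big_nil mul0r oppr0 expR0 mulr1.
  transitivity (\int[normal_prob 0 1]_w cos theta)%R; last first.
    by rewrite Rintegral_cst// /= probability_setT mulr1.
  apply: eq_Rintegral => w _; rewrite /trig_phase big1 ?add0r// => j _.
  by rewrite mxE /= mulr0.
pose N : probability borelR R := normal_prob 0 1.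
have mG' i : measurable_fun setT (fun p : T * borelR => G i p.1 + c i * (p.2 : R)).
  apply: measurable_funD; first exact: measurableT_comp.
  by apply: measurable_funM => //; exact: measurable_snd.
exists _, (T * borelR)%type, (Q \x N)%E, (fun i => mkRV (mG' i)) => t theta.
pose tc := \sum_j t j * c j.
have E (p : T * borelR) : trig_phase t (\row_i mkRV (mG' i) p) + theta =
    tc * (p.2 : R) + (trig_phase t (\row_i G i p.1) + theta).
  rewrite addrA; congr (_ + _); rewrite /trig_phase /tc mulr_suml -big_split.
  by apply: eq_bigr => j _; rewrite !mxE /=; ring.
pose F (p : T * borelR) := cos (tc * (p.2 : R) + (trig_phase t (\row_i G i p.1) + theta)).
have mF : measurable_fun setT F.
  apply: measurableT_comp; first exact: continuous_measurable_fun (@continuous_cos R).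
  apply: measurable_funD; first by apply: measurable_funM => //; exact: measurable_snd.
  apply: measurable_funD => //.
  exact: (measurableT_comp (@measurable_phase _ _ _ Q m G t) (@measurable_fst _ _ T borelR)).
have iF : (Q \x N)%E.-integrable setT (EFin \o F).
  by apply: (@integrable_bounded _ _ _ (Q \x N)%E F 1) => // p; exact: cos_max.
transitivity (\int[(Q \x N)%E]_p F p)%R.
  by apply: eq_Rintegral => p _; rewrite E.
rewrite /Rintegral -(integral12_prod_meas1 iF) /fubini_F.
transitivity (\int[Q]_w (cos (trig_phase t (\row_i G i w) + theta) * expR (- (tc ^+ 2 / 2))))%R.
  rewrite /Rintegral; congr fine; apply: eq_integral => w _ /=.
  have mFw : measurable_fun setT (fun y => F (w, y)) by exact: measurableT_comp.
  have iw : N.-integrable setT (EFin \o (fun y => F (w, y))).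
    by apply: (@integrable_bounded _ _ _ N _ 1) => // p; exact: cos_max.
  rewrite -[LHS]fineK; last exact: (integrable_fin_num _ iw).
  congr EFin; have := @normal_prob_cos R 1 ltr01 tc (trig_phase t (\row_i G i w) + theta).
  by rewrite expr1n mul1r.
rewrite RintegralZr//; last first.
  apply: (@integrable_bounded _ _ _ Q _ 1); first exact: (measurable_cos_phase (Q := Q) G).
  by move=> w; exact: cos_max.
by rewrite hG big_cons mulrDl opprD addrC expRD mulrA.
Qed.

Theorem gaussian_vector_exists (S : 'M[R]_m) : S^T = S ->
  (forall a, 0 <= quad_form (fun i j => S i j) a) ->
  exists (d : measure_display) (T : measurableType d) (Q : probability T R)
    (G : 'I_m -> {RV Q >-> R}), centered_gaussian_vector G S /\
  forall (t : 'I_m -> R) (theta : R),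
  (\int[Q]_w cos (trig_phase t (\row_i G i w) + theta))%R =
  cos theta * expR (- (quad_form (fun i j => S i j) t / 2)).
Proof.
move=> sS S0; have sS' i j : S i j = S j i by rewrite -{1}sS mxE.
have [s hs] := psd_rank_one_sum sS' S0.
have [d [T [Q [G hG]]]] := gaussian_exists s.
have qE t : quad_form (fun i j => S i j) t = \sum_(c <- s) (\sum_j t j * c j) ^+ 2.
  rewrite /quad_form; under eq_bigr do under eq_bigr do rewrite hs mulr_sumr.
  under eq_bigr do rewrite exchange_big.
  rewrite exchange_big; apply: eq_bigr => c _ /=; rewrite expr2 big_distrlr/=.
  by apply: eq_bigr => i _; apply: eq_bigr => j _; rewrite mulrACA.
have hG' t theta : (\int[Q]_w cos (trig_phase t (\row_i G i w) + theta))%R =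
  cos theta * expR (- (quad_form (fun i j => S i j) t / 2)) by rewrite qE.
exists d, T, Q, G; split => // a A mA.
have mX : measurable_fun setT (fun w => \sum_(i < m) a i * G i w).
  by apply: measurable_sum => i; apply: measurable_funM.
apply: (@gaussian_law (quad_form (fun i j => S i j) a) _ _ Q (mkRV mX)) => // t theta.
(* The law of the combination with coefficients [a] is read off from the characteristic function
   along the multiples [t a]. *)
have := hG' (fun i => t * a i) theta.
have -> : quad_form (fun i j => S i j) (fun i => t * a i) = quad_form (fun i j => S i j) a * t ^+ 2.
  rewrite /quad_form mulr_suml; apply: eq_bigr => i _; rewrite mulr_suml.
  by apply: eq_bigr => j _; ring.
move=> <-; apply: eq_Rintegral => w _; congr (cos (_ + _)); rewrite /trig_phase /= mulr_sumr.
by apply: eq_bigr => j _; rewrite mxE mulrA.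
Qed.

End GaussianVector.

(** * Uniform permutations *)

Section OccurrenceStatistics.
Variable R : realType.

(** Centred at the exact mean in the model of independent values, not at [C(n, r) / r!]; the
    denominator is [n] to the power [r - 1/2] when [r > 0]. *)
Definition occ_dev (r : nat) (pi : 'S_r) (n N : nat) (g : 'I_n -> nat) : R :=
  ((occ_fun pi g)%:R - 'C(n, r)%:R * pat_prob R r N) / (n%:R ^+ r.-1 * Num.sqrt n%:R).

Definition lin_stat (r : nat) (pi : 'S_r) (n N : nat) (g : 'I_n -> nat) : R :=
  (\sum_(i < n) lin_kernel R pi n N i (g i)) / Num.sqrt n%:R.

(** The transfer between words and permutations is applied to words of length [r] and to the
    indicator of one pattern, whose uniform mean is [1 / r!]. *)
Lemma pat_prob_rate (r N : nat) : (0 < N)%N ->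
  `|pat_prob R r N - r`!%:R^-1| <= 2 * (r%:R ^+ 2 / N%:R).
Proof.
move=> N0; pose pi : 'S_r := 1%g.
have := @pexp_perm_mean R r N N0 1 (fun Y => (pat pi (fun i : 'I_r => Y i))%:R) (fun s => (s == pi)%:R).
have nb (b : bool) : `|b%:R : R| <= 1 by case: b; rewrite /= ?normr1 ?normr0.
have -> : \sum_(s : 'S_r) (s == pi)%:R = 1 :> R.
  rewrite (bigD1 pi)//= eqxx big1 ?addr0// => s /negbTE ->; exact: mulr0n.
rewrite mulr1 mul1r pexp_pat//; apply => // Y s hs.
congr (nat_of_bool _)%:R; apply/idP/eqP => [hp|<- //].
exact: (pat_uniq hs hp).
Qed.

Variables (n N : nat).
Hypothesis N0 : (0 < N)%N.
Hypothesis n0 : (0 < n)%N.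
Local Notation Yspace := {ffun 'I_n -> 'I_N}.
Local Notation E := (pexp (unifw R (N := N))).
Local Notation w1 := (unifw_sum R N0).
Local Notation w0 := (@unifw_ge0 R N _).
Local Notation sn := (Num.sqrt n%:R : R).

Let nR0 : 0 < n%:R :> R.
Proof. by rewrite ltr0n. Qed.

Let sn0 : 0 < sn.
Proof. by rewrite sqrtr_gt0. Qed.

Let sqr_sn : sn ^+ 2 = n%:R.
Proof. by rewrite sqr_sqrtr// ltW. Qed.

Lemma bin_le_exp (r : nat) : 'C(n, r)%:R <= n%:R ^+ r :> R.
Proof.
have /andP[_] := pat_prob01 R 1%g n0 : 0 <= pat_prob R r n <= 1.
by rewrite /pat_prob ler_pdivrMr ?exprn_gt0// mul1r.
Qed.

Lemma scale_powR (r : nat) : (0 < r)%N -> n%:R `^ (r%:R - 2^-1) = n%:R ^+ r.-1 * sn :> R.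
Proof.
move=> r0; have -> : r%:R - 2^-1 = r.-1%:R + 2^-1 :> R.
  by rewrite -[in LHS](prednK r0) -natr1; lra.
rewrite powRD; last by apply/implyP => _; rewrite gt_eqF.
by rewrite powR_mulrn ?ler0n// -powR12_sqrt ?ler0n.
Qed.

Lemma occ_normalized_dev (r : nat) (pi : 'S_r) (s : 'S_n) : (0 < r)%N ->
  `|occ_normalized R pi s - occ_dev pi N (fun i => s i)| <= 2 * r%:R ^+ 2 * (n%:R / N%:R).
Proof.
move=> r0; rewrite /occ_normalized /occ_dev scale_powR// -mulrBl Occ_occ_fun.
have -> : (occ_fun pi (fun i => s i))%:R - r`!%:R^-1 * 'C(n, r)%:R -
    ((occ_fun pi (fun i => s i))%:R - 'C(n, r)%:R * pat_prob R r N) =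
    'C(n, r)%:R * (pat_prob R r N - r`!%:R^-1) :> R by ring.
have d0 : 0 < n%:R ^+ r.-1 * sn by rewrite mulr_gt0// exprn_gt0.
rewrite !normrM normrV ?unitfE ?gt_eqF// (gtr0_norm d0) ler_pdivrMr// ger0_norm//.
apply: (@le_trans _ _ (n%:R ^+ r * (2 * (r%:R ^+ 2 / N%:R)))).
  by apply: ler_pM => //; [exact: bin_le_exp|exact: pat_prob_rate].
have -> : 2 * r%:R ^+ 2 * (n%:R / N%:R) * (n%:R ^+ r.-1 * sn) =
  n%:R ^+ r * (2 * (r%:R ^+ 2 / N%:R)) * sn.
  have -> : n%:R ^+ r = n%:R * n%:R ^+ r.-1 :> R by rewrite -exprS prednK.
  by ring.
rewrite ler_peMr ?mulr_ge0 ?exprn_ge0 ?invr_ge0//.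
by rewrite -[leLHS]sqrtr1 ler_wsqrtr// ler1n.
Qed.

Lemma occ_dev_le (r : nat) (pi : 'S_r) (g : 'I_n -> nat) : (0 < r)%N ->
  `|occ_dev pi N g| <= sn.
Proof.
move=> r0; have d0 : 0 < n%:R ^+ r.-1 * sn by rewrite mulr_gt0// exprn_gt0.
rewrite normrM normrV ?unitfE ?gt_eqF// (gtr0_norm d0) ler_pdivrMr//.
have -> : sn * (n%:R ^+ r.-1 * sn) = n%:R ^+ r.
  by rewrite mulrCA -expr2 sqr_sn -exprSr prednK.
apply: le_trans (bin_le_exp r); have /andP[p0 p1] := pat_prob01 R pi N0.
have : (occ_fun pi g)%:R <= 'C(n, r)%:R :> R.
  by rewrite ler_nat -card_incr subset_leq_card//; apply/fintype.subsetP => e; rewrite !inE => /andP[].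
have : 0 <= (occ_fun pi g)%:R :> R by [].
have c0 : 0 <= 'C(n, r)%:R :> R by [].
have := ler_piMr c0 p1; have := mulr_ge0 c0 p0.
by rewrite ler_norml; lra.
Qed.

Lemma occ_dev_lin_stat (r : nat) (pi : 'S_r) : (0 < r)%N ->
  E (fun Y : Yspace => (occ_dev pi N (fun i => Y i) - lin_stat pi N (fun i => Y i)) ^+ 2)
  <= r.+1%:R ^+ 2 * r%:R ^+ 4 / n%:R.
Proof.
move=> r0; pose D : R := n%:R ^+ r.-1 * sn.
have d0 : 0 < D by rewrite mulr_gt0// exprn_gt0.
have -> : E (fun Y : Yspace => (occ_dev pi N (fun i => Y i) - lin_stat pi N (fun i => Y i)) ^+ 2) =
  E (fun Y : Yspace => ((occ_fun pi (fun i : 'I_n => Y i))%:R - 'C(n, r)%:R * pat_prob R r N -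
     \sum_(i < n) \sum_(j : 'I_r) (pos_count r n j i)%:R * pat_proj R r (pi j) (Y i)) ^+ 2) * D ^- 2.
  rewrite -pexpZr; apply: eq_pexp => Y; rewrite -exprVn -exprMn; congr (_ ^+ 2).
  rewrite [RHS]mulrBl; congr (_ - _).
  have -> : \sum_(i < n) \sum_(j : 'I_r) (pos_count r n j i)%:R * pat_proj R r (pi j) (Y i) =
      n%:R ^+ r.-1 * \sum_(i < n) lin_kernel R pi n N i (Y i).
    rewrite mulr_sumr; apply: eq_bigr => i _; rewrite mulr_sumr; apply: eq_bigr => j _.
    by rewrite mulrA; congr (_ * _); rewrite /pos_array mulrC divfK// gt_eqF// exprn_gt0.
  rewrite /lin_stat /D; have q0 : n%:R ^+ r.-1 != 0 :> R by rewrite gt_eqF ?exprn_gt0.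
  have s0 : sn != 0 by rewrite gt_eqF.
  by field; rewrite q0 s0.
rewrite ler_pdivrMr ?exprn_gt0//; apply: (le_trans (hoeffding_remainder R pi N0 n0)).
rewrite -[leRHS]mulrA ler_wpM2l ?mulr_ge0 ?exprn_ge0//.
rewrite /D exprMn sqr_sn.
have -> : n%:R ^+ r = n%:R * n%:R ^+ r.-1 :> R by rewrite -exprS prednK.
rewrite le_eqVlt; apply/orP; left; apply/eqP; field; by rewrite gt_eqF.
Qed.

Lemma sum_lin_kernel (r : nat) (pi : 'S_r) (i : nat) :
  \sum_(y < N) N%:R^-1 * lin_kernel R pi n N i y = 0.
Proof.
rewrite /lin_kernel; under eq_bigr do rewrite mulr_sumr.
rewrite exchange_big big1// => j _ /=.
under eq_bigr do rewrite mulrCA.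
by rewrite -mulr_sumr [X in _ * X](sum_pat_proj R N0 (pi j)) mulr0.
Qed.

Lemma pexp_lin_stat (r : nat) (pi : 'S_r) : E (fun Y : Yspace => lin_stat pi N (fun i => Y i)) = 0.
Proof.
rewrite pexpZr pexp_sum big1 ?mul0r// => i _.
by rewrite (pexp_coord w1 i (fun y : 'I_N => lin_kernel R pi n N i y)) sum_lin_kernel.
Qed.

(** Polarisation: the variance formula is applied to the sum and to the difference of the two
    kernels. *)
Lemma pexp_lin_statM (r1 r2 : nat) (pi : 'S_r1) (rho : 'S_r2) :
  E (fun Y : Yspace => lin_stat pi N (fun i => Y i) * lin_stat rho N (fun i => Y i)) =
  lin_cov R pi rho n N.
Proof.
have V (phi : 'I_n -> 'I_N -> R) : (forall i, \sum_y N%:R^-1 * phi i y = 0) ->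
    E (fun Y : Yspace => (\sum_i phi i (Y i)) ^+ 2) = \sum_i \sum_y N%:R^-1 * phi i y ^+ 2.
  by move=> h; rewrite (pexp_var_sum w1 (e := id)).
pose a (i : 'I_n) (y : 'I_N) : R := lin_kernel R pi n N i y.
pose b (i : 'I_n) (y : 'I_N) : R := lin_kernel R rho n N i y.
have hp i : \sum_y N%:R^-1 * (a i y + b i y) = 0.
  by under eq_bigr do rewrite mulrDr; rewrite big_split/= !sum_lin_kernel addr0.
have hm i : \sum_y N%:R^-1 * (a i y - b i y) = 0.
  by under eq_bigr do rewrite mulrBr; rewrite sumrB !sum_lin_kernel subr0.
have em : E (fun Y : Yspace => (\sum_i (a i (Y i) - b i (Y i))) ^+ 2) =
  \sum_i \sum_y N%:R^-1 * (a i y - b i y) ^+ 2 := V _ hm.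
have ep : E (fun Y : Yspace => (\sum_i (a i (Y i) + b i (Y i))) ^+ 2) =
  \sum_i \sum_y N%:R^-1 * (a i y + b i y) ^+ 2 := V _ hp.
have : (E (fun Y : Yspace => (\sum_i (a i (Y i) + b i (Y i))) ^+ 2) -
  E (fun Y : Yspace => (\sum_i (a i (Y i) - b i (Y i))) ^+ 2)) / 4 =
  E (fun Y : Yspace => (\sum_i a i (Y i)) * (\sum_i b i (Y i))).
  rewrite -pexpB -pexpZr; apply: eq_pexp => Y; rewrite big_split sumrB /=.
  by move: (\sum_i _) (\sum_i b i _) => u v; field.
rewrite em ep => h.
transitivity (E (fun Y : Yspace => (\sum_i a i (Y i)) * (\sum_i b i (Y i))) / n%:R).
  rewrite -pexpZr; apply: eq_pexp => Y; rewrite /lin_stat mulrACA -invfM -expr2 sqr_sn.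
  by [].
rewrite -h -sumrB /lin_cov; congr (_ / _); rewrite mulr_suml; apply: eq_bigr => i _.
rewrite -sumrB mulr_suml mulr_suml; apply: eq_bigr => y _; rewrite /a /b.
by move: (N%:R^-1) => z; field.
Qed.

End OccurrenceStatistics.

Section UniformMean.
Variables (R : realType) (n : nat).
Implicit Types F G : 'S_n -> R.

Let fact_gt0 : 0 < n`!%:R :> R.
Proof. by rewrite ltr0n fact_gt0. Qed.

Lemma unif_meanD F G : unif_mean (fun s => F s + G s) = unif_mean F + unif_mean G.
Proof. by rewrite /unif_mean big_split mulrDl. Qed.

Lemma unif_meanZ a F : unif_mean (fun s => a * F s) = a * unif_mean F.
Proof. by rewrite /unif_mean -mulr_sumr mulrA. Qed.

Lemma unif_mean_cst (a : R) : unif_mean (fun _ : 'S_n => a) = a.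
Proof.
rewrite /unif_mean sumr_const card_Sn -[a *+ _]mulr_natr mulfK// gt_eqF//.
Qed.

Lemma ler_unif_mean F G : (forall s, F s <= G s) -> unif_mean F <= unif_mean G.
Proof. by move=> FG; rewrite ler_pM2r ?invr_gt0// ler_sum. Qed.

Lemma ler_norm_unif_mean F : `|unif_mean F| <= unif_mean (fun s => `|F s|).
Proof.
rewrite normrM [`|_^-1|]gtr0_norm ?invr_gt0// ler_pM2r ?invr_gt0//.
exact: ler_norm_sum.
Qed.

Lemma eq_unif_mean F G : F =1 G -> unif_mean F = unif_mean G.
Proof. by move=> FG; rewrite /unif_mean (eq_bigr _ (fun s _ => FG s)). Qed.

(** Constants drop out of a covariance, so passing from [Occ] to the recentred [occ_dev] only
    rescales it. *)
Lemma unif_cov_affine (a b c e : R) F G :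
  unif_cov (fun s => a * F s + b) (fun s => c * G s + e) =
  a * c * (unif_mean (fun s => F s * G s) - unif_mean F * unif_mean G).
Proof.
rewrite /unif_cov !unif_meanD !unif_meanZ !unif_mean_cst.
rewrite (@eq_unif_mean _ (fun s => a * c * (F s * G s) + - (a * c * unif_mean G) * F s +
  - (a * c * unif_mean F) * G s + a * c * (unif_mean F * unif_mean G))) => [|s].
  by rewrite !unif_meanD unif_mean_cst !unif_meanZ; ring.
by ring.
Qed.

End UniformMean.

(** * First and second moments of the normalised counts *)

Section UniformLimit.
Variable R : realType.

Lemma cvg_div_sqrt (C : R) : (fun n : nat => C / Num.sqrt n%:R) @ \oo --> (0 : R).
Proof.
have h : (fun n : nat => (n%:R : R)^-1) @ \oo --> (0 : R).
  by have := cvg_harmonic0 (1 : R); under eq_fun do rewrite mul1r.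
have {}h : (fun n : nat => Num.sqrt (n%:R : R)^-1) @ \oo --> (0 : R).
  by rewrite -[X in _ --> X]sqrtr0; apply: continuous_cvg h; exact: sqrt_continuous.
rewrite -[X in _ --> X](mulr0 C); apply: cvgMr; apply: cvg_trans h; apply: near_eq_cvg.
by apply: nearW => n; rewrite sqrtrV ?ler0n.
Qed.

Definition rem_const (r : nat) : R := r.+1%:R * r%:R ^+ 2.

Variable n : nat.
Hypothesis n0 : (0 < n)%N.
Local Notation N := (n ^ 4)%N.
Local Notation Yspace := {ffun 'I_n -> 'I_N}.
Local Notation E := (pexp (unifw R (N := N))).
Local Notation sn := (Num.sqrt n%:R : R).

Let N0 : (0 < N)%N.
Proof. by rewrite expn_gt0 n0. Qed.

Local Notation w1 := (unifw_sum R N0).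
Local Notation w0 := (@unifw_ge0 R N _).

Let nR1 : 1 <= n%:R :> R.
Proof. by rewrite ler1n. Qed.

Let nR0 : 0 < n%:R :> R.
Proof. by rewrite ltr0n. Qed.

Let sn0 : 0 < sn.
Proof. by rewrite sqrtr_gt0. Qed.

Let sn1 : 1 <= sn.
Proof. by rewrite -[leLHS]sqrtr1 ler_wsqrtr. Qed.

Let sqr_sn : sn ^+ 2 = n%:R.
Proof. by rewrite sqr_sqrtr// ltW. Qed.

Let exp_div_N k : (k <= 3)%N -> n%:R ^+ k / N%:R <= n%:R^-1 :> R.
Proof.
move=> k3; rewrite natrX ler_pdivrMr ?exprn_gt0// exprS mulKf ?gt_eqF//.
by rewrite ler_weXn2l.
Qed.

Lemma pexp_rem_sqr (r : nat) (pi : 'S_r) : (0 < r)%N ->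
  E (fun Y : Yspace => (occ_dev R pi N (fun i => Y i) - lin_stat R pi N (fun i => Y i)) ^+ 2)
  <= rem_const r ^+ 2 / n%:R.
Proof.
move=> r0; have := occ_dev_lin_stat R N0 n0 pi r0.
by rewrite /rem_const exprMn -exprM.
Qed.

Lemma pexp_occ_dev_lin_stat (r : nat) (pi : 'S_r) : (0 < r)%N ->
  E (fun Y : Yspace => `|occ_dev R pi N (fun i => Y i) - lin_stat R pi N (fun i => Y i)|)
  <= rem_const r / sn.
Proof.
move=> r0; have rc0 : 0 <= rem_const r by rewrite mulr_ge0 ?exprn_ge0.
rewrite -(@ler_pXn2r _ 2)// ?nnegrE ?divr_ge0 ?(ltW sn0)//; last first.
  by apply: pexp_ge0 => [||Y]; [exact: w0|exact: w1|].
apply: le_trans (pexp_sqr_le w0 w1 _) _.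
rewrite expr_div_n sqr_sn; under eq_pexp do rewrite real_normK ?num_real//.
exact: pexp_rem_sqr.
Qed.

Lemma lin_cov_le (r : nat) (pi : 'S_r) : lin_cov R pi pi n N <= r%:R ^+ 2.
Proof.
rewrite /lin_cov ler_pdivrMr//.
have -> : r%:R ^+ 2 * n%:R = \sum_(i < n) r%:R ^+ 2 :> R.
  by rewrite sumr_const card_ord mulr_natr.
apply: ler_sum => i _; rewrite ler_pdivrMr ?ltr0n//.
have -> : r%:R ^+ 2 * N%:R = \sum_(i < N) r%:R ^+ 2 :> R.
  by rewrite sumr_const card_ord mulr_natr.
apply: ler_sum => y _; rewrite -expr2 -real_normK ?num_real//.
by rewrite lerXn2r ?nnegrE// lin_kernel_le.
Qed.

(** Weighted arithmetic-geometric inequality in place of Cauchy-Schwarz. With [c = sqrt n], a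
    bounded second moment paired with one of order [1 / n] gives [O(1 / sqrt n)]. *)
Lemma pexp_amgm (F G : Yspace -> R) (c : R) : 0 < c ->
  E (fun Y => `|F Y * G Y|) <= (E (fun Y => F Y ^+ 2) / c + c * E (fun Y => G Y ^+ 2)) / 2.
Proof.
move=> c0; rewrite -pexpZr -pexpZ -pexpD -pexpZr; apply: ler_pexp => [|Y]; first exact: w0.
rewrite normrM -(real_normK (num_real (F Y))) -(real_normK (num_real (G Y))).
move: `|F Y| `|G Y| => x y.
rewrite -subr_ge0.
have -> : (x ^+ 2 / c + c * y ^+ 2) / 2 - x * y = (x - c * y) ^+ 2 / c / 2.
  by field; rewrite gt_eqF.
by rewrite !divr_ge0 ?sqr_ge0// ltW.
Qed.

Lemma pexp_occ_dev_sqr (r : nat) (pi : 'S_r) : (0 < r)%N ->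
  E (fun Y : Yspace => occ_dev R pi N (fun i => Y i) ^+ 2) <= 2 * (r%:R ^+ 2 + rem_const r ^+ 2).
Proof.
move=> r0.
apply: (@le_trans _ _ (E (fun Y : Yspace => 2 * (lin_stat R pi N (fun i => Y i) * lin_stat R pi N (fun i => Y i)) +
  2 * (occ_dev R pi N (fun i => Y i) - lin_stat R pi N (fun i => Y i)) ^+ 2))).
  apply: ler_pexp => [|Y]; first exact: w0.
  move: (occ_dev _ _ _ _) (lin_stat _ _ _ _) => x y.
  by have := sqr_ge0 (x - 2 * y); nra.
rewrite pexpD !pexpZ pexp_lin_statM// -mulrDr ler_wpM2l// lerD ?lin_cov_le//.
apply: le_trans (pexp_rem_sqr pi r0) _; rewrite ler_pdivrMr// ler_peMr// sqr_ge0//.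
Qed.

(** The projection is centred, so the mean of the count reduces to that of the remainder, up to the
    cost of ties. *)
Lemma unif_mean_occ_dev (r : nat) (pi : 'S_r) : (0 < r)%N ->
  `|unif_mean (fun s : 'S_n => occ_dev R pi N (fun i => s i))| <= (2 + rem_const r) / sn.
Proof.
move=> r0; set m := unif_mean _.
pose A (Y : Yspace) := occ_dev R pi N (fun i => Y i).
have h1 : `|E A - m| <= 2 * sn * (n%:R ^+ 2 / N%:R).
  apply: pexp_perm_mean => // [Y|s|Y s hs]; [exact: occ_dev_le|exact: occ_dev_le|].
  by rewrite /A /occ_dev (occ_fun_pat _ hs).
have h2 : `|E A| <= rem_const r / sn.
  apply: le_trans (pexp_occ_dev_lin_stat pi r0).
  have -> : E A = E (fun Y => A Y - lin_stat R pi N (fun i => Y i)).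
    by rewrite pexpB pexp_lin_stat// subr0.
  by apply: ler_norm_pexp => i t; exact: unifw_ge0.
have h3 : 2 * sn * (n%:R ^+ 2 / N%:R) <= 2 / sn.
  rewrite -mulrA ler_wpM2l// -ler_pdivlMl// -invfM -expr2 sqr_sn.
  exact: exp_div_N.
have := ler_distD (E A) 0 m; rewrite sub0r normrN sub0r normrN mulrDl; lra.
Qed.

(** With [L] and [L'] the projections of the normalised counts [A] and [B], the identity
    [A B - L L' = A (B - L') + L' (A - L)] leaves only products containing a remainder, of order
    [1 / n] in second moment. *)
Lemma unif_mean_occ_devM (r1 r2 : nat) (pi : 'S_r1) (rho : 'S_r2) : (0 < r1)%N -> (0 < r2)%N ->
  `|unif_mean (fun s : 'S_n => occ_dev R pi N (fun i => s i) * occ_dev R rho N (fun i => s i)) -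
    lin_cov R pi rho n N| <=
  (2 + (r1%:R ^+ 2 + rem_const r1 ^+ 2) + (r2%:R ^+ 2) + rem_const r1 ^+ 2 + rem_const r2 ^+ 2) / sn.
Proof.
move=> r10 r20; set m := unif_mean _.
pose A (Y : Yspace) := occ_dev R pi N (fun i => Y i).
pose B (Y : Yspace) := occ_dev R rho N (fun i => Y i).
pose L (Y : Yspace) := lin_stat R pi N (fun i => Y i).
pose L' (Y : Yspace) := lin_stat R rho N (fun i => Y i).
have h1 : `|E (fun Y => A Y * B Y) - m| <= 2 * (sn * sn) * (n%:R ^+ 2 / N%:R).
  apply: (pexp_perm_mean N0) => // [Y|s|Y s hs].
  - by rewrite normrM ler_pM// occ_dev_le.
  - by rewrite normrM ler_pM// occ_dev_le.
  - by rewrite /A /B /occ_dev !(occ_fun_pat _ hs).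
have h2 : 2 * (sn * sn) * (n%:R ^+ 2 / N%:R) <= 2 / sn.
  rewrite -mulrA ler_wpM2l// -expr2 sqr_sn mulrA -exprS.
  by apply: le_trans (exp_div_N _) _ => //; rewrite lef_pV2 ?posrE// -[leRHS]sqr_sn ler_eXnr.
have h3 : `|E (fun Y => A Y * B Y) - lin_cov R pi rho n N| <=
    E (fun Y => `|A Y * (B Y - L' Y)|) + E (fun Y => `|L' Y * (A Y - L Y)|).
  rewrite -(@pexp_lin_statM R n N N0) -pexpB -pexpD; apply: le_trans (ler_norm_pexp w0 _) _.
  apply: ler_pexp => [|Y]; first exact: w0.
  by apply: le_trans (ler_normD _ _); rewrite -/(L Y) -/(L' Y) le_eqVlt; apply/orP; left; apply/eqP; congr `|_|; ring.
have /= h4 := pexp_amgm A (fun Y => B Y - L' Y) sn0.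
have /= h5 := pexp_amgm L' (fun Y => A Y - L Y) sn0.
have h6 : E (fun Y => A Y ^+ 2) / sn <= 2 * (r1%:R ^+ 2 + rem_const r1 ^+ 2) / sn.
  by rewrite ler_wpM2r ?invr_ge0 ?(ltW sn0)// pexp_occ_dev_sqr.
have h7 : E (fun Y => L' Y ^+ 2) / sn <= r2%:R ^+ 2 / sn.
  rewrite ler_wpM2r ?invr_ge0 ?(ltW sn0)//; apply: le_trans (lin_cov_le rho).
  by rewrite -(@pexp_lin_statM R n N N0).
have nsn : n%:R^-1 = sn^-1 * sn^-1 :> R by rewrite -invfM -expr2 sqr_sn.
have h8 : sn * E (fun Y => (B Y - L' Y) ^+ 2) <= rem_const r2 ^+ 2 / sn.
  rewrite -ler_pdivlMl//; apply: le_trans (pexp_rem_sqr rho r20) _.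
  by rewrite nsn mulrCA.
have h9 : sn * E (fun Y => (A Y - L Y) ^+ 2) <= rem_const r1 ^+ 2 / sn.
  rewrite -ler_pdivlMl//; apply: le_trans (pexp_rem_sqr pi r10) _.
  by rewrite nsn mulrCA.
have := ler_distD (E (fun Y => A Y * B Y)) m (lin_cov R pi rho n N).
rewrite (distrC m (E _)) => h10.
have h11 : 0 <= r2%:R ^+ 2 / sn by rewrite divr_ge0 ?exprn_ge0// ltW.
have h12 x : 0 <= rem_const x ^+ 2 / sn by rewrite divr_ge0 ?exprn_ge0 ?mulr_ge0 ?exprn_ge0// ltW.
have := h12 r1; have := h12 r2.
lra.
Qed.

End UniformLimit.

(** * Existence and value of the limiting covariances *)

Section LimitCovariance.
Variable R : realType.

Lemma cvg_near0 (u v : nat -> R) (l : R) : (fun n => u n - v n) @ \oo --> (0 : R) ->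
  v @ \oo --> l -> u @ \oo --> l.
Proof.
move=> uv vl; have : (fun n => u n - v n + v n) @ \oo --> 0 + l by exact: cvgD.
by rewrite add0r; under eq_fun do rewrite subrK.
Qed.

Lemma cvg_norm_le0 (u v : nat -> R) : (\forall n \near \oo, `|u n| <= v n) ->
  v @ \oo --> (0 : R) -> u @ \oo --> (0 : R).
Proof.
move=> uv v0; apply: norm_cvg0.
apply: (@squeeze_cvgr _ _ _ _ (cst 0) v); [|exact: cvg_cst|exact: v0].
by apply: filterS uv => n ->; rewrite normr_ge0.
Qed.

Section Pair.
Variables (r1 r2 : nat) (pi : 'S_r1) (rho : 'S_r2).
Hypotheses (r10 : (0 < r1)%N) (r20 : (0 < r2)%N).

Lemma unif_covE (n : nat) : (0 < n)%N ->
  unif_cov (fun u : 'S_n => (Occ pi u)%:R : R) (fun u : 'S_n => (Occ rho u)%:R)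
    / n%:R ^+ (r1 + r2).-1 =
  unif_mean (fun s : 'S_n => occ_dev R pi (n ^ 4) (fun i => s i) * occ_dev R rho (n ^ 4) (fun i => s i)) -
  unif_mean (fun s : 'S_n => occ_dev R pi (n ^ 4) (fun i => s i)) *
  unif_mean (fun s : 'S_n => occ_dev R rho (n ^ 4) (fun i => s i)).
Proof.
move=> n0; have nR0 : 0 < n%:R :> R by rewrite ltr0n.
have sn0 : 0 < Num.sqrt n%:R :> R by rewrite sqrtr_gt0.
have D0 r : n%:R ^+ r.-1 * Num.sqrt n%:R != 0 :> R by rewrite gt_eqF// mulr_gt0// exprn_gt0.
have occE r (p : 'S_r) : (fun s : 'S_n => (Occ p s)%:R : R) =
    (fun s => n%:R ^+ r.-1 * Num.sqrt n%:R * occ_dev R p (n ^ 4) (fun i => s i) +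
      'C(n, r)%:R * pat_prob R r (n ^ 4)).
  by apply/funext => s; rewrite /occ_dev mulrC divfK// subrK Occ_occ_fun.
rewrite !occE unif_cov_affine mulrC mulrA.
have -> : n%:R ^+ r1.-1 * Num.sqrt n%:R * (n%:R ^+ r2.-1 * Num.sqrt n%:R) = n%:R ^+ (r1 + r2).-1 :> R.
  rewrite mulrACA -expr2 sqr_sqrtr ?(ltW nR0)// -exprD -exprSr; congr (_ ^+ _).
  by lia.
by rewrite mulVf ?mul1r// gt_eqF// exprn_gt0.
Qed.

(** The product of the two means is [O(1 / n)] and the mean of the product is within [O(1 / sqrt n)]
    of [lin_cov], so the limit defining [nu_cov] exists and is that of the projections. *)
Theorem cvg_unif_cov :
  (fun n => unif_cov (fun u : 'S_n => (Occ pi u)%:R : R) (fun u : 'S_n => (Occ rho u)%:R)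
    / n%:R ^+ (r1 + r2).-1) @ \oo --> limn (fun n => lin_cov R pi rho n (n ^ 4)).
Proof.
apply: (@cvg_near0 _ (fun n => lin_cov R pi rho n (n ^ 4))); last exact: cvg_lin_cov.
set K : R := 2 + (r1%:R ^+ 2 + rem_const R r1 ^+ 2) + (r2%:R ^+ 2) + rem_const R r1 ^+ 2 + rem_const R r2 ^+ 2.
apply: (@cvg_norm_le0 _ (fun n => K / Num.sqrt n%:R +
  ((2 + rem_const R r1) / Num.sqrt n%:R) * ((2 + rem_const R r2) / Num.sqrt n%:R))); last first.
  rewrite -[0](addr0 (0 : R)); apply: cvgD; first exact: cvg_div_sqrt.
  by rewrite -[X in _ --> X](mulr0 (0 : R)); apply: cvgM; exact: cvg_div_sqrt.
exists 1%N => //= n n0; rewrite unif_covE//.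
have h1 := unif_mean_occ_devM R n0 pi rho r10 r20.
have h2 := ler_pM (normr_ge0 _) (normr_ge0 _) (unif_mean_occ_dev R n0 pi r10) (unif_mean_occ_dev R n0 rho r20).
rewrite -normrM in h2; rewrite addrAC; apply: le_trans (ler_normB _ _) _.
exact: lerD.
Qed.

Lemma nu_covE : nu_cov R pi rho = limn (fun n => lin_cov R pi rho n (n ^ 4)).
Proof. exact/cvg_lim/cvg_unif_cov. Qed.

Lemma cvg_lin_cov_nu : (fun n => lin_cov R pi rho n (n ^ 4)) @ \oo --> nu_cov R pi rho.
Proof. by rewrite nu_covE; exact: cvg_lin_cov. Qed.

End Pair.

Lemma nu_cov_gt0 (r : nat) (pi : 'S_r) : (2 <= r)%N -> 0 < nu_cov R pi pi.
Proof.
by move=> r2; rewrite nu_covE ?(ltnW r2)//; exact: lin_cov_gt0.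
Qed.

End LimitCovariance.

(** * Central limit theorem for uniform permutations *)

Section UniformCLT.
Variables (R : realType) (m : nat) (r : 'I_m -> nat) (pi : forall a, 'S_(r a)).
Hypothesis r0 : forall a, (0 < r a)%N.
Variable t : 'I_m -> R.

Let lin_combo n (i : 'I_n) (y : nat) : R :=
  (\sum_a t a * lin_kernel R (pi a) n (n ^ 4) i y) / Num.sqrt n%:R.

Let var n : R := \sum_a \sum_b t a * t b * lin_cov R (pi a) (pi b) n (n ^ 4).

Let T : R := \sum_a `|t a| * (r a)%:R.

Let T0 : 0 <= T.
Proof. by apply: sumr_ge0 => a _; rewrite mulr_ge0. Qed.

(** One term per approximation: Gaussian approximation of the projection, Hoeffding remainder,
    passage from words to permutations, recentring at [C(n, r) / r!]. *)
Let err n : R := (2 * T ^+ 3) / Num.sqrt n%:R + (\sum_a `|t a| * rem_const R (r a)) / Num.sqrt n%:R +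
  2 / n%:R + (\sum_a `|t a| * (2 * (r a)%:R ^+ 2)) / n%:R.

(** There are [n] summands, each bounded by [T / sqrt n], so [n] errors [2 (T / sqrt n) ^ 3] add up
    to the bound. The hypothesis on [T] makes the summands at most 1 in absolute value. *)
Lemma cos_lin_stat n (theta : R) : (0 < n)%N -> T <= Num.sqrt n%:R ->
  `|pexp (unifw R (N := n ^ 4))
     (fun Y : {ffun 'I_n -> 'I_(n ^ 4)} =>
       cos (theta + \sum_a t a * lin_stat R (pi a) (n ^ 4) (fun i => Y i))) -
    cos theta * expR (- (var n / 2))| <= (2 * T ^+ 3) / Num.sqrt n%:R.
Proof.
move=> n0 Tn; have N0 : (0 < n ^ 4)%N by rewrite expn_gt0 n0.
have nR0 : 0 < n%:R :> R by rewrite ltr0n.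
set sn : R := Num.sqrt n%:R in Tn *; have sn0 : 0 < sn by rewrite sqrtr_gt0.
pose eta (i : 'I_n) (y : 'I_(n ^ 4)) := lin_combo i y.
have eta0 i : \sum_y (unifw R (N := n ^ 4)) i y * eta i y = 0.
  rewrite /eta /lin_combo; under eq_bigr do rewrite mulrA mulr_sumr.
  rewrite -mulr_suml exchange_big big1 ?mul0r// => a _.
  under eq_bigr do rewrite mulrCA.
  by rewrite -mulr_sumr [X in _ * X](sum_lin_kernel R n N0) mulr0.
have eta_le i y : `|eta i y| <= T / sn.
  rewrite /eta /lin_combo normrM normrV ?unitfE ?gt_eqF// (gtr0_norm sn0) ler_pM2r ?invr_gt0//.
  apply: le_trans (ler_norm_sum _ _ _) _; apply: ler_sum => a _.
  by rewrite normrM ler_wpM2l// lin_kernel_le.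
have b01 : 0 <= T / sn <= 1 by rewrite divr_ge0 ?(ltW sn0)//= ler_pdivrMr// mul1r.
have linE (Y : {ffun 'I_n -> 'I_(n ^ 4)}) :
    \sum_a t a * lin_stat R (pi a) (n ^ 4) (fun i => Y i) = \sum_i eta i (Y i).
  rewrite /eta /lin_combo -mulr_suml exchange_big mulr_suml; apply: eq_bigr => a _ /=.
  by rewrite -mulr_sumr mulrA.
have varE : \sum_(i <- index_enum 'I_n) \sum_y (unifw R (N := n ^ 4)) i y * eta i y ^+ 2 = var n.
  have := pexp_var_sum (unifw_sum R N0) (e := id) (phi := eta) (fun i j h => h) eta0.
  move=> <-; rewrite /var.
  transitivity (pexp (unifw R (N := n ^ 4)) (fun Y : {ffun 'I_n -> 'I_(n ^ 4)} =>
     \sum_a \sum_b t a * t b * (lin_stat R (pi a) (n ^ 4) (fun i => Y i) * lin_stat R (pi b) (n ^ 4) (fun i => Y i)))).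
    apply: eq_pexp => Y; rewrite -linE expr2 big_distrlr; apply: eq_bigr => a _.
    by apply: eq_bigr => b _; rewrite mulrACA.
  rewrite pexp_sum; apply: eq_bigr => a _; rewrite pexp_sum; apply: eq_bigr => b _.
  by rewrite pexpZ (@pexp_lin_statM R n _ N0).
have := pexp_cos_sum (@unifw_ge0 R _ _) (unifw_sum R N0) b01 eta_le eta0 theta (index_enum_uniq 'I_n).
rewrite varE; under eq_pexp do rewrite -linE.
move/le_trans; apply.
have -> : size (index_enum 'I_n) = n by rewrite [index_enum _]unlock -enumT size_enum_ord.
rewrite le_eqVlt; apply/orP; left; apply/eqP.
rewrite -mulr_natr.
have -> : n%:R = sn ^+ 2 by rewrite sqr_sqrtr// ltW.
by field; rewrite gt_eqF.
Qed.

Lemma unif_clt_bound n (theta : R) : (0 < n)%N -> T <= Num.sqrt n%:R ->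
  `|unif_mean (fun s : 'S_n => cos (theta + \sum_a t a * occ_normalized R (pi a) s)) -
    cos theta * expR (- (var n / 2))| <= err n.
Proof.
move=> n0 Tn; have N0 : (0 < n ^ 4)%N by rewrite expn_gt0 n0.
have nR0 : 0 < n%:R :> R by rewrite ltr0n.
set sn : R := Num.sqrt n%:R in Tn *; have sn0 : 0 < sn by rewrite sqrtr_gt0.
have cos_lip (x y : 'I_m -> R) : `|cos (theta + \sum_a t a * x a) - cos (theta + \sum_a t a * y a)| <=
    \sum_a `|t a| * `|x a - y a|.
  apply: le_trans (norm_cosB _ _) _.
  rewrite opprD addrACA subrr add0r -sumrB; apply: le_trans (ler_norm_sum _ _ _) _.
  by apply: ler_sum => a _; rewrite -mulrBr normrM distrC.
set mU := unif_mean _.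
pose mV := unif_mean (fun s : 'S_n => cos (theta + \sum_a t a * occ_dev R (pi a) (n ^ 4) (fun i => s i))).
pose EV := pexp (unifw R (N := n ^ 4)) (fun Y : {ffun 'I_n -> 'I_(n ^ 4)} =>
  cos (theta + \sum_a t a * occ_dev R (pi a) (n ^ 4) (fun i => Y i))).
pose EL := pexp (unifw R (N := n ^ 4)) (fun Y : {ffun 'I_n -> 'I_(n ^ 4)} =>
  cos (theta + \sum_a t a * lin_stat R (pi a) (n ^ 4) (fun i => Y i))).
have h1 : `|mU - mV| <= (\sum_a `|t a| * (2 * (r a)%:R ^+ 2)) / n%:R.
  rewrite /mU /mV; set F := fun s : 'S_n => _; set G := fun s : 'S_n => _.
  have -> : unif_mean F - unif_mean G = unif_mean (fun s => F s + -1 * G s).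
    by rewrite unif_meanD unif_meanZ mulN1r.
  apply: le_trans (ler_norm_unif_mean _) _.
  rewrite -[leRHS](unif_mean_cst n); apply: ler_unif_mean => s; rewrite mulN1r.
  apply: le_trans (cos_lip _ _) _; rewrite mulr_suml; apply: ler_sum => a _.
  rewrite -mulrA ler_wpM2l//; apply: le_trans (occ_normalized_dev R N0 n0 (pi a) s (r0 a)) _.
  rewrite ler_wpM2l ?mulr_ge0 ?exprn_ge0// natrX ler_pdivrMr ?exprn_gt0//.
  by rewrite exprS mulKf ?gt_eqF// -[leLHS]expr1 ler_weXn2l// ler1n.
have h2 : `|EV - mV| <= 2 / n%:R.
  apply: le_trans (@pexp_perm_mean R n (n ^ 4) N0 1 _ (fun s : 'S_n => cos (theta + \sum_a t a * occ_dev R (pi a) (n ^ 4) (fun i => s i))) _ _ _) _ => [Y|s|Y s hs|].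
  - exact: cos_max.
  - exact: cos_max.
  - congr (cos (_ + _)); apply: eq_bigr => a _; congr (_ * _).
    by rewrite /occ_dev (occ_fun_pat _ hs).
  rewrite mulr1 ler_wpM2l// natrX ler_pdivrMr ?exprn_gt0//.
  by rewrite [n%:R ^+ 4]exprS mulKf ?gt_eqF// ler_weXn2l// ler1n.
have h3 : `|EV - EL| <= (\sum_a `|t a| * rem_const R (r a)) / sn.
  rewrite -pexpB; apply: le_trans (ler_norm_pexp (@unifw_ge0 R _ _) _) _.
  apply: (@le_trans _ _ (pexp (unifw R (N := n ^ 4)) (fun Y : {ffun 'I_n -> 'I_(n ^ 4)} =>
    \sum_a `|t a| * `|occ_dev R (pi a) (n ^ 4) (fun i => Y i) - lin_stat R (pi a) (n ^ 4) (fun i => Y i)|))).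
    by apply: ler_pexp => [|Y]; [exact: unifw_ge0|exact: cos_lip].
  rewrite pexp_sum mulr_suml; apply: ler_sum => a _; rewrite pexpZ -mulrA ler_wpM2l//.
  exact: pexp_occ_dev_lin_stat.
have h4 := cos_lin_stat theta n0 Tn.
rewrite -/EL in h4; rewrite /err -/sn.
have h5 := ler_distD mV mU (cos theta * expR (- (var n / 2))).
have h6 := ler_distD EV mV (cos theta * expR (- (var n / 2))).
have h7 := ler_distD EL EV (cos theta * expR (- (var n / 2))).
rewrite (distrC mV EV) in h6; lra.
Qed.

Theorem unif_clt (theta : R) :
  (fun n => unif_mean (fun s : 'S_n => cos (theta + \sum_a t a * occ_normalized R (pi a) s))) @ \oo -->
  cos theta * expR (- ((\sum_a \sum_b t a * t b * nu_cov R (pi a) (pi b)) / 2)).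
Proof.
apply: (@cvg_near0 _ _ (fun n => cos theta * expR (- (var n / 2)))).
  apply: (@cvg_norm_le0 _ _ err).
    (* Beyond this rank [n >= T ^ 2], as the quantitative bound requires. *)
    exists (Num.bound (T ^+ 2)).+1 => //= n hn; apply: unif_clt_bound; first by apply: leq_trans hn.
    rewrite -(ler_pXn2r (n := 2))// ?nnegrE ?sqrtr_ge0// sqr_sqrtr//.
    apply: (le_trans (ltW (archi_boundP _))); first by rewrite exprn_ge0.
    by rewrite ler_nat ltnW.
  rewrite /err -[X in _ --> X](addr0 (0 : R)); apply: cvgD; last exact: cvg_harmonic0.
  rewrite -[X in _ --> X](addr0 (0 : R)); apply: cvgD; last exact: cvg_harmonic0.
  by rewrite -[X in _ --> X](addr0 (0 : R)); apply: cvgD; exact: cvg_div_sqrt.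
apply: cvgMr; apply: continuous_cvg; first exact: continuous_expR.
apply: cvgN; apply: cvgMl; apply: cvg_sumr => a _; apply: cvg_sumr => b _; apply: cvgMr.
exact: cvg_lin_cov_nu.
Qed.

End UniformCLT.

(** * Mallows permutations *)

Section AbsoluteMoment.
Variable R : realType.

Definition abs_const (r : nat) : R := 3 * (1 + r%:R ^+ 2 + rem_const R r ^+ 2) .

(** Serves twice: for the fluctuations of the inversion number in the total variation bound, and for
    tightness. It comes from the second moment through [|x| <= (1 + x ^ 2) / 2]. *)
Lemma unif_mean_abs_occ (n r : nat) (pi : 'S_r) : (0 < n)%N -> (0 < r)%N ->
  unif_mean (fun s : 'S_n => `|occ_normalized R pi s|) <= abs_const r.
Proof.
move=> n0 r0; have N0 : (0 < n ^ 4)%N by rewrite expn_gt0 n0.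
have nR0 : 0 < n%:R :> R by rewrite ltr0n.
have nR1 : 1 <= n%:R :> R by rewrite ler1n.
set sn : R := Num.sqrt n%:R; have sn0 : 0 < sn by rewrite sqrtr_gt0.
have sqr_sn : sn ^+ 2 = n%:R by rewrite sqr_sqrtr// ltW.
have sn1 : 1 <= sn by rewrite -[leLHS]sqrtr1 ler_wsqrtr.
pose V (g : 'I_n -> nat) : R := occ_dev R pi (n ^ 4) g.
have h1 : unif_mean (fun s : 'S_n => `|occ_normalized R pi s|) <=
    unif_mean (fun s : 'S_n => `|V (fun i => s i)|) + 2 * r%:R ^+ 2.
  rewrite -[X in _ + X](unif_mean_cst n) -unif_meanD; apply: ler_unif_mean => s.
  have := occ_normalized_dev R N0 n0 pi s r0; rewrite -/(V _).
  have : 2 * r%:R ^+ 2 * (n%:R / (n ^ 4)%:R) <= 2 * r%:R ^+ 2 :> R.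
    rewrite ler_piMr ?mulr_ge0 ?exprn_ge0// natrX ler_pdivrMr ?exprn_gt0// mul1r.
    by rewrite -[leLHS]expr1 ler_weXn2l.
  have := ler_distD (V (fun i => s i)) (occ_normalized R pi s) 0; rewrite !subr0; lra.
have h2 : `|pexp (unifw R (N := n ^ 4)) (fun Y : {ffun 'I_n -> 'I_(n ^ 4)} => `|V (fun i => Y i)|) -
    unif_mean (fun s : 'S_n => `|V (fun i => s i)|)| <= 2.
  apply: le_trans (@pexp_perm_mean R n (n ^ 4) N0 sn _ (fun s : 'S_n => `|V (fun i => s i)|) _ _ _) _ => [Y|s|Y s hs|].
  - by rewrite normr_id occ_dev_le.
  - by rewrite normr_id occ_dev_le.
  - by rewrite /V /occ_dev (occ_fun_pat _ hs).
  rewrite -mulrA -[leRHS]mulr1 ler_wpM2l// natrX mulrA ler_pdivrMr ?exprn_gt0// mul1r.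
  apply: (@le_trans _ _ (n%:R * n%:R ^+ 2)).
    by rewrite ler_wpM2r ?exprn_ge0// -sqr_sn ler_eXnr.
  by rewrite -exprS ler_weXn2l.
have h3 : pexp (unifw R (N := n ^ 4)) (fun Y : {ffun 'I_n -> 'I_(n ^ 4)} => `|V (fun i => Y i)|) <=
    (1 + 2 * (r%:R ^+ 2 + rem_const R r ^+ 2)) / 2.
  apply: (@le_trans _ _ (pexp (unifw R (N := n ^ 4)) (fun Y : {ffun 'I_n -> 'I_(n ^ 4)} =>
     (1 + V (fun i => Y i) ^+ 2) / 2))).
    apply: ler_pexp => [|Y]; first exact: unifw_ge0.
    rewrite -(real_normK (num_real (V _))); have := sqr_ge0 (1 - `|V (fun i => Y i)|); nra.
  rewrite pexpZr pexpD pexp_cst; last exact: unifw_sum.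
  by rewrite ler_pM2r// lerD2l; exact: pexp_occ_dev_sqr.
have h4 : 0 <= r%:R ^+ 2 :> R by rewrite exprn_ge0.
have h5 := sqr_ge0 (rem_const R r).
move: h2; rewrite ler_norml /abs_const => /andP[]; lra.
Qed.

End AbsoluteMoment.

Lemma inv_perm_Occ (n : nat) (s : 'S_n) :
  inv_perm s = Occ (tperm ord0 ord_max : 'S_2) s.
Proof.
rewrite Occ_occ_fun /occ_fun /inv_perm; set A := (X in #|X| = _); set rho : 'S_2 := tperm _ _.
pose f (e : {ffun 'I_2 -> 'I_n}) : 'I_n * 'I_n := (e ord0, e ord_max).
pose g (p : 'I_n * 'I_n) : {ffun 'I_2 -> 'I_n} := [ffun i => if i == ord0 then p.1 else p.2].
have I2 (i : 'I_2) : i = ord0 \/ i = ord_max.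
  by case: i => -[|[|//]] i2; [left|right]; exact: val_inj.
have fK : cancel f g by move=> e; apply/ffunP => i; rewrite ffunE; case: (I2 i) => ->.
have gK : cancel g f by move=> -[a b]; rewrite /f !ffunE.
rewrite -(on_card_preimset (f := f)); last by exists g => x _; [exact: fK|exact: gK].
apply: eq_card => e; rewrite !inE /=; congr (_ && _).
  apply/idP/forallP => [h j|/(_ ord0)/forallP/(_ ord_max)//]; apply/forallP => k.
  by case: (I2 j) => ->; case: (I2 k) => ->; rewrite ?ltnn// h implybT.
have r0 : rho ord0 = ord_max by rewrite tpermL.
have r1 : rho ord_max = ord0 by rewrite tpermR.
apply/idP/patP => [h j k|H]; last by rewrite H r0 r1.
by case: (I2 j) => ->; case: (I2 k) => ->; rewrite ?r0 ?r1 ?ltnn// ?h// ltnNge ltnW.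
Qed.

(** * Total variation distance between the Mallows and uniform laws *)

Section TotalVariation.
Variable R : realType.

Lemma expR_le2 (x : R) : `|x| <= 2^-1 -> expR x <= 1 + x + 2 * x ^+ 2.
Proof.
rewrite ler_norml => /andP[x1 x2]; have x3 : 0 < 1 - x by lra.
have h : expR x <= (1 - x)^-1.
  by rewrite -[expR x]invrK -expRN lef_pV2 ?posrE ?expR_gt0// expR_ge1Dx.
apply: le_trans h _; rewrite -div1r ler_pdivrMr//; nra.
Qed.

Lemma sum_centered (k : nat) : \sum_(j < k) ((k%:R - 1) / 2 - j%:R) = 0 :> R.
Proof.
have h : \sum_(j < k) j%:R = k%:R * (k%:R - 1) / 2 :> R.
  elim: k => [|k IHk]; first by rewrite big_ord0 !mul0r.
  by rewrite big_ord_recr /= IHk -[k.+1%:R]natr1; field.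
by rewrite sumrB h sumr_const card_ord -[X in X - _]mulr_natl mulrA subrr.
Qed.

(* After centring the exponents the first-order terms sum to 0, which leaves an
   error quadratic in [l]. *)
Lemma mallows_factor_le (l B : R) (k : nat) : 0 <= l -> l * B <= 1 -> k%:R <= B ->
  expR (l * ((k%:R - 1) / 2)) * \sum_(j < k) expR (- l) ^+ j <= k%:R * expR (l ^+ 2 * B ^+ 2).
Proof.
move=> l0 lB kB.
have k0 : 0 <= k%:R :> R by [].
apply: (@le_trans _ _ (\sum_(j < k) (1 + l * ((k%:R - 1) / 2 - j%:R) + l ^+ 2 * B ^+ 2))).
  rewrite mulr_sumr; apply: ler_sum => j _.
  rewrite -expRM_natr -expRD.
  have -> : l * ((k%:R - 1) / 2) + - l * j%:R = l * ((k%:R - 1) / 2 - j%:R) by ring.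
  have jk : j%:R + 1 <= k%:R :> R by rewrite natr1 ler_nat.
  have j0 : 0 <= j%:R :> R by [].
  set y : R := (k%:R - 1) / 2 - j%:R.
  have yB : `|y| <= B / 2 by rewrite ler_norml /y; apply/andP; split; lra.
  have lyB : `|l * y| <= l * B / 2 by rewrite normrM (ger0_norm l0) -mulrA ler_wpM2l.
  apply: le_trans (expR_le2 _) _; first by apply: le_trans lyB _; lra.
  rewrite lerD2l -(real_normK (num_real (l * y))).
  have : `|l * y| ^+ 2 <= (l * B / 2) ^+ 2 by rewrite lerXn2r// nnegrE ?(le_trans (normr_ge0 _) lyB).
  have := mulr_ge0 (sqr_ge0 l) (sqr_ge0 B).
  have -> : (l * B / 2) ^+ 2 = l ^+ 2 * B ^+ 2 / 4 by field.
  lra.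
rewrite big_split big_split/= -mulr_sumr sum_centered mulr0 addr0 !sumr_const card_ord.
by rewrite -mulrnDl -[leLHS]mulr_natl ler_wpM2l// expR_ge1Dx.
Qed.

Lemma mallows_ZE (n : nat) (q : R) : q != 1 ->
  mallows_Z n q = \prod_(1 <= k < n.+1) \sum_(j < k) q ^+ j.
Proof.
move=> q1; apply: eq_bigr => k _; rewrite -opprB subrX1 -(opprB q 1) invrN mulrNN.
by rewrite mulrAC mulfV ?mul1r// subr_eq0.
Qed.

Lemma mallows_Z_gt0 (n : nat) (q : R) : 0 < q < 1 -> 0 < mallows_Z n q.
Proof.
move=> /andP[q0 q1]; rewrite /mallows_Z big_nat; apply: prodr_gt0 => k /andP[k0 _].
by rewrite divr_gt0// subr_gt0// exprn_ilt1// -?lt0n// ltW.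
Qed.

Lemma mallows_mass_ge0 (n : nat) (q : R) (s : 'S_n) : 0 < q < 1 -> 0 <= mallows_mass q s.
Proof.
move=> q01; have /andP[q0 _] := q01.
by rewrite divr_ge0 ?exprn_ge0 ?(ltW q0)// ltW// mallows_Z_gt0.
Qed.

(** Product of the bounds on the factors [k = 1, ..., n]; the centring exponents [(k - 1) / 2] add
    up to half of [C(n, 2)], the uniform mean of the inversion number. The bound [B] stays fixed
    along the induction. *)
Lemma mallows_Z_le (n : nat) (l B : R) : 0 < l -> l * B <= 1 -> n%:R <= B ->
  expR (l * (2^-1 * 'C(n, 2)%:R)) * mallows_Z n (expR (- l)) <=
  n`!%:R * expR (l ^+ 2 * B ^+ 2 * n%:R).
Proof.
move=> l0 lB; have q1 : expR (- l) != 1 by rewrite lt_eqF// expR_lt1 oppr_lt0.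
elim: n => [|n IHn] nB.
  by rewrite mallows_ZE// big_nil bin0n !mulr0 !expR0 fact0 mulr1.
have nB' : n%:R <= B by apply: le_trans nB; rewrite ler_nat.
have := ler_pM _ _ (IHn nB') (mallows_factor_le (ltW l0) lB nB).
have -> : expR (l * (2^-1 * 'C(n, 2)%:R)) * mallows_Z n (expR (- l)) *
    (expR (l * ((n.+1%:R - 1) / 2)) * \sum_(j < n.+1) expR (- l) ^+ j) =
    expR (l * (2^-1 * 'C(n.+1, 2)%:R)) * mallows_Z n.+1 (expR (- l)).
  rewrite !mallows_ZE// [in RHS]big_nat_recr//= mulrACA -expRD; congr (expR _ * _).
  by rewrite binS bin1 natrD -natr1; field.
have -> : n`!%:R * expR (l ^+ 2 * B ^+ 2 * n%:R) * (n.+1%:R * expR (l ^+ 2 * B ^+ 2)) =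
    n.+1`!%:R * expR (l ^+ 2 * B ^+ 2 * n.+1%:R).
  by rewrite mulrACA -expRD factS natrM mulrC [n`!%:R * _]mulrC mulrC -natr1; congr (_ * expR _); ring.
have Z0 : 0 < mallows_Z n (expR (- l)) by rewrite mallows_Z_gt0// expR_gt0 expR_lt1 oppr_lt0.
apply; rewrite mulr_ge0 ?expR_ge0 ?(ltW Z0)//.
by apply: sumr_ge0 => j _; rewrite exprn_ge0 ?expR_ge0.
Qed.

(** The upper bound on [mallows_Z] bounds the density with respect to the uniform law below by an
    exponential, and [1 + x <= exp x] makes that bound linear. *)
Lemma mallows_density_ge (n : nat) (l : R) (s : 'S_n) : 0 < l -> l * n%:R <= 1 ->
  1 - (l * ((inv_perm s)%:R - 2^-1 * 'C(n, 2)%:R) + l ^+ 2 * n%:R ^+ 3) <=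
  mallows_mass (expR (- l)) s * n`!%:R.
Proof.
move=> l0 ln; have Z0 : 0 < mallows_Z n (expR (- l)).
  by rewrite mallows_Z_gt0// expR_gt0 expR_lt1 oppr_lt0.
apply: (@le_trans _ _ (expR (- (l * ((inv_perm s)%:R - 2^-1 * 'C(n, 2)%:R) + l ^+ 2 * n%:R ^+ 3)))).
  exact: expR_ge1Dx.
rewrite /mallows_mass [leRHS]mulrAC ler_pdivlMr//.
have h := mallows_Z_le l0 ln (lexx _).
have -> : l * ((inv_perm s)%:R - 2^-1 * 'C(n, 2)%:R) + l ^+ 2 * n%:R ^+ 3 =
  - (- l * (inv_perm s)%:R + l * (2^-1 * 'C(n, 2)%:R) - l ^+ 2 * n%:R ^+ 2 * n%:R) by ring.
rewrite opprK !expRD expRM_natr [expR (- (l ^+ 2 * _ * _))]expRN.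
move: h; move: (expR (l * _)) (mallows_Z _ _) (n`!%:R) => a z c h.
have e0 : 0 < expR (l ^+ 2 * n%:R ^+ 2 * n%:R) by exact: expR_gt0.
have -> : expR (- l) ^+ inv_perm s * a / expR (l ^+ 2 * n%:R ^+ 2 * n%:R) * z =
  expR (- l) ^+ inv_perm s * (a * z / expR (l ^+ 2 * n%:R ^+ 2 * n%:R)).
  by rewrite -!mulrA; congr (_ * (_ * _)); rewrite mulrC.
by rewrite ler_wpM2l ?exprn_ge0 ?expR_ge0// ler_pdivrMr.
Qed.

Lemma tv_mallows_unif (n : nat) (q : R) : (0 < n)%N -> 0 < q < 1 ->
  \sum_(s : 'S_n) mallows_mass q s = 1 ->
  let x := n%:R `^ (3 / 2) * (1 - q) in x <= 4^-1 ->
  \sum_(s : 'S_n) `|mallows_mass q s - n`!%:R^-1| <= 4 * abs_const R 2 * x + 8 * x ^+ 2.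
Proof.
move=> n0 /andP[q0 q1] mass1 x x4.
have nR0 : 0 < n%:R :> R by rewrite ltr0n.
have nR1 : 1 <= n%:R :> R by rewrite ler1n.
have fn0 : 0 < n`!%:R :> R by rewrite ltr0n fact_gt0.
set N32 : R := n%:R `^ (3 / 2) in x x4 *.
have N32E : N32 = n%:R `^ (2%:R - 2^-1) by congr (_ `^ _); lra.
have n32 : n%:R <= N32.
  rewrite N32E scale_powR// expr1 ler_peMr ?(ltW nR0)//.
  by rewrite -[leLHS]sqrtr1 ler_wsqrtr.
have N32sq : N32 ^+ 2 = n%:R ^+ 3.
  by rewrite N32E scale_powR// expr1 exprMn sqr_sqrtr ?(ltW nR0)// -exprSr.
pose l : R := - ln q.
have qE : q = expR (- l) by rewrite opprK lnK.
have l0 : 0 < l by rewrite oppr_gt0 ln_lt0// q0.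
(* As [n ^ (3/2) >= 1], the hypothesis [x <= 1/4] forces [1 - q <= 1/4]; staying away from [q = 0]
   is what allows [- ln q <= 2 (1 - q)]. *)
have q34 : 3 / 4 <= q.
  have : 1 - q <= x by rewrite /x ler_peMl ?subr_ge0 ?(ltW q1)// (le_trans nR1).
  lra.
have lq : l <= 2 * (1 - q).
  have : 1 + l <= q^-1 by rewrite qE expRN invrK expR_ge1Dx.
  have : q^-1 <= 1 + 2 * (1 - q) by rewrite -div1r ler_pdivrMr//; nra.
  lra.
have lx : l * N32 <= 2 * x by rewrite /x mulrCA mulrC ler_wpM2l// (le_trans (ltW nR0)).
have ln1 : l * n%:R <= 1 by apply: (le_trans (ler_wpM2l (ltW l0) n32)); lra.
pose L (s : 'S_n) := mallows_mass q s * n`!%:R.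
pose D (s : 'S_n) : R := 2 * (l * N32) * `|occ_normalized R (tperm ord0 ord_max : 'S_2) s| + 2 * (l * N32) ^+ 2.
(* Since [|y| = y + 2 max (0, - y)] and [D] is at least twice the deficit [1 - L], the density
   enters only through its lower bound. As [L] has uniform mean 1, averaging leaves the mean of
   [D]. *)
have LD s : `|L s - 1| <= (L s - 1) + D s.
  have := mallows_density_ge s l0 ln1; rewrite -qE -/(L s) => h.
  have h1 : l * ((inv_perm s)%:R - 2^-1 * 'C(n, 2)%:R) <=
      (l * N32) * `|occ_normalized R (tperm ord0 ord_max : 'S_2) s|.
    rewrite -mulrA ler_wpM2l ?(ltW l0)// inv_perm_Occ /occ_normalized -N32E.
    rewrite normrM normrV ?unitfE ?gt_eqF ?(lt_le_trans nR0)//.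
    rewrite [`|N32|]ger0_norm ?(le_trans (ltW nR0))// mulrCA mulfV ?mulr1 ?gt_eqF ?(lt_le_trans nR0)//.
    exact: ler_norm.
  have h2 : l ^+ 2 * n%:R ^+ 3 = (l * N32) ^+ 2 by rewrite exprMn N32sq.
  have h3 : 0 <= l * N32 * `|occ_normalized R (tperm ord0 ord_max : 'S_2) s|.
    by rewrite !mulr_ge0 ?(ltW l0)// (le_trans (ltW nR0)).
  have h4 := sqr_ge0 (l * N32).
  rewrite /D ler_norml; apply/andP; split; lra.
have -> : \sum_(s : 'S_n) `|mallows_mass q s - n`!%:R^-1| = unif_mean (fun s => `|L s - 1|).
  rewrite /unif_mean mulr_suml; apply: eq_bigr => s _.
  rewrite -[X in _ / X](ger0_norm (ltW fn0)) -normrV ?unitfE ?gt_eqF// -normrM mulrBl.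
  by rewrite /L mulfK ?gt_eqF// mul1r.
apply: le_trans (ler_unif_mean LD) _.
have mL : unif_mean L = 1 by rewrite /unif_mean /L -mulr_suml mass1 mul1r mulfV// gt_eqF.
rewrite (@unif_meanD _ _ (fun s => L s - 1)) (@unif_meanD _ _ L) mL unif_mean_cst subrr add0r.
rewrite /D unif_meanD unif_mean_cst unif_meanZ.
have h1 := unif_mean_abs_occ R (tperm ord0 ord_max : 'S_2) n0 (isT : (0 < 2)%N).
have lN0 : 0 <= l * N32 by rewrite mulr_ge0 ?(ltW l0)// (le_trans (ltW nR0)).
apply: lerD.
  have -> : 4 * abs_const R 2 * x = 2 * (2 * x) * abs_const R 2 by ring.
  apply: ler_pM h1; first by rewrite pmulr_rge0.
    rewrite -[leLHS](unif_mean_cst n); exact: ler_unif_mean.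
  by rewrite ler_wpM2l.
have -> : 8 * x ^+ 2 = 2 * (2 * x) ^+ 2 by ring.
by rewrite ler_wpM2l// lerXn2r// nnegrE (le_trans lN0).
Qed.

End TotalVariation.

Section NuCovariance.
Variables (R : realType) (m : nat) (r : 'I_m -> nat) (pi : forall a, 'S_(r a)).
Hypothesis r0 : forall a, (0 < r a)%N.

Lemma nu_covC a b : nu_cov R (pi a) (pi b) = nu_cov R (pi b) (pi a).
Proof.
rewrite !nu_covE//; congr (limn _); apply/funext => n; rewrite /lin_cov; congr (_ / _).
by apply: eq_bigr => i _; congr (_ / _); apply: eq_bigr => y _; rewrite mulrC.
Qed.

(** The form is a limit of second moments of linear combinations of projections. *)
Lemma nu_cov_psd (t : 'I_m -> R) : 0 <= \sum_a \sum_b t a * t b * nu_cov R (pi a) (pi b).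
Proof.
have h : (fun n => \sum_a \sum_b t a * t b * lin_cov R (pi a) (pi b) n (n ^ 4)) @ \oo -->
    \sum_a \sum_b t a * t b * nu_cov R (pi a) (pi b).
  apply: cvg_sumr => a _; apply: cvg_sumr => b _; apply: cvgMr; exact: cvg_lin_cov_nu.
rewrite -(cvg_lim (@Rhausdorff R) h); apply: limr_ge; first by apply/cvg_ex; eexists; exact: h.
exists 1%N => //= n n0; have N0 : (0 < n ^ 4)%N by rewrite expn_gt0 n0.
have -> : \sum_a \sum_b t a * t b * lin_cov R (pi a) (pi b) n (n ^ 4) =
  pexp (unifw R (N := n ^ 4)) (fun Y : {ffun 'I_n -> 'I_(n ^ 4)} =>
    (\sum_a t a * lin_stat R (pi a) (n ^ 4) (fun i => Y i)) ^+ 2).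
  transitivity (pexp (unifw R (N := n ^ 4)) (fun Y : {ffun 'I_n -> 'I_(n ^ 4)} =>
     \sum_a \sum_b t a * t b * (lin_stat R (pi a) (n ^ 4) (fun i => Y i) * lin_stat R (pi b) (n ^ 4) (fun i => Y i)))).
    rewrite pexp_sum; apply: eq_bigr => a _; rewrite pexp_sum; apply: eq_bigr => b _.
    by rewrite pexpZ (@pexp_lin_statM R n _ N0).
  apply: eq_pexp => Y; rewrite expr2 big_distrlr; apply: eq_bigr => a _.
  by apply: eq_bigr => b _; rewrite mulrACA.
apply: pexp_ge0 => [||Y]; [exact: unifw_ge0|exact: unifw_sum|exact: sqr_ge0].
Qed.

End NuCovariance.

(** * Convergence in law for Mallows permutations *)

Section MallowsExpectation.
Variables (R : realType) (n : nat) (q : R).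
Context d (Omega : measurableType d) (P : probability Omega R) (tau : Omega -> 'S_n).
Hypothesis htau : mallows_rv P q tau.

Lemma mallows_expectation (f : 'S_n -> R) :
  'E_P[fun w => f (tau w)]%E = (\sum_s mallows_mass q s * f s)%:E.
Proof.
have mA s : measurable (tau @^-1` [set s]) by have [] := htau s.
pose h (s : 'S_n) w : R := f s * \1_(tau @^-1` [set s]) w.
have fE w : f (tau w) = \sum_s h s w.
  rewrite (bigD1 (tau w))//= big1 => [|s /eqP sw]; rewrite /h indicE.
    by rewrite mem_set// mulr1 addr0.
  by rewrite memNset ?mulr0// => ws; apply: sw.
have mh s : measurable_fun setT (h s) by apply: measurable_funM => //; exact: measurable_indic.
have i1 s w : `|\1_(tau @^-1` [set s]) w : R| <= 1.
  by rewrite indicE; case: (_ \in _); rewrite /= ?normr1 ?normr0.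
have hb s w : `|h s w| <= `|f s| by rewrite normrM ler_piMr.
have mf : measurable_fun setT (fun w => f (tau w)).
  by under eq_fun do rewrite fE; exact: measurable_sum.
rewrite unlock -[LHS]fineK; last first.
  apply: (integrable_fin_num measurableT).
  apply: (@integrable_bounded _ _ _ P (fun w => f (tau w)) (\sum_s `|f s|)) => // w.
  by rewrite fE (le_trans (ler_norm_sum _ _ _))// ler_sum.
congr EFin; transitivity (\int[P]_w (\sum_s h s w))%R.
  by apply: eq_Rintegral => w _; rewrite fE.
rewrite (@Rintegral_bounded_sum _ _ _ P _ (index_enum _) h (fun s => `|f s|))//; apply: eq_bigr => s _.
rewrite /h RintegralZl//; last first.
  by apply: (@integrable_bounded _ _ _ P _ 1) => //; exact: measurable_indic.
rewrite mulrC; congr (_ * _).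
by rewrite /Rintegral integral_indic// setIT; have [_ e] := htau s; exact: (congr1 fine e).
Qed.

(** Total mass one is read off from the law of [tau], a random variable on a probability space,
    instead of from the generating function of inversions. *)
Lemma mallows_mass_sum : \sum_(s : 'S_n) mallows_mass q s = 1.
Proof.
have := mallows_expectation (fun=> 1); rewrite -[X in 'E_P[X]%E]/(cst 1) expectation_cst => -[->].
by apply: eq_bigr => s _; rewrite mulr1.
Qed.

End MallowsExpectation.

Section MallowsCLT.
Variables (R : realType) (q : nat -> R).
Hypothesis hq : forall n : nat, 0 < q n < 1.
Hypothesis hq_lim : (fun n : nat => n%:R `^ (3 / 2) * (1 - q n)) @ \oo --> (0 : R).
Hypothesis mass1 : forall n, \sum_(s : 'S_n) mallows_mass (q n) s = 1.

Lemma cvg_tv : (fun n => \sum_(s : 'S_n) `|mallows_mass (q n) s - n`!%:R^-1|) @ \oo --> (0 : R).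
Proof.
apply: (@cvg_norm_le0 _ _ (fun n => 4 * abs_const R 2 * (n%:R `^ (3 / 2) * (1 - q n)) +
   8 * (n%:R `^ (3 / 2) * (1 - q n)) ^+ 2)); last first.
  rewrite -[X in _ --> X](addr0 (0 : R)); apply: cvgD.
    by rewrite -[X in _ --> X](mulr0 (4 * abs_const R 2)); exact: cvgMr.
  rewrite -[X in _ --> X](mulr0 8); apply: cvgMr; rewrite -[X in _ --> X](mulr0 (0 : R)).
  exact: cvgM.
have x4 : \forall n \near \oo, n%:R `^ (3 / 2) * (1 - q n) <= 4^-1.
  by apply: (cvgr_le _ hq_lim); rewrite invr_gt0.
near=> n; rewrite ger0_norm ?sumr_ge0//; apply: tv_mallows_unif => //; last by near: n.
by near: n; exists 1%N.
Unshelve. all: by end_near. Qed.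

Lemma mallows_unif_dist (n : nat) (H : 'S_n -> R) (M : R) : (forall s, `|H s| <= M) ->
  `|\sum_s mallows_mass (q n) s * H s - unif_mean H| <=
  M * \sum_(s : 'S_n) `|mallows_mass (q n) s - n`!%:R^-1|.
Proof.
move=> HM; rewrite /unif_mean mulr_suml -sumrB mulr_sumr.
apply: le_trans (ler_norm_sum _ _ _) _; apply: ler_sum => s _.
by rewrite [H s * _]mulrC -mulrBl normrM mulrC ler_wpM2r.
Qed.

Variables (m : nat) (r : 'I_m -> nat) (pi : forall a, 'S_(r a)).
Hypothesis r0 : forall a, (0 < r a)%N.

Local Notation X s := (\row_(a < m) occ_normalized R (pi a) s).

Lemma mallows_cvg_cos (t : 'I_m -> R) (theta : R) :
  (fun n => \sum_(s : 'S_n) mallows_mass (q n) s * cos (trig_phase t (X s) + theta)) @ \oo -->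
  cos theta * expR (- ((\sum_a \sum_b t a * t b * nu_cov R (pi a) (pi b)) / 2)).
Proof.
apply: cvg_near0 (unif_clt r0 (t := t) (theta := theta)).
apply: (@cvg_norm_le0 _ _ (fun n => \sum_(s : 'S_n) `|mallows_mass (q n) s - n`!%:R^-1|)); last exact: cvg_tv.
apply: nearW => n.
have -> : unif_mean (fun s : 'S_n => cos (theta + \sum_a t a * occ_normalized R (pi a) s)) =
    unif_mean (fun s : 'S_n => cos (trig_phase t (X s) + theta)).
  apply: eq_unif_mean => s; rewrite addrC /trig_phase; congr (cos (_ + _)).
  by apply: eq_bigr => a _; rewrite mxE.
by rewrite -[leRHS]mul1r; apply: mallows_unif_dist => s; exact: cos_max.
Qed.

(** Markov's inequality for the uniform law and the total variation distance contribute at most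
    [e / 2] each. The 1 in [K] keeps it positive even if [C = 0]. *)
Lemma mallows_tight (e : R) : 0 < e -> exists K : R, \forall n \near \oo,
  \sum_(s : 'S_n) mallows_mass (q n) s * (~~ [forall a, `|X s ord0 a| <= K])%:R <= e.
Proof.
move=> e0; pose C : R := \sum_a abs_const R (r a).
have C0 : 0 <= C.
  by apply: sumr_ge0 => a _; rewrite mulr_ge0// !addr_ge0 ?sqr_ge0.
pose K : R := 2 * (C + 1) / e.
have K0 : 0 < K by rewrite divr_gt0// mulr_gt0// ltr_wpDl.
exists K.
have tv : \forall n \near \oo, \sum_(s : 'S_n) `|mallows_mass (q n) s - n`!%:R^-1| <= e / 2.
  by apply: (cvgr_le _ cvg_tv); rewrite divr_gt0.
have n1 : \forall n \near \oo, (0 < n)%N by exists 1%N.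
apply: filterS2 tv n1 => n tv n0.
pose H (s : 'S_n) : R := (~~ [forall a, `|X s ord0 a| <= K])%:R.
have H1 s : `|H s| <= 1 by rewrite /H; case: (~~ _); rewrite /= ?normr1 ?normr0.
have := mallows_unif_dist H1; rewrite mul1r => /le_trans/(_ tv) h.
have : unif_mean H <= C / K.
  apply: (@le_trans _ _ (unif_mean (fun s : 'S_n => K^-1 * \sum_a `|occ_normalized R (pi a) s|))).
    apply: ler_unif_mean => s; rewrite /H.
    have S0 : 0 <= \sum_a `|occ_normalized R (pi a) s| by apply: sumr_ge0.
    case: (boolP [forall a, _]) => [_|/forallPn[a]] /=.
      by rewrite mulr_ge0// invr_ge0 ltW.
    rewrite mxE -ltNge => /ltW Ka; rewrite mulrC ler_pdivlMr// mul1r; apply: le_trans Ka _.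
    by rewrite (bigD1 a)//= lerDl sumr_ge0.
  rewrite unif_meanZ mulrC ler_pM2r ?invr_gt0//.
  rewrite /unif_mean exchange_big mulr_suml; apply: ler_sum => a _.
  exact: unif_mean_abs_occ.
have : C / K <= e / 2.
  rewrite /K invf_div mulrA ler_pdivrMr ?mulr_gt0 ?ltr_wpDl//.
  have -> : e / 2 * (2 * (C + 1)) = C * e + e by field.
  by rewrite lerDl ltW.
by move: h; rewrite ler_norml /H => /andP[]; lra.
Qed.

End MallowsCLT.

Section MallowsConvergence.
Variables (R : realType) (q : nat -> R).
Hypothesis hq : forall n : nat, 0 < q n < 1.
Hypothesis hq_lim : (fun n : nat => n%:R `^ (3 / 2) * (1 - q n)) @ \oo --> (0 : R).
Variables (d : nat -> measure_display) (Omega : forall n : nat, measurableType (d n))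
  (P : forall n : nat, probability (Omega n) R) (tau : forall n : nat, Omega n -> 'S_n).
Hypothesis htau : forall n : nat, mallows_rv (P n) (q n) (@tau n).

Theorem mallows_occ_cvg (m : nat) (r : 'I_m -> nat) (pi : forall a, 'S_(r a))
    (d' : measure_display) (T : measurableType d') (Q : probability T R) (G : 'I_m -> {RV Q >-> R}) :
  (forall a, (0 < r a)%N) ->
  (forall (t : 'I_m -> R) (theta : R),
    (\int[Q]_w cos (trig_phase t (\row_a G a w) + theta))%R =
    cos theta * expR (- ((\sum_a \sum_b t a * t b * nu_cov R (pi a) (pi b)) / 2))) ->
  cvg_in_distribution P (fun n w => \row_(a < m) occ_normalized R (pi a) (@tau n w))
    Q (fun w => \row_(a < m) G a w).
Proof.
move=> r0 hG f cf [M0 [_ bM]].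
(* [bounded_fun] guarantees a bound only for numbers strictly above [M0], hence the shift by 1. *)
pose M := M0 + 1; have fM x : `|f x| <= M by apply: bM => //; rewrite ltrDl.
have mass1 (n : nat) : \sum_(s : 'S_n) mallows_mass (q n) s = 1 by exact: (mallows_mass_sum (@htau n)).
pose X n (s : 'S_n) : 'rV[R]_m := \row_(a < m) occ_normalized R (pi a) s.
have mass0 n (s : 'S_n) : 0 <= mallows_mass (q n) s by exact: mallows_mass_ge0.
have H := @cvg_bounded_continuous R m (fun n => 'S_n) (fun n s => mallows_mass (q n) s) X
  mass0 mass1 _ _ Q G _ (mallows_tight hq hq_lim mass1 pi r0) f M cf fM.
have [g [tg gM gf]] := trig_approx_seq cf fM.
(* Called for the measurability of [f] along the vector [G]. *)
have [mf _] := cvg_Rintegral_approx (Q := Q) G tg gM gf.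
have E n : ('E_(P n)[fun w => f (\row_(a < m) occ_normalized R (pi a) (@tau n w))] =
    (\sum_(s : 'S_n) mallows_mass (q n) s * f (X n s))%:E)%E.
  exact: (mallows_expectation (@htau n) (fun s => f (X n s))).
under eq_fun do rewrite E.
have -> : ('E_Q[fun w => f (\row_a G a w)] = (\int[Q]_w f (\row_a G a w))%R%:E)%E.
  rewrite unlock -[LHS]fineK//; apply: (integrable_fin_num measurableT).
  exact: (@integrable_bounded _ _ _ Q _ M).
apply: cvg_EFin; first exact: nearW.
apply: H => t theta; rewrite hG.
exact: mallows_cvg_cos.
Qed.

End MallowsConvergence.

Theorem corollary2p2 (R : realType) (q : nat -> R)
    (hq : forall n : nat, 0 < q n < 1)
    (hq_lim : (fun n : nat => n%:R `^ (3 / 2) * (1 - q n)) @ \oo --> (0 : R))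
    (d : nat -> measure_display) (Omega : forall n : nat, measurableType (d n))
    (P : forall n : nat, probability (Omega n) R)
    (tau : forall n : nat, Omega n -> 'S_n)
    (htau : forall n : nat, mallows_rv (P n) (q n) (tau n)) :
  (forall (r : nat) (pi : 'S_r), (2 <= r)%N ->
     0 < nu R pi /\
     cvg_in_distribution P (fun n w => occ_normalized R pi (tau n w))
       (normal_prob (0 : R) (nu R pi)) (fun x : R => x)) /\
  (forall (m : nat) (r : 'I_m -> nat) (pi : forall i : 'I_m, 'S_(r i)),
     (forall i : 'I_m, (2 <= r i)%N) ->
     exists (d' : measure_display) (Omega' : measurableType d')
       (Q : probability Omega' R) (G : 'I_m -> {RV Q >-> R}),
       centered_gaussian_vector G (\matrix_(i, j) nu_cov R (pi i) (pi j)) /\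
       cvg_in_distribution P
         (fun n w => \row_(i < m) occ_normalized R (pi i) (tau n w))
         Q (fun w => \row_(i < m) G i w)).
Proof.
split=> [r pi r2|m r pi r2].
  have v0 := nu_cov_gt0 R pi r2.
  have nu0 : 0 < nu R pi by rewrite sqrtr_gt0.
  split=> // f cf [M0 [M0r bM]].
  (* The limit law itself carries the identity variable, seen as a vector of dimension one, so the
     vector statement covers a single pattern. *)
  pose G (_ : 'I_1) : {mfun (g_sigma_algebraType R.-ocitv.-measurable) >-> R} :=
    mkRV (@measurable_id _ (g_sigma_algebraType R.-ocitv.-measurable) setT).
  have hG (t : 'I_1 -> R) (theta : R) :
    (\int[normal_prob 0 (nu R pi)]_w cos (trig_phase t (\row_a G a w) + theta))%R =
    cos theta * expR (- ((\sum_(a < 1) \sum_(b < 1) t a * t b * nu_cov R pi pi) / 2)).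
    transitivity (\int[normal_prob 0 (nu R pi)]_w cos (t ord0 * w + theta))%R.
      by apply: eq_Rintegral => w _; rewrite /trig_phase big_ord1 mxE.
    rewrite [LHS]normal_prob_cos// !big_ord1 sqr_sqrtr ?(ltW v0)//.
    by rewrite mulrC -expr2 mulrC [_ * nu_cov _ _ _]mulrC.
  have r0 (a : 'I_1) : (0 < r)%N by exact: ltnW.
  pose h (x : 'rV[R]_1) := f (x ord0 ord0).
  have ch : continuous h.
    by move=> x; exact: (continuous_comp (@coord_continuous R 1 1 ord0 ord0 x) (cf _)).
  have bh : bounded_fun h by exists M0; split => // x Mx y _; exact: bM.
  have := @mallows_occ_cvg R q hq hq_lim d Omega P tau htau 1 (fun=> r) (fun=> pi) _ _ _ G r0 hG h ch bh.
  under eq_fun => n do under [X in expectation _ X]eq_fun do rewrite /h mxE.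
  under [X in _ --> expectation _ X]eq_fun do rewrite /h mxE.
  by [].
have r0 a : (0 < r a)%N by apply: ltnW.
pose S : 'M[R]_m := \matrix_(i, j) nu_cov R (pi i) (pi j).
have sS : S^T = S by apply/matrixP => i j; rewrite !mxE nu_covC.
have quadE t : quad_form (fun i j => S i j) t = \sum_a \sum_b t a * t b * nu_cov R (pi a) (pi b).
  by apply: eq_bigr => a _; apply: eq_bigr => b _; rewrite mxE.
have S0 t : 0 <= quad_form (fun i j => S i j) t by rewrite quadE nu_cov_psd.
have [d' [T [Q [G [gG hG]]]]] := gaussian_vector_exists sS S0.
exists d', T, Q, G; split => //; apply: (mallows_occ_cvg hq hq_lim htau) => // t theta.
by rewrite hG quadE.
Qed.
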